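(* Suppose that there is a constant $L_f\ge0$ such that $$|f(t_1,x_1,y_1,z_1)-f(t_2,x_2,y_2,z_2)|\le L_f\big(\sqrt{|t_1-t_2|}+|x_1-x_2|+|y_1-y_2|+\|z_1-z_2\|\big)$$ for all $t_1,t_2\in[0,T]$, $x_1,x_2\in\mathbb{R}^d$, $y_1,y_2\in\mathbb{R}$, $z_1,z_2\in\mathbb{R}^d$, and that $\Phi$ is measurable and bounded. Then the stochastic multi-step predictor-corrector scheme (S) given in the context is numerically stable ($\mathbb{L}_2$-stable, as defined in the context) if and only if its characteristic polynomial $$P(\zeta)=\zeta^m-\alpha_1\zeta^{m-1}-\alpha_2\zeta^{m-2}-\cdots-\alpha_m$$ satisfies Dahlquist's root condition: (i) the roots of $P$ lie on or within the unit circle, and (ii) the roots on the unit circle are simple.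
   Context: Setting. $T>0$; $W$ is a standard $d$-dimensional Brownian motion with its natural filtration $(\mathcal F_t)$. The decoupled forward-backward SDE is $$X_t=x_0+\int_0^t b(s,X_s)ds+\int_0^t\sigma(s,X_s)dW_s,\qquad Y_t=\Phi(X_T)+\int_t^T f(s,X_s,Y_s,Z_s)ds-\int_t^T Z_s dW_s,$$ with $Y$ real-valued, $X$ and $Z$ $d$-dimensional, and $b,\sigma$ Lipschitz in $x$. For $N\in\mathbb{N}^+$ put $h=T/N$, $t_i=ih$, $W_i=W_{t_i}$, $\mathcal F_i=\mathcal F_{t_i}$, $\mathbb{E}_i[\cdot]=\mathbb{E}[\cdot\mid\mathcal F_{t_i}]$. $X^\pi_i$ is the approximation of $X_{t_i}$; the forward SDE is assumed to be solved perfectly, so the error caused by $X$ is not considered. Scheme (S). Fix $m\in\mathbb{N}^+$ and real numbers $\widetilde\alpha_j,\widetilde\gamma_j,\alpha_j,\gamma_j$ ($1\le j\le m$) and $\gamma_0\ne0$. The reals $\lambda_{m,0},\dots,\lambda_{m,m}$ (depending on $h$) satisfy $\frac1{j!}\sum_{n=0}^m\lambda_{m,n}(nh)^j=1$ if $j=1$ and $=0$ if $j\in\{0,\dots,m\}\setminus\{1\}$. Given starting values $(Y^\pi_k,Z^\pi_k)$ for $N-m+1\le k\le N$, for $i=N-m,N-m-1,\dots,0$: $$\widetilde Y_i^\pi=\mathbb{E}_i\Big[\sum_{j=1}^m\widetilde\alpha_jY_{i+j}^\pi+\sum_{j=1}^m\widetilde\gamma_jh f_{i+j}^\pi\Big],$$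 $$Y_i^\pi=\mathbb{E}_i\Big[\sum_{j=1}^m\alpha_jY_{i+j}^\pi+\gamma_0h\widetilde f_i^\pi+\sum_{j=1}^m\gamma_jhf_{i+j}^\pi\Big],$$ $$Z_i^\pi=\mathbb{E}_i\Big[\sum_{j=1}^m\lambda_{m,j}Y_{i+j}^\pi(W_{i+j}-W_i)^\top\Big],$$ where $f_i^\pi=f(t_i,X_i^\pi,Y_i^\pi,Z_i^\pi)$ and $\widetilde f_i^\pi=f(t_i,X_i^\pi,\widetilde Y_i^\pi,Z_i^\pi)$. Perturbed scheme. $(\bar Y_i^\pi,\bar Z_i^\pi)$ satisfies, for $i=N-m,N-m-1,\dots,0$, $$\bar{\widetilde Y}_i^\pi=\mathbb{E}_i\Big[\sum_{j=1}^m\widetilde\alpha_j\bar Y_{i+j}^\pi+\sum_{j=1}^m\widetilde\gamma_jhf(t_{i+j},X_{i+j}^\pi,\bar Y_{i+j}^\pi,\bar Z_{i+j}^\pi)\Big],$$ $$\bar Y_i^\pi=\mathbb{E}_i\Big[\sum_{j=1}^m\alpha_j\bar Y_{i+j}^\pi+\gamma_0hf(t_i,X_i^\pi,\bar{\widetilde Y}_i^\pi,\bar Z_i^\pi)+\sum_{j=1}^m\gamma_jhf(t_{i+j},X_{i+j}^\pi,\bar Y_{i+j}^\pi,\bar Z_{i+j}^\pi)\Big]+\varepsilon_i^Y,$$ $$\bar Z_i^\pi=\mathbb{E}_i\Big[\sum_{j=1}^m\lambda_{m,j}\bar Y_{i+j}^\pi(W_{i+j}-W_i)^\top\Big]+\varepsilon_i^Z,$$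 where the perturbations $\varepsilon_i^Y,\varepsilon_i^Z$ are random variables belonging to $\mathbb{L}_2(\mathcal F_i)$. $\mathbb{L}_2$-stability. The scheme (S) is said to be $\mathbb{L}_2$-stable if $$\max_{0\le i\le N-m}\mathbb{E}[|Y_i^\pi-\bar Y_i^\pi|^2]+\sum_{i=0}^{N-m}h\,\mathbb{E}[|Z_i^\pi-\bar Z_i^\pi|^2]\le C\Big(\max_{N-m+1\le k\le N}\mathbb{E}[|Y_k^\pi-\bar Y_k^\pi|^2]+\sum_{i=0}^{N-m}\mathbb{E}\big[h|\varepsilon_i^Z|^2+\tfrac1h|\varepsilon_i^Y|^2\big]\Big),$$ where $C$ is a constant (independent of $h$ and of the perturbations).
   Formalization: In the stability definition the starting Z-values of the perturbed scheme are required to equal those of the scheme almost surely; if they could differ, the inequality, which has no term for them, would fail (e.g. f = z) even under the root condition. *)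

(* Defs.v *)
From HB Require Import structures.
From mathcomp Require Import all_boot all_order all_algebra.
From mathcomp Require Import complex.
From mathcomp Require Import all_classical all_reals all_analysis.

Set Implicit Arguments.
Unset Strict Implicit.
Unset Printing Implicit Defensive.

Import Order.TTheory GRing.Theory Num.Theory.
Import numFieldNormedType.Exports.

Local Open Scope classical_set_scope.
Local Open Scope ring_scope.

(* Euclidean (Frobenius) norm; the library norm on matrices is the sup norm. *)
Definition enorm (R : realType) (p q : nat) (A : 'M[R]_(p, q)) : R :=
  Num.sqrt (\sum_i \sum_j A i j ^+ 2).

Section stochastic_basis.
Context (R : realType) (dO : measure_display) (Omega : measurableType dO).
Context (P : probability Omega R) (d : nat).

Definition measurable_wrt (T : Type) (G : set (set T)) (xi : T -> R) : Prop :=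
  forall B : set R, measurable B -> G (xi @^-1` B).

Definition L2 (G : set (set Omega)) (xi : Omega -> R) : Prop :=
  measurable_wrt G xi /\ xi \in Lfun P 2%:E.

Definition L2_mx (p q : nat) (G : set (set Omega)) (xi : Omega -> 'M[R]_(p, q))
  : Prop := forall i j, L2 G (fun w => xi w i j).

(* eta is a version of E[xi | G]. *)
Definition is_condexp (G : set (set Omega)) (xi eta : Omega -> R) : Prop :=
  [/\ P.-integrable [set: Omega] (EFin \o xi),
      P.-integrable [set: Omega] (EFin \o eta),
      measurable_wrt G eta &
      forall A, G A ->
        (\int[P]_(w in A) (eta w)%:E = \int[P]_(w in A) (xi w)%:E)%E].

Definition is_condexp_mx (p q : nat) (G : set (set Omega))
    (xi eta : Omega -> 'M[R]_(p, q)) : Prop :=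
  forall i j, is_condexp G (fun w => xi w i j) (fun w => eta w i j).

Definition natural_filtration (W : R -> Omega -> 'cV[R]_d) (t : R)
  : set (set Omega) :=
  <<s [set A | exists s k B,
         [/\ 0 <= s <= t, measurable B & A = [set w | B (W s w k 0)]]] >>.

(* As rectangles generate the Borel sets of R^d, the third clause is the
   independence of W_t - W_s from the past, and the fourth one says that
   W_t - W_s has law N(0, (t - s) I_d). *)
Definition brownian_motion (W : R -> Omega -> 'cV[R]_d) : Prop :=
  [/\ (forall t k, 0 <= t -> measurable_fun [set: Omega] (fun w => W t w k 0)),
      {ae P, forall w, W 0 w = 0},
      (forall s t (A : set Omega) (B : 'I_d -> set R),
         0 <= s -> s < t -> natural_filtration W s A ->
         (forall k, measurable (B k)) ->
         let D := [set w | forall k, B k ((W t w - W s w) k 0)] in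
         P (A `&` D) = (P A * P D)%E),
      (forall s t (B : 'I_d -> set R),
         0 <= s -> s < t -> (forall k, measurable (B k)) ->
         P [set w | forall k, B k ((W t w - W s w) k 0)] =
         (\prod_(k < d) normal_prob 0 (Num.sqrt (t - s)) (B k))%E) &
      {ae P, forall w, forall k,
         {within `[0, +oo[, continuous (fun t : R => W t w k 0)}}].

(* sum_(k < sp_size) sp_val k * 1_(sp_time k, sp_time k.+1] *)
Record simple_process := SimpleProcess {
  sp_size : nat ;
  sp_time : nat -> R ;
  sp_val : nat -> Omega -> 'M[R]_d }.

Definition simple_adapted (W : R -> Omega -> 'cV[R]_d) (t : R)
    (S : simple_process) : Prop :=
  [/\ (forall k, (k <= sp_size S)%N -> 0 <= sp_time S k <= t),
      (forall k, (k < sp_size S)%N -> sp_time S k <= sp_time S k.+1),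
      (forall k i j, (k < sp_size S)%N ->
         measurable_wrt (natural_filtration W (sp_time S k))
           (fun w => sp_val S k w i j)) &
      (exists M : R, forall k w, (k < sp_size S)%N ->
         enorm (sp_val S k w) <= M)].

Definition simple_eval (S : simple_process) (s : R) (w : Omega) : 'M[R]_d :=
  \sum_(0 <= k < sp_size S)
    \1_(`]sp_time S k, sp_time S k.+1]) s *: sp_val S k w.

Definition simple_integral (W : R -> Omega -> 'cV[R]_d) (S : simple_process)
    (w : Omega) : 'cV[R]_d :=
  \sum_(0 <= k < sp_size S)
    sp_val S k w *m (W (sp_time S k.+1) w - W (sp_time S k) w).

(* I is a version of the Ito integral of H over [0, t]: the L2 limit of the
   integrals of simple adapted processes which converge to H in
   L2([0, t] * Omega). *)
Definition is_ito_integral (W : R -> Omega -> 'cV[R]_d) (t : R)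
    (H : R -> Omega -> 'M[R]_d) (I : Omega -> 'cV[R]_d) : Prop :=
  [/\ (forall i j, measurable_fun (`[0, t] `*` [set: Omega])
         (fun p : R * Omega => H p.1 p.2 i j)),
      (forall k, measurable_fun [set: Omega] (fun w => I w k 0)) &
      exists S : nat -> simple_process,
        [/\ (forall n, simple_adapted W t (S n)),
            (fun n => \int[lebesgue_measure]_(s in `[0%R, t])
               'E_P[fun w => (enorm (simple_eval (S n) s w - H s w) ^+ 2)%R])%E
              @ \oo --> 0%E &
            (fun n =>
               'E_P[fun w => (enorm (simple_integral W (S n) w - I w) ^+ 2)%R])%E
              @ \oo --> 0%E]].

(* X is a square-integrable strong solution on [0, T] of
   X_t = x0 + int_0^t b(s, X_s) ds + int_0^t sigma(s, X_s) dW_s. *)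
Definition sde_solution (T : R) (W : R -> Omega -> 'cV[R]_d) (x0 : 'cV[R]_d)
    (b : R -> 'cV[R]_d -> 'cV[R]_d) (sigma : R -> 'cV[R]_d -> 'M[R]_d)
    (X : R -> Omega -> 'cV[R]_d) : Prop :=
  [/\ (forall t, 0 <= t <= T -> L2_mx (natural_filtration W t) (X t)),
      {ae P, forall w, forall k,
         {within `[0, T], continuous (fun t : R => X t w k 0)}},
      (forall k, measurable_fun (`[0, T] `*` [set: Omega])
         (fun p : R * Omega => b p.1 (X p.1 p.2) k 0)),
      {ae P, forall w, forall k,
         lebesgue_measure.-integrable `[0, T]
           (fun s : R => (b s (X s w) k 0)%:E)} &
      forall t, 0 <= t <= T -> exists2 I : Omega -> 'cV[R]_d,
        is_ito_integral W t (fun s w => sigma s (X s w)) I &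
        {ae P, forall w, X t w =
           x0 + (\col_k \int[lebesgue_measure]_(s in `[0, t]) b s (X s w) k 0)
           + I w}].

End stochastic_basis.

Definition borel (R : realType) (d : nat) : set (set 'cV[R]_d) :=
  <<s [set U : set 'cV[R]_d | open U] >>.

Definition lipschitz_x (R : realType) (T : R) (d p q : nat)
    (g : R -> 'cV[R]_d -> 'M[R]_(p, q)) : Prop :=
  exists K : R, forall t x y, 0 <= t <= T ->
    enorm (g t x - g t y) <= K * enorm (x - y).

(* sum_(n <= m) lam n (n h)^j / j! = 1 if j = 1, and 0 for the other j <= m *)
Definition lambda_cond (R : realType) (m : nat) (h : R) (lam : nat -> R)
  : Prop :=
  forall j, (j <= m)%N ->
    (j`!%:R)^-1 * \sum_(0 <= n < m.+1) lam n * (n%:R * h) ^+ j = (j == 1%N)%:R.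

Section scheme.
Context (R : realType) (dO : measure_display) (Omega : measurableType dO).
Context (P : probability Omega R) (d : nat) (T : R).
Context (W X : R -> Omega -> 'cV[R]_d).
Context (f : R -> 'cV[R]_d -> R -> 'rV[R]_d -> R).
Context (m : nat) (alphat gammat alpha gamma : nat -> R).
Context (lam : R -> nat -> R).

(* Perturbed scheme on the grid t_i = i h, h = T / N, with X^pi_i = X_{t_i}.
   Only the values Y i, Z i with i <= N and epsY i, epsZ i with i <= N - m
   matter; those with i > N - m are the starting values. Since epsY i is
   F_i-measurable, "Y i = E_i[...] + epsY i a.s." is stated as "Y i - epsY i is
   a version of E_i[...]", and similarly for Z. *)
Definition perturbed_scheme (N : nat) (epsY : nat -> Omega -> R)
    (epsZ : nat -> Omega -> 'rV[R]_d) (Y : nat -> Omega -> R)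
    (Z : nat -> Omega -> 'rV[R]_d) : Prop :=
  let h : R := T / N%:R in
  let t (i : nat) : R := i%:R * h in
  let F (i : nat) := natural_filtration W (t i) in
  let fpi (i : nat) (w : Omega) : R := f (t i) (X (t i) w) (Y i w) (Z i w) in
  (forall i, (i <= N)%N -> L2 P (F i) (Y i) /\ L2_mx P (F i) (Z i)) /\
  forall i, (i <= N - m)%N ->
    exists Yt : Omega -> R,
      [/\ is_condexp P (F i)
            (fun w => \sum_(1 <= j < m.+1) alphat j * Y (i + j)%N w
                    + \sum_(1 <= j < m.+1) gammat j * h * fpi (i + j)%N w)
            Yt,
          is_condexp P (F i)
            (fun w => \sum_(1 <= j < m.+1) alpha j * Y (i + j)%N w
                    + gamma 0%N * h * f (t i) (X (t i) w) (Yt w) (Z i w)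
                    + \sum_(1 <= j < m.+1) gamma j * h * fpi (i + j)%N w)
            (fun w => Y i w - epsY i w) &
          is_condexp_mx P (F i)
            (fun w => \sum_(1 <= j < m.+1)
               (lam h j * Y (i + j)%N w) *:
               (W (t (i + j)%N) w - W (t i) w)^T)
            (fun w => Z i w - epsZ i w)].

Definition scheme (N : nat) (Y : nat -> Omega -> R)
    (Z : nat -> Omega -> 'rV[R]_d) : Prop :=
  perturbed_scheme N (fun _ _ => 0) (fun _ _ => 0) Y Z.

(* The starting values Z k, N - m < k <= N, are the same in both schemes: the
   right-hand side has no term for an error in them. *)
Definition L2_stable : Prop :=
  exists C : R, forall (N : nat) (Y Yb : nat -> Omega -> R)
    (Z Zb : nat -> Omega -> 'rV[R]_d)
    (epsY : nat -> Omega -> R) (epsZ : nat -> Omega -> 'rV[R]_d),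
  let h : R := T / N%:R in
  let F (i : nat) := natural_filtration W (i%:R * h) in
  (m <= N)%N ->
  (forall i, (i <= N - m)%N -> L2 P (F i) (epsY i) /\ L2_mx P (F i) (epsZ i)) ->
  scheme N Y Z ->
  perturbed_scheme N epsY epsZ Yb Zb ->
  (forall k, (N - m < k <= N)%N -> {ae P, forall w, Zb k w = Z k w}) ->
  (\big[maxe/0]_(0 <= i < (N - m).+1)
      'E_P[fun w => (`|Y i w - Yb i w| ^+ 2)%R]
   + \sum_(0 <= i < (N - m).+1)
      h%:E * 'E_P[fun w => (enorm (Z i w - Zb i w) ^+ 2)%R]
   <= C%:E *
   (\big[maxe/0]_((N - m).+1 <= k < N.+1)
      'E_P[fun w => (`|Y k w - Yb k w| ^+ 2)%R]
    + \sum_(0 <= i < (N - m).+1)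
      'E_P[fun w => (h * enorm (epsZ i w) ^+ 2
                     + h^-1 * `|epsY i w| ^+ 2)%R]))%E.

End scheme.

Definition char_poly_scheme (R : realType) (m : nat) (alpha : nat -> R)
  : {poly R} :=
  'X^m - \sum_(1 <= j < m.+1) alpha j *: 'X^(m - j).

Definition dahlquist_root_condition (R : realType) (p : {poly R}) : Prop :=
  let pC : {poly R[i]} := map_poly (real_complex R) p in
  (forall z : R[i], root pC z -> `|z| <= 1) /\
  (forall z : R[i], root pC z -> `|z| = 1 -> mup z pC = 1%N).

(* Main.v *)
(* Let y, z be the differences of the Y- and Z-components of two solutions and E_i the
   conditional expectation given the i-th sigma-algebra of the grid. Dahlquist's condition
   means that all solutions of a(n+m) = alpha_1 a(n+m-1) + ... + alpha_m a(n) are bounded.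

   Sufficiency. The Y-equation reads y_i = E_i[sum_j alpha_j y_{i+j} + r_i], with r_i of size
   h (|y| + |z|) plus the perturbation, while the Z-equation together with |lambda_{m,j}| <= K/h
   bounds h |z_i|^2 by sum_j |y_{i+j} - E_i y_{i+j}|^2, i.e. by the martingale increments
   D_l y_{i+j} = (E_{l+1} - E_l) y_{i+j}, i <= l < i+j. For l < i the sequence D_l y_i satisfies
   the recurrence perturbed by D_l r_i, so boundedness of the impulse response bounds it by
   the D_l r_k, k > l, and the starting values. As sum_l |D_l r_k|^2 <= |r_k|^2, summing
   against the weights (1 + eta h)^i with eta large absorbs the z-terms of r, for every h.

   Necessity. A solution a of the recurrence is planted as Yb_i = Y_i + a(N-i) on the n0 last
   steps of the grid; each step needs only a perturbation of size O(h), which contributes O(h)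
   in total, so stability bounds a(n0)^2 by the initial values of a, uniformly in n0. *)

Require Import Defs.
From HB Require Import structures.
From mathcomp Require Import all_boot all_order all_algebra.
From mathcomp Require Import complex.
From mathcomp Require Import all_classical all_reals all_analysis measurable_realfun.
From mathcomp Require Import ring lra zify.

Set Implicit Arguments.
Unset Strict Implicit.
Unset Printing Implicit Defensive.

Import Order.TTheory GRing.Theory Num.Theory.
Import numFieldNormedType.Exports.

Local Open Scope classical_set_scope.
Local Open Scope ring_scope.

(** * Linear recurrences and the root condition *)

(** The delicate point is that no smallness of h may be assumed, although r contains z and z is
    controlled only after multiplication by h. Write rho = 1 + eta h and let x be h^-1 times the
    rho-weighted sum of |r_k|^2. Since D_l of the recurrence only involves r_k with k > l, the
    weighted Cauchy-Schwarz inequality costs exactly (rho - 1)^-1 = 1 / (eta h), without a bounded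
    remainder. Hence the weighted sum of h |z_i|^2 is at most a constant times x / eta plus data,
    while x is bounded by this sum and a similar one for y. A choice of eta from the other constants
    alone absorbs x, and the weights stay below exp(eta T).

    The impulse-response estimate is proved for an arbitrary seminorm, because it is applied to
    images of a random sequence under E_i and D_l. Random variables are not identified almost
    everywhere, so the geometry is that of a semi-inner product and projections agree up to vectors
    of norm zero. Products of Y with Brownian increments are a priori only integrable, so square
    integrability of Z comes from duality with bounded test functions. *)

Section shift_operator.
Variable K : comNzRingType.
Implicit Types (p q : {poly K}) (a : nat -> K).

(** This is p(E) a for the shift operator E. By [shift_opM] a factorisation of the characteristic
    polynomial becomes a composition of operators, so the recurrence can be solved factor by
    factor. *)
Definition shift_op p a (n : nat) : K := \sum_(i < size p) p`_i * a (n + i)%N.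

Lemma shift_op_widen p a n k : (size p <= k)%N ->
  shift_op p a n = \sum_(i < k) p`_i * a (n + i)%N.
Proof.
move=> pk; rewrite /shift_op (big_ord_widen _ (fun i => p`_i * a (n + i)%N) pk).
rewrite big_mkcond; apply: eq_bigr => i _; case: ltnP => // /leq_sizeP -> //.
by rewrite mul0r.
Qed.

Lemma shift_opD p q a n : shift_op (p + q) a n = shift_op p a n + shift_op q a n.
Proof.
pose k := maxn (size p) (size q).
rewrite !(@shift_op_widen _ _ _ k) ?leq_maxl ?leq_maxr ?size_polyD //.
by rewrite -big_split; apply: eq_bigr => i _; rewrite coefD mulrDl.
Qed.

Lemma shift_opZ c p a n : shift_op (c *: p) a n = c * shift_op p a n.
Proof.
rewrite (@shift_op_widen _ _ _ (size p)) ?size_scale_leq // mulr_sumr.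
by apply: eq_bigr => i _; rewrite coefZ mulrA.
Qed.

Lemma shift_opB p q a n : shift_op (p - q) a n = shift_op p a n - shift_op q a n.
Proof. by rewrite -[- q]scaleN1r shift_opD shift_opZ mulN1r. Qed.

Lemma shift_op_sum (I : Type) (r : seq I) (F : I -> {poly K}) a n :
  shift_op (\sum_(i <- r) F i) a n = \sum_(i <- r) shift_op (F i) a n.
Proof.
elim: r => [|x r IH]; last by rewrite !big_cons shift_opD IH.
by rewrite !big_nil /shift_op size_poly0 big_ord0.
Qed.

Lemma shift_opXn k a n : shift_op 'X^k a n = a (n + k)%N.
Proof.
rewrite /shift_op size_polyXn big_ord_recr /= coefXn eqxx mul1r big1 ?add0r//.
by move=> i _; rewrite coefXn ltn_eqF ?mul0r.
Qed.

Lemma shift_op_eq p a b n : a =1 b -> shift_op p a n = shift_op p b n.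
Proof. by move=> ab; apply: eq_bigr => i _; rewrite ab. Qed.

Lemma shift_opM p q a n : shift_op (p * q) a n = shift_op p (shift_op q a) n.
Proof.
elim/poly_ind: p n => [|p c IH] n; first by rewrite mul0r /shift_op size_poly0 !big_ord0.
rewrite mulrDl -mulrA (mulrC 'X) mulrA !shift_opD; congr (_ + _).
  transitivity (shift_op (p * q) a n.+1).
    rewrite (@shift_op_widen _ _ n (size (p * q)).+1); last first.
      by rewrite (leq_trans (size_polyMleq _ _)) // size_polyX addn2.
    rewrite big_ord_recl coefMX mul0r add0r; apply: eq_bigr => i _.
    by rewrite coefMX /= addSnnS.
  rewrite IH (@shift_op_widen (p * 'X) _ n (size p).+1); last first.
    by rewrite (leq_trans (size_polyMleq _ _)) // size_polyX addn2.
  rewrite big_ord_recl coefMX mul0r add0r; apply: eq_bigr => i _.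
  by rewrite coefMX /= addSnnS.
rewrite mul_polyC shift_opZ -[c%:P]mulr1 mul_polyC shift_opZ.
by rewrite -(expr0 'X) shift_opXn addn0.
Qed.

Lemma shift_opXsubC z a n : shift_op ('X - z%:P) a n = a n.+1 - z * a n.
Proof.
rewrite shift_opB -(expr1 'X) shift_opXn addn1 -[z%:P]mulr1 mul_polyC shift_opZ.
by rewrite -(expr0 'X) shift_opXn addn0.
Qed.

Lemma shift_op1 a n : shift_op 1 a n = a n.
Proof. by rewrite -(expr0 'X) shift_opXn addn0. Qed.

Lemma shift_op_0 p n : shift_op p (fun=> 0) n = 0.
Proof. by rewrite /shift_op big1 // => i _; rewrite mulr0. Qed.

Lemma shift_op_geom p z n : shift_op p (GRing.exp z) n = z ^+ n * p.[z].
Proof.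
rewrite horner_coef mulr_sumr; apply: eq_bigr => i _.
by rewrite exprD mulrCA.
Qed.

End shift_operator.

Section bounded_kernel.
Variable R : realType.
Local Notation C := R[i].
Implicit Types (p q : {poly C}) (a : nat -> C).

Definition bounded_kernel p := forall a,
  (forall n, shift_op p a n = 0) -> exists M : R, forall n, `|a n| <= (M)%:C%C.

Lemma real_bound (x : C) : exists M : R, `|x| = M%:C%C.
Proof. by rewrite normc_def; eexists. Qed.

Lemma shift_op_bounded p a (M : R) : (forall n, `|a n| <= M%:C%C) ->
  exists M' : R, forall n, `|shift_op p a n| <= M'%:C%C.
Proof.
move=> aM.
have [S ES] := real_bound (\sum_(i < size p) `|p`_i| * M%:C%C).
exists S => n; rewrite -ES [leRHS]ger0_norm; last first.
  apply: sumr_ge0 => i _; apply: mulr_ge0 => //.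
  exact: le_trans (normr_ge0 _) (aM 0%N).
apply: (le_trans (ler_norm_sum _ _ _)); apply: ler_sum => i _.
by rewrite normrM; apply: ler_wpM2l.
Qed.

(** With a Bezout relation u p + v q = 1, the sequence a is u(E) p(E) a + v(E) q(E) a. Here p(E) a
    lies in the kernel of q and q(E) a in that of p, and finite-order operators preserve
    boundedness. *)
Lemma bounded_kernelM_coprime p q : coprimep p q ->
  bounded_kernel p -> bounded_kernel q -> bounded_kernel (p * q).
Proof.
move=> /Bezout_eq1_coprimepP [[u v] /= uv1] Bp Bq a pqa.
have [M1 H1] : exists M, forall n, `|shift_op p a n| <= M%:C%C.
  by apply: Bq => n; rewrite -shift_opM mulrC.
have [M2 H2] : exists M, forall n, `|shift_op q a n| <= M%:C%C.
  by apply: Bp => n; rewrite -shift_opM.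
have [M1' H1'] := shift_op_bounded u H1.
have [M2' H2'] := shift_op_bounded v H2.
exists (M1' + M2') => n; rewrite -[a n]shift_op1 -uv1 shift_opD !shift_opM.
by rewrite rmorphD; apply: (le_trans (ler_normD _ _)); apply: lerD.
Qed.

(** The sequence a(n+1) - z a(n) lies in the kernel of [q], so a obeys a contraction with bounded
    forcing. Coprimality is not involved, which is how roots of any multiplicity inside the disc are
    treated. *)
Lemma bounded_kernel_contract q (z : C) : `|z| < 1 ->
  bounded_kernel q -> bounded_kernel (('X - z%:P) * q).
Proof.
move=> z1 Bq a za.
have [M HM] : exists M, forall n, `|shift_op ('X - z%:P) a n| <= M%:C%C.
  by apply: Bq => n; rewrite -shift_opM mulrC.
have [r Er] := real_bound z; have [a0 Ea0] := real_bound (a 0%N).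
have r1 : r < 1 by rewrite Er -[1]/(1%:C)%C ltcR in z1.
exists (a0 + M / (1 - r)).
have M0 : 0 <= M by have := le_trans (normr_ge0 _) (HM 0%N); rewrite lecR.
have a00 : 0 <= a0 by have := normr_ge0 (a 0%N); rewrite Ea0 lecR.
have r0 : 0 <= r by have := normr_ge0 z; rewrite Er lecR.
elim=> [|n IH].
  by rewrite Ea0 lecR lerDl divr_ge0 // subr_ge0 ltW.
have -> : a n.+1 = z * a n + shift_op ('X - z%:P) a n.
  by rewrite shift_opXsubC addrCA subrr addr0.
apply: (le_trans (ler_normD _ _)); rewrite normrM Er.
apply: (le_trans (lerD (ler_wpM2l _ IH) (HM n))); first by rewrite lecR.
rewrite -rmorphM -rmorphD lecR.
rewrite [leRHS](_ : _ = r * (a0 + M / (1 - r)) + M + a0 * (1 - r)); last first.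
  by field; rewrite subr_eq0 gt_eqF.
by rewrite lerDl mulr_ge0 // subr_ge0 ltW.
Qed.

Lemma bounded_kernel_unit (z : C) : `|z| = 1 -> bounded_kernel ('X - z%:P).
Proof.
move=> z1 a za; have [a0 Ea0] := real_bound (a 0%N); exists a0.
elim=> [|n IH]; first by rewrite Ea0.
have /eqP := za n; rewrite shift_opXsubC subr_eq0 => /eqP ->.
by rewrite normrM z1 mul1r.
Qed.

(** Roots are peeled off one by one: a root inside the disc by contraction, a root on the circle by
    coprimality with the remaining product, which is what its simplicity provides. *)
Lemma bounded_kernel_roots (rs : seq C) :
  (forall z, z \in rs -> `|z| <= 1) ->
  (forall z, z \in rs -> `|z| = 1 -> count_mem z rs = 1%N) ->
  bounded_kernel (\prod_(z <- rs) ('X - z%:P)).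
Proof.
elim: rs => [|z rs IH] le1 cnt.
  rewrite big_nil => a a0; exists 0 => n.
  by rewrite -[a n]shift_op1 a0 normr0.
have {}IH : bounded_kernel (\prod_(z <- rs) ('X - z%:P)).
  apply: IH => w wrs; first by apply: le1; rewrite inE wrs orbT.
  move=> w1; have := cnt w; rewrite inE wrs orbT => /(_ isT w1) /=.
  by case: eqP => // _; rewrite add1n => -[] /count_memPn; rewrite wrs.
rewrite big_cons; have := le1 z; rewrite inE eqxx => /(_ isT).
rewrite le_eqVlt => /orP[/eqP z1|z1]; last exact: bounded_kernel_contract.
apply: bounded_kernelM_coprime => //; last exact: bounded_kernel_unit.
rewrite coprimep_sym coprimep_XsubC root_prod_XsubC.
have := cnt z; rewrite inE eqxx => /(_ isT z1) /=; rewrite eqxx add1n => -[].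
by move/count_memPn.
Qed.

End bounded_kernel.

Section dahlquist.
Variables (R : realType) (m : nat) (alpha : nat -> R).
Local Notation C := R[i].
Local Notation chi := (char_poly_scheme m alpha).
Local Notation chiC := (map_poly (real_complex R) chi).

Definition recurrence (a : nat -> R) := forall n,
  a (n + m)%N = \sum_(1 <= j < m.+1) alpha j * a (n + m - j)%N.

Lemma recurrenceP a : recurrence a <-> forall n, shift_op chi a n = 0.
Proof.
have E n : shift_op chi a n =
    a (n + m)%N - \sum_(1 <= j < m.+1) alpha j * a (n + m - j)%N.
  rewrite shift_opB shift_opXn shift_op_sum; congr (_ - _).
  apply: eq_big_nat => j /andP[_ jm].
  by rewrite shift_opZ shift_opXn addnBA.
by split=> H n; [rewrite E H subrr | apply/eqP; rewrite -subr_eq0 -E H].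
Qed.

Lemma shift_op_real (a : nat -> R) n :
  shift_op chiC (fun k => (a k)%:C%C) n = (shift_op chi a n)%:C%C.
Proof.
rewrite (@shift_op_widen _ chiC _ n (size chi)) ?size_map_poly //.
rewrite /shift_op rmorph_sum; apply: eq_bigr => i _.
by rewrite coef_map rmorphM.
Qed.

Lemma Re_shift_op (w : nat -> C) n :
  complex.Re (shift_op chiC w n) = shift_op chi (fun k => complex.Re (w k)) n.
Proof.
rewrite (@shift_op_widen _ chiC _ n (size chi)) ?size_map_poly //.
rewrite /shift_op raddf_sum; apply: eq_bigr => i _.
by rewrite coef_map /=; case: (w _) => x y /=; rewrite mul0r subr0.
Qed.

Lemma Im_shift_op (w : nat -> C) n :
  complex.Im (shift_op chiC w n) = shift_op chi (fun k => complex.Im (w k)) n.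
Proof.
rewrite (@shift_op_widen _ chiC _ n (size chi)) ?size_map_poly //.
rewrite /shift_op raddf_sum; apply: eq_bigr => i _.
by rewrite coef_map /=; case: (w _) => x y /=; rewrite mul0r addr0.
Qed.

Lemma monic_char_poly_scheme : chi \is monic.
Proof.
rewrite monicE /char_poly_scheme lead_coefDl ?lead_coefXn //.
rewrite size_polyN size_polyXn ltnS; apply: (leq_trans (size_sum _ _ _)).
apply/bigmax_leqP_seq => j; rewrite mem_index_iota => /andP[j1 jm] _.
apply: (leq_trans (size_scale_leq _ _)); rewrite size_polyXn.
by rewrite ltn_subLR // ?addn_gt0 ?j1 // -{1}[m]add0n ltn_add2r.
Qed.

Lemma chiC_neq0 : chiC != 0.
Proof. by rewrite map_poly_eq0 monic_neq0 // monic_char_poly_scheme. Qed.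

Lemma recurrence_bounded a : dahlquist_root_condition chi ->
  recurrence a -> exists M : R, forall n, `|a n| <= M.
Proof.
move=> [le1 mu1] /recurrenceP ra.
have [rs Ers] := closed_field_poly_normal chiC.
have Ec : chiC = \prod_(z <- rs) ('X - z%:P).
  rewrite [LHS]Ers lead_coef_map (eqP monic_char_poly_scheme) /=.
  by rewrite scale1r.
have rootrs z : z \in rs -> root chiC z by rewrite Ec root_prod_XsubC.
have B : bounded_kernel chiC.
  rewrite Ec; apply: bounded_kernel_roots => z zrs; first exact/le1/rootrs.
  by move=> z1; rewrite -mu_prod_XsubC -Ec; exact: mu1 (rootrs _ zrs) z1.
have [|M HM] := B (fun k => (a k)%:C%C).
  by move=> n; rewrite shift_op_real ra.
exists M => n; have := HM n.
by rewrite normc_def /= expr0n addr0 sqrtr_sqr lecR.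
Qed.

(** The root condition needs complex test sequences, while stability speaks of real ones. The
    coefficients being real, real and imaginary parts solve the recurrence separately. *)
Lemma complex_kernel_bounded :
  (forall a, recurrence a -> exists M : R, forall n, `|a n| <= M) ->
  bounded_kernel chiC.
Proof.
move=> H w w0.
have [|M1 H1] := H (fun k => complex.Re (w k)).
  by apply/recurrenceP => n; rewrite -Re_shift_op w0.
have [|M2 H2] := H (fun k => complex.Im (w k)).
  by apply/recurrenceP => n; rewrite -Im_shift_op w0.
exists (M1 + M2) => n; rewrite [w n]complexE.
apply: (le_trans (ler_normD _ _)); rewrite rmorphD; apply: lerD.
  by rewrite normc_def /= expr0n addr0 sqrtr_sqr lecR.
rewrite normrM [`|'i%C|]normc_def /= expr0n expr1n add0r sqrtr1 mul1r.
by rewrite normc_def /= expr0n addr0 sqrtr_sqr lecR.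
Qed.

(** The two test sequences are z^n, unbounded if |z| > 1, and n z^n, a solution as soon as z is a
    multiple root. *)
Lemma bounded_recurrence_dahlquist :
  (forall a, recurrence a -> exists M : R, forall n, `|a n| <= M) ->
  dahlquist_root_condition chi.
Proof.
move=> /complex_kernel_bounded B; split=> z zroot.
  have [|M HM] := B (GRing.exp z).
    by move=> n; rewrite shift_op_geom (eqP zroot) mulr0.
  have [r Er] := real_bound z.
  rewrite Er lecR leNgt; apply/negP => r1.
  (* Bernoulli's inequality N (r - 1) <= r^N - 1 shows that r^N exceeds M for this N. *)
  pose N := (Num.truncn (M / (r - 1))).+1.
  have := HM N; rewrite normrX Er -rmorphXn lecR leNgt => /negP; apply.
  have MN : M / (r - 1) < N%:R by apply: truncnS_gt.
  have rN : N%:R * (r - 1) <= r ^+ N - 1.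
    elim: N {MN} => [|k IH]; first by rewrite mul0r expr0 subrr.
    rewrite exprS -natr1 mulrDl mul1r.
    have rk : 1 <= r ^+ k by rewrite exprn_ege1 // ltW.
    have : 0 <= (r - 1) * (r ^+ k - 1) by rewrite mulr_ge0 ?subr_ge0 // ltW.
    by lra.
  by move: MN; rewrite ltr_pdivrMr ?subr_gt0 //; lra.
move=> z1; apply/eqP; rewrite eqn_leq -XsubC_dvd ?chiC_neq0 // -root_factor_theorem zroot andbT.
rewrite leqNgt mup_geq ?chiC_neq0 //; apply/negP => /dvdpP[q Eq].
(* One application of E - z turns this into z^(n+1), a second one into 0; hence every multiple of (X
   - z)^2 annihilates it. *)
pose w n : C := n%:R * z ^+ n.
have [|M HM] := B w.
  move=> n; rewrite Eq shift_opM expr2.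
  rewrite (shift_op_eq _ _ (b := fun=> 0)) ?shift_op_0 // => k.
  rewrite shift_opM (shift_op_eq _ _ (b := fun k => z ^+ k.+1)).
    by rewrite shift_opXsubC -exprS subrr.
  move=> l; rewrite shift_opXsubC /w mulrCA -exprS -mulrBl -natrB ?leqnSn //.
  by rewrite subSnn mul1r.
have := HM (Num.truncn M).+1.
rewrite /w normrM normrX z1 expr1n mulr1 normr_nat.
have -> : (Num.truncn M).+1%:R = ((Num.truncn M).+1%:R)%:C%C :> C by rewrite rmorph_nat.
by rewrite lecR leNgt truncnS_gt.
Qed.

End dahlquist.

(** * Impulse response and bounds for perturbed recurrences *)

Section impulse_response.
Variables (R : realType) (m : nat) (alpha : nat -> R).

(** The list carries the whole history, newest value first, since an m-step recursion is not
    structural. Reading beyond its end gives 0, which encodes the zero past before the unit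
    impulse. *)
Fixpoint impulse_seq (n : nat) : seq R :=
  if n is k.+1 then
    let s := impulse_seq k in
    (\sum_(1 <= j < m.+1) alpha j * s`_j.-1) :: s
  else [:: 1].

Definition impulse n := head 0 (impulse_seq n).

Lemma nth_impulse_seq n j :
  (impulse_seq n)`_j = if (j <= n)%N then impulse (n - j) else 0.
Proof.
by elim: n j => [|n IH] [|j] //=; rewrite nth_nil.
Qed.

Lemma impulseS n : impulse n.+1 =
  \sum_(1 <= j < m.+1 | (j <= n.+1)%N) alpha j * impulse (n.+1 - j).
Proof.
rewrite {1}/impulse /= [RHS]big_mkcond; apply: eq_big_nat => -[|j] // _ /=.
by rewrite nth_impulse_seq ltnS subSS; case: ifP; rewrite ?mulr0.
Qed.

Lemma impulse_recurrence : (0 < m)%N -> recurrence m alpha impulse.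
Proof.
move=> m0 n; rewrite -[(n + m)%N]prednK ?addn_gt0 ?m0 ?orbT // impulseS prednK.
  rewrite big_mkcond; apply: eq_big_nat => j /andP[_ jk].
  by rewrite (leq_trans (jk : (j <= m)%N)) // leq_addl.
by rewrite addn_gt0 m0 orbT.
Qed.

(* Duhamel's formula; the truncated sum treats the starting values as forcing terms. *)
Lemma impulse_repr (V : lmodType R) (a : nat -> V) n :
  a n = \sum_(0 <= k < n.+1) impulse (n - k) *:
    (a k - \sum_(1 <= j < m.+1 | (j <= k)%N) alpha j *: a (k - j)%N).
Proof.
pose rho k := a k - \sum_(1 <= j < m.+1 | (j <= k)%N) alpha j *: a (k - j)%N.
suff : a n = \sum_(0 <= k < n.+1) impulse (n - k) *: rho k by [].
elim/ltn_ind: n => n IH.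
rewrite big_nat_recr //= subnn {2}/impulse /= scale1r.
suff -> : \sum_(0 <= k < n) impulse (n - k) *: rho k =
    \sum_(1 <= j < m.+1 | (j <= n)%N) alpha j *: a (n - j)%N.
  by rewrite /rho addrCA subrr addr0.
(* The impulse response is unfolded once; after exchanging the sums, the inner sum at fixed j is the
   formula for a(n - j). *)
transitivity (\sum_(0 <= k < n) \sum_(1 <= j < m.+1 | (j <= n - k)%N)
    (alpha j * impulse (n - k - j)) *: rho k).
  apply: eq_big_nat => k /andP[_ kn].
  by rewrite -(subnSK kn) impulseS scaler_suml (subnSK kn).
rewrite (exchange_big_dep_nat (fun j => (j <= n)%N)) /=; last first.
  by move=> *; lia.
rewrite big_nat_cond [RHS]big_nat_cond.
apply: eq_bigr => j /andP[/andP[j1 jm] jn].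
rewrite [a (n - j)%N]IH; last by lia.
rewrite scaler_sumr [RHS](big_nat_widen _ _ n); last by lia.
rewrite big_nat_cond [RHS]big_nat_cond; apply: eq_big => k; first by lia.
by rewrite scalerA subnAC.
Qed.

(** [K] is chosen before the space and the seminorm: later [N] is the L2 norm and [a] the image of a
    random sequence under a projection or a difference of projections, and the constant must not
    depend on which. *)
Lemma recurrence_perturbation_bound : (0 < m)%N ->
  (forall a, recurrence m alpha a -> exists M : R, forall n, `|a n| <= M) ->
  exists2 K, 0 <= K &
  forall (V : lmodType R) (N : V -> R) (a : nat -> V) (n : nat),
  N 0 = 0 -> (forall u, 0 <= N u) -> (forall u v, N (u + v) <= N u + N v) ->
  (forall c u, N (c *: u) = `|c| * N u) ->
  N (a n) <= K * (\sum_(0 <= k < m) N (a k) +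
    \sum_(m <= k < n.+1) N (a k - \sum_(1 <= j < m.+1) alpha j *: a (k - j)%N)).
Proof.
move=> m0 B; have [M HM] := B _ (impulse_recurrence m0).
pose A := 1 + \sum_(1 <= j < m.+1) `|alpha j|.
have M0 : 0 <= M := le_trans (normr_ge0 _) (HM 0%N).
have A1 : 1 <= A by rewrite lerDl sumr_ge0.
(* [M] bounds the impulse response; in Duhamel's formula each of the m starting indices contributes
   a forcing term of size at most [A] times the sum of the starting norms. *)
exists (M * (m%:R * A)); first by rewrite !mulr_ge0 // (le_trans _ A1).
move=> V N a n N0 Nge0 Ntri NZ.
have Nsum (I : Type) (r : seq I) (Q : pred I) (F : I -> V) :
    N (\sum_(i <- r | Q i) F i) <= \sum_(i <- r | Q i) N (F i).
  elim: r => [|i r IH]; first by rewrite !big_nil N0.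
  rewrite !big_cons; case: ifP => _ //.
  by apply: (le_trans (Ntri _ _)); rewrite lerD2l.
have NN u : N (- u) = N u by rewrite -scaleN1r NZ normrN1 mul1r.
rewrite {1}(impulse_repr a n).
pose rho k := a k - \sum_(1 <= j < m.+1 | (j <= k)%N) alpha j *: a (k - j)%N.
have S0 : 0 <= \sum_(0 <= k < m) N (a k) by apply: sumr_ge0.
have rho_start k : (k < m)%N -> N (rho k) <= A * \sum_(0 <= k < m) N (a k).
  move=> km; rewrite /rho; apply: (le_trans (Ntri _ _)); rewrite NN.
  have le1 i : (i < m)%N -> N (a i) <= \sum_(0 <= k < m) N (a k).
    move=> im; rewrite big_mkord (bigD1 (Ordinal im)) //= lerDl.
    by apply: sumr_ge0.
  rewrite /A mulrDl mul1r; apply: lerD; first exact: le1.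
  apply: (le_trans (Nsum _ _ _ _)); rewrite mulr_suml big_mkcond.
  apply: ler_sum => j _; case: ifP => jk; last by rewrite mulr_ge0.
  by rewrite NZ ler_wpM2l // le1 // (leq_ltn_trans (leq_subr _ _) km).
have key : \sum_(0 <= k < n.+1) N (rho k) <=
    m%:R * A * (\sum_(0 <= k < m) N (a k)) +
    \sum_(m <= k < n.+1) N (a k - \sum_(1 <= j < m.+1) alpha j *: a (k - j)%N).
  apply: (@le_trans _ _ (\sum_(0 <= k < m) N (rho k) + \sum_(m <= k < n.+1) N (rho k))).
    have [mn|nm] := leqP m n.+1; first by rewrite -big_cat_nat.
    rewrite [X in _ + X]big_geq ?(ltnW nm) // addr0.
    rewrite (big_cat_nat _ (n := n.+1) (p := m)) ?(ltnW nm) //= lerDl.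
    exact: sumr_ge0.
  apply: lerD.
    rewrite -mulrA mulr_natl -{3}[m]subn0 -sumr_const_nat.
    by apply: ler_sum_nat => k /andP[_ km]; exact: rho_start.
  apply: ler_sum_nat => k /andP[mk _].
  rewrite /rho big_nat_cond [in leRHS]big_nat_cond.
  rewrite (eq_bigl (fun i => (0 < i < m.+1)%N && true)) // => j.
  by case: (ltnP j m.+1) => jm; rewrite ?andbF // (leq_trans _ mk) ?andbT.
apply: (le_trans (Nsum _ _ _ _)).
apply: (@le_trans _ _ (M * \sum_(0 <= k < n.+1) N (rho k))).
  rewrite mulr_sumr; apply: ler_sum => k _.
  by rewrite NZ ler_wpM2r.
rewrite -mulrA; apply: ler_wpM2l => //; apply: (le_trans key).
rewrite [leRHS]mulrDr lerD2l ler_peMl ?sumr_ge0 //.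
by rewrite mulr_ege1 // ler1n.
Qed.

End impulse_response.

(** * Size of the coefficients of the Z-equation *)

Section lambda_bound.
Variables (R : realType) (m : nat).

(** The order conditions say that the weights [lam n * h] at the nodes 0, ..., m send each monomial
    to its linear coefficient. By linearity they represent p'(0) for all degrees up to m. *)
Lemma lambda_cond_horner (h : R) lam (p : {poly R}) : 0 < h ->
  lambda_cond m h lam -> (size p <= m.+1)%N ->
  \sum_(0 <= n < m.+1) (lam n * h) * p.[n%:R] = p`_1.
Proof.
move=> h0 lc sp.
have mom j : (j <= m)%N -> \sum_(0 <= n < m.+1) (lam n * h) * n%:R ^+ j = (j == 1%N)%:R.
  move=> jm; have := lc j jm.
  have -> : \sum_(0 <= n < m.+1) lam n * (n%:R * h) ^+ j =
      h ^+ j / h * \sum_(0 <= n < m.+1) (lam n * h) * n%:R ^+ j.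
    rewrite mulr_sumr; apply: eq_bigr => n _; rewrite exprMn.
    by field; rewrite gt_eqF.
  case: eqP => [->|j1] /=; first by rewrite (_ : 1`! = 1%N) // invr1 expr1 divff ?gt_eqF // !mul1r.
  move/eqP; rewrite !mulf_eq0 !invr_eq0 expf_eq0 (gt_eqF h0) andbF pnatr_eq0.
  by rewrite -[j`! == 0%N]negbK -lt0n fact_gt0 /= => /eqP.
under eq_bigr => n _ do rewrite (horner_coef_wide _ sp) mulr_sumr.
rewrite exchange_big /= -[RHS]mul1r.
transitivity (\sum_(j < m.+1) p`_j * (j == 1%N :> nat)%:R).
  apply: eq_bigr => j _; rewrite -mom; last by rewrite -ltnS.
  rewrite mulr_sumr.
  by apply: eq_bigr => n _; rewrite mulrCA.
case: m sp => [|k] sp.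
  by rewrite big_ord_recl big_ord0 /= mulr0 addr0 (nth_default _ sp) mulr0.
rewrite (bigD1 (Ordinal (isT : 1 < k.+2)%N)) //= mulr1 big1 ?addr0 ?mul1r //.
by move=> i; rewrite -val_eqE /= => /negbTE ->; rewrite mulr0.
Qed.

(** Testing with the unnormalised Lagrange polynomial of node j isolates [lam j * h], whose value is
    therefore a number depending on m and j only. *)
Lemma lambda_bound : exists2 K : R, 0 <= K & forall h lam, 0 < h ->
  lambda_cond m h lam -> forall j, (j <= m)%N -> `|lam j| <= K / h.
Proof.
pose q (n : nat) : {poly R} := \prod_(k < m.+1 | k != n :> nat) ('X - (k%:R)%:P).
pose K := \sum_(n < m.+1) `|(q n)`_1 / (q n).[n%:R]|.
exists K; first exact: sumr_ge0.
move=> h lam h0 lc j jm; rewrite ler_pdivlMr // -{1}(gtr0_norm h0) -normrM.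
have qj0 : (q j).[j%:R] != 0.
  rewrite /q horner_prod prodf_seq_neq0; apply/allP => k _; apply/implyP => kj.
  by rewrite hornerXsubC subr_eq0 eqr_nat eq_sym.
have sq : (size (q j) <= m.+1)%N.
  rewrite size_prod; last by move=> i _; rewrite polyXsubC_eq0.
  under eq_bigr do rewrite size_XsubC.
  rewrite sum_nat_const muln2 -addnn subSn ?leq_addr // addnK.
  rewrite ltnS (@leq_trans #|predC1 (Ordinal (jm : (j < m.+1)%N))|) //.
  by rewrite cardC1 card_ord.
have -> : lam j * h = (q j)`_1 / (q j).[j%:R].
  rewrite -(lambda_cond_horner h0 lc sq) big_mkord (bigD1 (Ordinal (jm : (j < m.+1)%N))) //=.
  rewrite big1 ?addr0 ?mulfK // => i ij.
  rewrite (_ : (q j).[_] = 0) ?mulr0 // /q horner_prod (bigD1 i) //=.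
  by rewrite hornerXsubC subrr mul0r.
by rewrite /K (bigD1 (Ordinal (jm : (j < m.+1)%N))) //= lerDl sumr_ge0.
Qed.

End lambda_bound.

(** * Geometrically weighted sums *)

Section weighted_sums.
Variable R : realType.

Lemma sum_nat_shift_le (F : nat -> R) a b j : (forall i, 0 <= F i) ->
  (a + j <= b)%N -> \sum_(0 <= i < a) F (i + j)%N <= \sum_(0 <= i < b) F i.
Proof.
move=> F0 ajb; rewrite [leRHS](big_cat_nat _ (n := j)) //=; last by lia.
rewrite [X in _ + X](big_cat_nat _ (n := (a + j)%N)) //=; last by lia.
have -> : \sum_(j <= i < a + j) F i = \sum_(0 <= i < a) F (i + j)%N.
  by rewrite -{1}[j]add0n big_addn addnK.
rewrite addrCA lerDl.
by rewrite addr_ge0 // sumr_ge0.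
Qed.

Lemma sum_nat_sub_le (F : nat -> R) a b a' b' : (forall i, 0 <= F i) ->
  (a' <= a)%N -> (b <= b')%N ->
  \sum_(a <= i < b) F i <= \sum_(a' <= i < b') F i.
Proof.
move=> F0 aa bb; have [ab|ba] := leqP a b; last first.
  by rewrite big_geq ?sumr_ge0 // ltnW.
rewrite [leRHS](big_cat_nat _ (n := a)) //=; last exact: leq_trans bb.
rewrite [X in _ + X](big_cat_nat _ (n := b)) //= addrCA lerDl.
by rewrite addr_ge0 // sumr_ge0.
Qed.

Lemma sqr_sum_le (F : nat -> R) a b :
  (\sum_(a <= i < b) F i) ^+ 2 <= (b - a)%:R * \sum_(a <= i < b) F i ^+ 2.
Proof.
have [ab|ba] := leqP a b; last first.
  by rewrite !big_geq ?mulr0 ?expr0n // ltnW.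
elim: b ab => [|b IH]; first by rewrite leqn0 => /eqP ->; rewrite !big_geq ?mulr0 ?expr0n.
rewrite leq_eqVlt => /orP[/eqP ->|]; first by rewrite !big_geq ?mulr0 ?expr0n.
rewrite ltnS => ab; have {IH} := IH ab.
rewrite !big_nat_recr //= subSn // -natr1.
set s := \sum_(a <= i < b) F i; set q := \sum_(a <= i < b) F i ^+ 2.
set k := (b - a)%:R : R; set x := F b => H.
have k0 : 0 <= k by [].
have q0 : 0 <= q by apply: sumr_ge0 => i _; exact: sqr_ge0.
have xs : 2 * (s * x) <= q + k * x ^+ 2.
  have [k00|kp] := eqVneq k 0.
    by move: H; rewrite k00 !mul0r => /(conj (sqr_ge0 s)) /andP/le_anti/esym/eqP;
       rewrite sqrf_eq0 => /eqP ->; rewrite !mul0r mulr0 addr0.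
  have kp' : 0 < k by rewrite lt0r kp.
  rewrite -(ler_pM2l kp').
  have := sqr_ge0 (s - k * x); nra.
rewrite sqrrD mulrDr !mulrDl !mul1r -mulr_natr; lra.
Qed.

(* Cauchy-Schwarz against a geometric weight; the weight makes the constant
   independent of the number of terms. *)
Lemma weighted_sqr_sum_le (rho : R) (x : nat -> R) i M : 1 < rho ->
  rho ^+ i * (\sum_(i <= k < M) x k) ^+ 2 <=
  rho / (rho - 1) * \sum_(i <= k < M) rho ^+ k * x k ^+ 2.
Proof.
move=> r1; have [iM|Mi] := leqP i M; last first.
  by rewrite !big_geq ?expr0n ?mulr0 // ltnW.
rewrite -(subKn iM); elim: (M - i)%N (leq_subr i M) => [|k IH] kM.
  by rewrite subn0 !big_geq ?expr0n ?mulr0.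
have Mk : (M - k)%N = (M - k.+1).+1 by lia.
have {IH} := IH (ltnW kM); rewrite Mk.
set j := (M - k.+1)%N; have jM : (j < M)%N by rewrite /j; lia.
rewrite ![in X in _ -> X](big_ltn jM).
set s := \sum_(j.+1 <= k0 < M) x k0; set q := \sum_(j.+1 <= k0 < M) _.
rewrite mulrDr exprS; set w := rho ^+ j; set t := x j => H.
have w0 : 0 < w by rewrite exprn_gt0 // (lt_trans _ r1).
apply: (le_trans _ (lerD (lexx _) H)).
rewrite [leRHS](_ : _ = w * (rho / (rho - 1) * t ^+ 2 + rho * s ^+ 2)); last by ring.
rewrite ler_pM2l //.
have rp : 0 < rho - 1 by rewrite subr_gt0.
rewrite -(ler_pM2l rp) mulrDr -subr_ge0.
(* The induction step is Young's inequality (t + s)^2 <= rho / (rho - 1) t^2 + rho s^2; multiplied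
   by rho - 1, its defect is this square. *)
rewrite [leRHS](_ : _ = (t - (rho - 1) * s) ^+ 2) ?sqr_ge0 //.
by field; rewrite gt_eqF.
Qed.

(** Leaving out the index i gains a factor rho over the previous constant. For rho = 1 + eta h the
    result is exactly 1 / (eta h) instead of 1 / (eta h) + 1, which is why h need not be small. *)
Lemma weighted_sqr_sum_lt (rho : R) (x : nat -> R) i M : 1 < rho ->
  rho ^+ i * (\sum_(i.+1 <= k < M) x k) ^+ 2 <=
  (rho - 1)^-1 * \sum_(i.+1 <= k < M) rho ^+ k * x k ^+ 2.
Proof.
move=> r1; have r0 : 0 < rho := lt_trans ltr01 r1.
have := weighted_sqr_sum_le x i.+1 M r1.
rewrite exprS -mulrA -[rho / _ * _]mulrA ler_pM2l //.
Qed.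

End weighted_sums.

Section real_estimates.
Variable R : realType.

Lemma sqr_sumD_le (m : nat) (c : R) (a b q : nat -> R) : 0 <= c ->
  (forall j, (1 <= j < m.+1)%N -> b j ^+ 2 <= c * q j) ->
  (forall j, (1 <= j < m.+1)%N -> 0 <= q j) ->
  (\sum_(1 <= j < m.+1) (a j + b j)) ^+ 2 <=
  2 * m%:R * (1 + c) * \sum_(1 <= j < m.+1) (a j ^+ 2 + q j).
Proof.
move=> c0 bq q0; rewrite (le_trans (sqr_sum_le _ _ _)) // subn1 /=.
rewrite [2 * _]mulrC -!mulrA ler_wpM2l // mulrA [leRHS]mulr_sumr.
apply: ler_sum_nat => j jm; have := bq _ jm; have := q0 _ jm.
move: (a j) (b j) (q j) => x y p p0 yp.
have cx : 0 <= c * x ^+ 2 by rewrite mulr_ge0 ?sqr_ge0.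
have cp : 0 <= c * p by rewrite mulr_ge0.
rewrite [leRHS](_ : _ = 2 * x ^+ 2 + 2 * (c * x ^+ 2) + 2 * p + 2 * (c * p)); last by ring.
have := sqr_ge0 (x - y); rewrite sqrrB sqrrD; lra.
Qed.

(** Squares the one-step estimate of the remainder: [S] collects the norms at later times, [b] is
    the norm of the current z, and [e] that of the Y-perturbation. *)
Lemma drift_sqr_le (D h m c S b Q q e K : R) : 1 <= m -> 0 <= c -> 0 <= q -> 0 <= Q ->
  S ^+ 2 <= 2 * m * (1 + c) * Q -> b ^+ 2 <= c * q ->
  8 * D ^+ 2 * m * (1 + c) + 2 <= K ->
  (D * h * (S + b) + e) ^+ 2 <= K * (h ^+ 2 * Q + h ^+ 2 * q + e ^+ 2).
Proof.
move=> m1 c0 q0 Q0 SQ bq HK.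
have h2 : 0 <= h ^+ 2 by exact: sqr_ge0.
have D2 : 0 <= D ^+ 2 * h ^+ 2 by rewrite mulr_ge0 ?sqr_ge0.
apply: (@le_trans _ _ (2 * (D ^+ 2 * h ^+ 2 * (S + b) ^+ 2) + 2 * e ^+ 2)).
  have := sqr_ge0 (D * h * (S + b) - e); rewrite sqrrB sqrrD !exprMn; lra.
have Sb : (S + b) ^+ 2 <= 4 * m * (1 + c) * (Q + q).
  have cq : c * q <= m * (1 + c) * q.
    rewrite ler_wpM2r // (le_trans (_ : c <= 1 + c)) ?lerDr //.
    by rewrite ler_peMl // addr_ge0.
  have cq0 : 0 <= m * (1 + c) * q by rewrite !mulr_ge0 ?addr_ge0 //; lra.
  rewrite [leRHS](_ : _ = 2 * (2 * m * (1 + c) * Q) + 4 * (m * (1 + c) * q)); last by ring.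
  have := sqr_ge0 (S - b); rewrite sqrrB sqrrD; lra.
have tot0 : 0 <= h ^+ 2 * Q + h ^+ 2 * q + e ^+ 2.
  by rewrite !addr_ge0 ?(mulr_ge0 h2) ?sqr_ge0.
apply: le_trans (ler_wpM2r tot0 HK).
have c1 : 0 <= D ^+ 2 * m * (1 + c) by rewrite mulr_ge0 ?addr_ge0 // mulr_ge0 ?sqr_ge0 //; lra.
have := ler_wpM2l D2 Sb.
have : 0 <= D ^+ 2 * m * (1 + c) * e ^+ 2 by rewrite mulr_ge0 ?sqr_ge0.
have : 0 <= h ^+ 2 * Q by rewrite mulr_ge0.
have : 0 <= h ^+ 2 * q by rewrite mulr_ge0.
rewrite (_ : D ^+ 2 * h ^+ 2 * (4 * m * (1 + c) * (Q + q)) =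
  4 * (D ^+ 2 * m * (1 + c) * (h ^+ 2 * Q + h ^+ 2 * q))); last by ring.
move: (D ^+ 2 * h ^+ 2 * _) => u u1 u2 u3 u4.
rewrite (_ : (8 * D ^+ 2 * m * (1 + c) + 2) * (h ^+ 2 * Q + h ^+ 2 * q + e ^+ 2) =
  8 * (D ^+ 2 * m * (1 + c) * (h ^+ 2 * Q + h ^+ 2 * q)) + 8 * (D ^+ 2 * m * (1 + c) * e ^+ 2)
  + 2 * (h ^+ 2 * Q + h ^+ 2 * q + e ^+ 2)); last by ring.
by lra.
Qed.

(** For one component of z: [zt] is its unperturbed part, controlled by the martingale part [g] of
    y, and [e] the Z-perturbation. The next lemma adds the d components. *)
Lemma martingale_sqr_le (h L g zt e z : R) : 0 <= h -> 0 <= z -> 0 <= zt -> 0 <= g ->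
  Num.sqrt h * zt <= L * g -> z <= zt + e ->
  h * z ^+ 2 <= 2 * L ^+ 2 * g ^+ 2 + 2 * (h * e ^+ 2).
Proof.
move=> h0 z0 zt0 g0 zg ze.
have hz : h * zt ^+ 2 <= L ^+ 2 * g ^+ 2.
  have s0 : 0 <= Num.sqrt h * zt by rewrite mulr_ge0 ?sqrtr_ge0.
  rewrite -{1}(sqr_sqrtr h0) -!exprMn lerXn2r ?nnegrE //.
  exact: le_trans zg.
have z2 : z ^+ 2 <= 2 * zt ^+ 2 + 2 * e ^+ 2.
  have : z ^+ 2 <= (zt + e) ^+ 2 by rewrite lerXn2r // nnegrE // (le_trans z0).
  by have := sqr_ge0 (zt - e); rewrite sqrrB sqrrD; lra.
have := ler_wpM2l h0 z2.
rewrite (_ : h * (2 * zt ^+ 2 + 2 * e ^+ 2) = 2 * (h * zt ^+ 2) + 2 * (h * e ^+ 2)); last by ring.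
by move: (h * e ^+ 2) => u; lra.
Qed.

Lemma martingale_sum_le (h d L m g G e K : R) : 0 <= h -> 0 <= d -> 0 <= m -> 0 <= e -> 0 <= G ->
  g ^+ 2 <= m * G -> 2 + 2 * d * L ^+ 2 * m <= K ->
  d * (2 * L ^+ 2 * g ^+ 2) + 2 * (h * e) <= K * (G + h * e).
Proof.
move=> h0 d0 m0 e0 G0 gG HK.
have L2 : 0 <= L ^+ 2 by exact: sqr_ge0.
have he : 0 <= h * e by rewrite mulr_ge0.
have dL : 0 <= 2 * d * L ^+ 2 by rewrite mulr_ge0 // mulr_ge0.
have GE0 : 0 <= G + h * e by rewrite addr_ge0.
apply: le_trans (ler_wpM2r GE0 HK).
have := ler_wpM2l dL gG; have := mulr_ge0 (mulr_ge0 dL m0) he.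
rewrite [X in _ -> _ -> _ <= X](_ : _ = 2 * G + 2 * (h * e) + 2 * d * L ^+ 2 * (m * G) +
  2 * d * L ^+ 2 * m * (h * e)); last by ring.
rewrite (_ : d * (2 * L ^+ 2 * g ^+ 2) = 2 * d * L ^+ 2 * g ^+ 2); last by ring.
by move: (2 * d * L ^+ 2 * g ^+ 2) (2 * d * L ^+ 2 * (m * G)) (_ * (h * e)) => u1 u2 u3; lra.
Qed.

Lemma sum_le_bigmax (x : nat -> R) a b : (forall i, (a <= i < b)%N -> 0 <= x i) ->
  \sum_(a <= i < b) x i <= (b - a)%:R * \big[Num.max/0]_(a <= i < b) x i.
Proof.
move=> x0; apply: (@le_trans _ _ (\sum_(a <= i < b) \big[Num.max/0]_(a <= i < b) x i)).
  by apply: ler_sum_nat => i ib; apply: le_bigmax_seq; rewrite ?mem_index_iota.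
by rewrite sumr_const_nat mulr_natl.
Qed.
End real_estimates.

(** * Stability of backward recurrences in a filtered semi-inner-product space *)

Section semi_inner_product.
Variables (R : realType) (V : lmodType R) (ip : V -> V -> R).

(** Definiteness is omitted because square-integrable functions are not quotiented by almost sure
    equality. *)
Definition semi_inner_product := [/\ (forall u v, ip u v = ip v u),
  (forall u v w, ip (u + v) w = ip u w + ip v w),
  (forall c u w, ip (c *: u) w = c * ip u w) & forall u, 0 <= ip u u].

Hypothesis ipP : semi_inner_product.

Let ipC u v : ip u v = ip v u. Proof. by case: ipP. Qed.
Let ipDl u v w : ip (u + v) w = ip u w + ip v w. Proof. by case: ipP. Qed.
Let ipZl c u w : ip (c *: u) w = c * ip u w. Proof. by case: ipP. Qed.
Let ip_ge0 u : 0 <= ip u u. Proof. by case: ipP. Qed.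

Lemma ipDr u v w : ip w (u + v) = ip w u + ip w v.
Proof. by rewrite ipC ipDl !(ipC w). Qed.

Lemma ipZr c u w : ip w (c *: u) = c * ip w u.
Proof. by rewrite ipC ipZl (ipC w). Qed.

Lemma ipNl u w : ip (- u) w = - ip u w.
Proof. by rewrite -scaleN1r ipZl mulN1r. Qed.

Lemma ipBl u v w : ip (u - v) w = ip u w - ip v w.
Proof. by rewrite ipDl ipNl. Qed.

Lemma ip0l w : ip 0 w = 0.
Proof. by rewrite -(scale0r 0) ipZl mul0r. Qed.

Lemma ip_suml (I : Type) (r : seq I) (F : I -> V) w :
  ip (\sum_(i <- r) F i) w = \sum_(i <- r) ip (F i) w.
Proof.
by elim: r => [|i r IH]; rewrite ?big_nil ?ip0l // !big_cons ipDl IH.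
Qed.

Lemma ip_sqrD u v : ip (u + v) (u + v) = ip u u + 2 * ip u v + ip v v.
Proof. by rewrite ipDl !ipDr (ipC v u); ring. Qed.

Lemma ip_cauchy_schwarz u v : ip u v ^+ 2 <= ip u u * ip v v.
Proof.
have poly c : 0 <= ip u u + 2 * c * ip u v + c ^+ 2 * ip v v.
  have := ip_ge0 (u + c *: v); rewrite ip_sqrD ipZr ipZl ipZr.
  by rewrite !mulrA -expr2.
have [v0|v0] := eqVneq (ip v v) 0.
  have [->|uv0] := eqVneq (ip u v) 0; first by rewrite expr0n mulr_ge0.
  (* If v has norm zero the polynomial is affine in c, and this c gives it the value -1, so the
     mixed product must vanish. *)
  have := poly (- (ip u u + 1) / (2 * ip u v)); rewrite v0 mulr0 addr0.
  by rewrite [X in _ <= X](_ : _ = -1); [lra | field].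
have vp : 0 < ip v v by rewrite lt0r v0 ip_ge0.
have := poly (- ip u v / ip v v); rewrite -(ler_pM2l vp) mulr0.
set a := ip u u; set b := ip u v; set c := ip v v.
rewrite [X in _ <= X](_ : _ = c * a - b ^+ 2); last by field.
by rewrite mulrC subr_ge0.
Qed.

Definition nrm u := Num.sqrt (ip u u).

Lemma nrm_ge0 u : 0 <= nrm u. Proof. exact: sqrtr_ge0. Qed.

Lemma sqr_nrm u : nrm u ^+ 2 = ip u u. Proof. by rewrite sqr_sqrtr. Qed.

Lemma ip_le_nrm u v : `|ip u v| <= nrm u * nrm v.
Proof.
rewrite -(ler_pXn2r (n := 2)) ?nnegrE ?mulr_ge0 ?nrm_ge0 //.
by rewrite exprMn !sqr_nrm real_normK ?num_real // ip_cauchy_schwarz.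
Qed.

Lemma nrmD u v : nrm (u + v) <= nrm u + nrm v.
Proof.
rewrite -(ler_pXn2r (n := 2)) ?nnegrE ?addr_ge0 ?nrm_ge0 //.
rewrite sqrrD !sqr_nrm ip_sqrD lerD2r lerD2l mulr_natl.
by rewrite -mulr_natl -[leRHS]mulr_natl ler_pM2l // (le_trans (ler_norm _)) ?ip_le_nrm.
Qed.

Lemma nrmZ c u : nrm (c *: u) = `|c| * nrm u.
Proof. by rewrite /nrm ipZl ipZr mulrA -expr2 sqrtrM ?sqr_ge0 // sqrtr_sqr. Qed.

Lemma nrm0 : nrm 0 = 0.
Proof. by rewrite /nrm ip0l sqrtr0. Qed.

Lemma nrmN u : nrm (- u) = nrm u.
Proof. by rewrite -scaleN1r nrmZ normrN1 mul1r. Qed.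

Lemma nrmB u v : nrm (u - v) = nrm (v - u).
Proof. by rewrite -nrmN opprB. Qed.

Lemma nrm_eq u v : nrm (u - v) = 0 -> nrm u = nrm v.
Proof.
move=> uv; apply/le_anti/andP; split.
  by rewrite -{1}(subrK v u) (le_trans (nrmD _ _)) // uv add0r.
by rewrite -{1}(subrK u v) (le_trans (nrmD _ _)) // nrmB uv add0r.
Qed.

Lemma nrm_sum (I : Type) (r : seq I) (F : I -> V) :
  nrm (\sum_(i <- r) F i) <= \sum_(i <- r) nrm (F i).
Proof.
elim: r => [|i r IH]; first by rewrite !big_nil nrm0.
by rewrite !big_cons (le_trans (nrmD _ _)) // lerD2l.
Qed.

(** The abstract form of a conditional expectation. It is a relation, since without definiteness p
    is determined only up to a vector of norm zero. *)
Definition is_proj (S : V -> Prop) u p :=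
  S p /\ forall w, S w -> ip (u - p) w = 0.

Definition subspace (S : V -> Prop) :=
  (forall u v, S u -> S v -> S (u + v)) /\ (forall c u, S u -> S (c *: u)).

Lemma subspaceB S u v : subspace S -> S u -> S v -> S (u - v).
Proof. by move=> [SD SZ] Su Sv; rewrite -scaleN1r; apply/SD/SZ. Qed.

Lemma subspace_sum S (n : nat) (F : nat -> V) a : subspace S -> (exists u, S u) ->
  (forall i, (a <= i < n)%N -> S (F i)) -> S (\sum_(a <= i < n) F i).
Proof.
move=> [SD SZ] [u Su] SF; rewrite big_nat_cond.
apply: (big_ind S) => // [|i /andP[]//]; last by move=> /SF.
by rewrite -(scale0r u); exact: SZ.
Qed.

Lemma is_proj_unique S u p q : subspace S -> is_proj S u p -> is_proj S u q ->
  nrm (p - q) = 0.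
Proof.
move=> sS [Sp up] [Sq uq]; rewrite /nrm.
suff -> : ip (p - q) (p - q) = 0 by rewrite sqrtr0.
have Spq := subspaceB sS Sp Sq.
have := up _ Spq; have := uq _ Spq; rewrite !ipBl => /eqP; rewrite subr_eq0 => /eqP <-.
by move=> /eqP; rewrite subr_eq0 => /eqP ->; rewrite subrr.
Qed.

Lemma is_proj_pythagoras S u p : is_proj S u p -> ip u u = ip p p + ip (u - p) (u - p).
Proof.
move=> [Sp up]; rewrite -{1 2}(subrK p u) ip_sqrD (up p Sp); ring.
Qed.

Lemma is_proj_le S u p : is_proj S u p -> nrm p <= nrm u.
Proof.
move=> H; rewrite /nrm ler_wsqrtr // (is_proj_pythagoras H) lerDl //.
Qed.

Lemma is_proj_id (S : V -> Prop) u : S u -> is_proj S u u.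
Proof. by move=> Su; split=> // w _; rewrite subrr ip0l. Qed.

End semi_inner_product.

(** * Martingale increments along the recurrence *)

Section filtered_recurrence.
Variables (R : realType) (V : lmodType R) (ip : V -> V -> R).
Hypothesis ipP : semi_inner_product ip.
Variable G : nat -> V -> Prop.
Hypothesis G_subspace : forall i, subspace (G i).
Hypothesis G_mono : forall i j u, (i <= j)%N -> G i u -> G j u.
Hypothesis G_proj : forall i u, exists p, is_proj ip (G i) u p.

Local Notation nrm := (nrm ip).

Definition cproj i u := sval (cid (G_proj i u)).

Lemma cprojP i u : is_proj ip (G i) u (cproj i u).
Proof. exact: svalP (cid (G_proj i u)). Qed.

Definition increment l u := cproj l.+1 u - cproj l u.

Lemma cproj_step l u : is_proj ip (G l) (cproj l.+1 u) (cproj l u).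
Proof.
have [Gl pl] := cprojP l u; have [Gl1 pl1] := cprojP l.+1 u.
split=> // w Gw; have := pl w Gw; have := pl1 w (G_mono (leqnSn l) Gw).
by rewrite !(ipBl ipP) => /subr0_eq -> /subr0_eq ->; rewrite subrr.
Qed.

(** By the tower property [cproj l u] is a projection of [cproj l.+1 u], so each term is a
    Pythagorean difference and the sum telescopes. *)
Lemma sum_sqr_increment a b u : (a <= b)%N ->
  \sum_(a <= l < b) nrm (increment l u) ^+ 2 =
  nrm (cproj b u) ^+ 2 - nrm (cproj a u) ^+ 2.
Proof.
move=> ab; rewrite -(telescope_sumr (fun l => nrm (cproj l u) ^+ 2) ab); apply: eq_bigr => l _.
rewrite !(sqr_nrm ipP) (is_proj_pythagoras ipP (cproj_step l u)).
by rewrite addrC addKr.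
Qed.

Lemma sum_sqr_increment_le b u :
  \sum_(0 <= l < b) nrm (increment l u) ^+ 2 <= nrm u ^+ 2.
Proof.
rewrite sum_sqr_increment // lerBlDr ler_wpDr ?sqr_ge0 //.
by rewrite ler_pXn2r ?nnegrE ?nrm_ge0 // (is_proj_le ipP (cprojP b u)).
Qed.

Lemma nrm_cproj_id i u : G i u -> nrm (cproj i u) = nrm u.
Proof.
move=> Gu; apply: (nrm_eq ipP); apply: (is_proj_unique ipP (G_subspace i)) (cprojP i u) _.
exact: is_proj_id.
Qed.

Lemma sqr_nrm_sub_cproj a b u : (a <= b)%N -> G b u ->
  nrm (u - cproj a u) ^+ 2 = \sum_(a <= l < b) nrm (increment l u) ^+ 2.
Proof.
move=> ab Gu; rewrite sum_sqr_increment // nrm_cproj_id // !(sqr_nrm ipP).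
by rewrite (is_proj_pythagoras ipP (cprojP a u)) [RHS]addrC addKr.
Qed.

Variables (m n : nat) (alpha : nat -> R) (y r : nat -> V).
Hypothesis y_rec : forall i, (i <= n)%N -> forall w, G i w ->
  ip (\sum_(1 <= j < m.+1) alpha j *: y (i + j)%N + r i - y i) w = 0.

(** The Y-equation may be tested against G l because G l is contained in G i; this is where l <= i
    enters. *)
Lemma cproj_recurrence l i : (l <= i)%N -> (i <= n)%N ->
  nrm (cproj l (y i) - \sum_(1 <= j < m.+1) alpha j *: cproj l (y (i + j)%N)
       - cproj l (r i)) = 0.
Proof.
move=> li lin; rewrite -addrA -opprD.
apply: (is_proj_unique ipP (G_subspace l)) (cprojP l (y i)) _.
have [GD GZ] := G_subspace l.
split.
  apply: GD; last by have [] := cprojP l (r i).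
  apply: subspace_sum => // [|j _]; first by exists (cproj l (r i)); have [] := cprojP l (r i).
  by apply: GZ; have [] := cprojP l (y (i + j)%N).
move=> w Gw; have := y_rec lin (G_mono li Gw).
rewrite !(ipBl ipP).
case: ipP => _ ipD ipZ _; rewrite !ipD.
have [_ /(_ w Gw)] := cprojP l (r i); rewrite (ipBl ipP) => /subr0_eq ->.
rewrite !(ip_suml ipP).
have -> : \sum_(1 <= j < m.+1) ip (alpha j *: y (i + j)%N) w =
    \sum_(1 <= j < m.+1) ip (alpha j *: cproj l (y (i + j)%N)) w.
  apply: eq_bigr => j _; rewrite !ipZ; congr (_ * _).
  by have [_ /(_ w Gw)] := cprojP l (y (i + j)%N); rewrite (ipBl ipP) => /subr0_eq.
by move=> /subr0_eq ->; rewrite subrr.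
Qed.

(** D_l contains the projection at time l + 1, so the previous lemma has to be used with l + 1 <= i.
    This strictness later yields the sharp constant (rho - 1)^-1. *)
Lemma increment_recurrence l i : (l < i)%N -> (i <= n)%N ->
  nrm (increment l (y i) - \sum_(1 <= j < m.+1) alpha j *: increment l (y (i + j)%N)
       - increment l (r i)) = 0.
Proof.
move=> li lin; apply/le_anti; rewrite nrm_ge0 andbT.
have := cproj_recurrence (ltnW li) lin; have := cproj_recurrence li lin.
set u1 := _ - cproj l.+1 (r i); set u0 := _ - cproj l (r i) => n1 n0.
rewrite (_ : _ - increment l (r i) = u1 - u0).
  by rewrite (le_trans (nrmD ipP _ _)) // (nrmN ipP) n1 n0 addr0.
rewrite /u1 /u0 /increment.
have -> : \sum_(1 <= j < m.+1) alpha j *: (cproj l.+1 (y (i + j)%N) - cproj l (y (i + j)%N)) =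
  \sum_(1 <= j < m.+1) alpha j *: cproj l.+1 (y (i + j)%N) -
  \sum_(1 <= j < m.+1) alpha j *: cproj l (y (i + j)%N).
  by rewrite -sumrB; apply: eq_bigr => j _; rewrite scalerBr.
have subACA (a b c d : V) : (a - b) - (c - d) = (a - c) - (b - d).
  by rewrite !opprD !opprK addrACA.
by rewrite [X in X - _ = _]subACA [LHS]subACA.
Qed.

Lemma big_nat_sub (F : nat -> R) a b c : (b <= c.+1)%N ->
  \sum_(a <= k < b) F (c - k)%N = \sum_(c.+1 - b <= k < c.+1 - a) F k.
Proof.
have [ab|ba] := leqP a b; last by move=> ?; rewrite !big_geq //; lia.
elim: b ab => [|b IH] ab bc; first by rewrite !big_geq //; lia.
have [aEb|aNb] := eqVneq a b.+1; first by rewrite -aEb !big_geq //; lia.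
rewrite big_nat_recr /=; last by lia.
rewrite IH; [|lia|lia].
rewrite [RHS]big_ltn; last by lia.
by rewrite subSS subSn // addrC.
Qed.

Variable Kb : R.
Hypothesis Kb_bound : forall (N : V -> R) (a : nat -> V) (n : nat),
  N 0 = 0 -> (forall u, 0 <= N u) -> (forall u v, N (u + v) <= N u + N v) ->
  (forall c u, N (c *: u) = `|c| * N u) ->
  N (a n) <= Kb * (\sum_(0 <= k < m) N (a k) +
    \sum_(m <= k < n.+1) N (a k - \sum_(1 <= j < m.+1) alpha j *: a (k - j)%N)).

(** The time reversal k -> n + m - k turns the backward recurrence into a forward one whose m
    initial values are y(n+1), ..., y(n+m). [F] will be E_i or D_l. *)
Lemma image_recurrence_bound (F : V -> V) i : 0 <= Kb -> (i <= n)%N ->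
  (forall k, (i <= k <= n)%N -> nrm (F (y k) -
      \sum_(1 <= j < m.+1) alpha j *: F (y (k + j)%N) - F (r k)) = 0) ->
  nrm (F (y i)) <= Kb * (\sum_(n.+1 <= s < (n + m).+1) nrm (F (y s)) +
    \sum_(i <= k < n.+1) nrm (F (r k))).
Proof.
move=> Kb0 lin HF.
pose a k := F (y (n + m - k)%N).
have := Kb_bound a (n + m - i) (nrm0 ipP) (nrm_ge0 ip) (nrmD ipP) (nrmZ ipP).
rewrite {1}/a subKn; last by lia.
move/le_trans; apply; apply: ler_wpM2l => //; apply: lerD.
  rewrite (big_nat_sub (fun s => nrm (F (y s)))); last by lia.
  by rewrite subn0 -addSn addnK.
rewrite -[leRHS](_ : \sum_(m <= k < (n + m - i).+1) nrm (F (r (n + m - k)%N)) = _).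
  apply: ler_sum_nat => k /andP[mk kn].
  rewrite (nrm_eq ipP (v := F (r (n + m - k)%N))) //.
  rewrite -(HF (n + m - k)%N); last by lia.
  congr (nrm (_ - _ - _)); apply: eq_big_nat => j /andP[_ jm].
  by rewrite /a; congr (_ *: F (y _)); lia.
rewrite (big_nat_sub (fun s => nrm (F (r s)))); last by lia.
by congr bigop.body; congr (index_iota _ _); lia.
Qed.

End filtered_recurrence.

(** * Weighted energy estimates *)

Section weighted_energy.
Variables (R : realType) (V : lmodType R) (ip : V -> V -> R).
Hypothesis ipP : semi_inner_product ip.
Variable G : nat -> V -> Prop.
Hypothesis G_subspace : forall i, subspace (G i).
Hypothesis G_mono : forall i j u, (i <= j)%N -> G i u -> G j u.
Hypothesis G_proj : forall i u, exists p, is_proj ip (G i) u p.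
Variables (m n : nat) (alpha : nat -> R) (y r : nat -> V).
Hypothesis m_gt0 : (0 < m)%N.
Hypothesis y_adapted : forall i, (i <= n + m)%N -> G i (y i).
Hypothesis y_rec : forall i, (i <= n)%N -> forall w, G i w ->
  ip (\sum_(1 <= j < m.+1) alpha j *: y (i + j)%N + r i - y i) w = 0.
Variable Kb : R.
Hypothesis Kb_ge0 : 0 <= Kb.
Hypothesis Kb_bound : forall (N : V -> R) (a : nat -> V) (n : nat),
  N 0 = 0 -> (forall u, 0 <= N u) -> (forall u v, N (u + v) <= N u + N v) ->
  (forall c u, N (c *: u) = `|c| * N u) ->
  N (a n) <= Kb * (\sum_(0 <= k < m) N (a k) +
    \sum_(m <= k < n.+1) N (a k - \sum_(1 <= j < m.+1) alpha j *: a (k - j)%N)).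
(** [zq], [eq] and [ezq] stand for the squared L2 norms of the Z-difference, of the Y-perturbation
    and of the Z-perturbation. *)
Variables (h K rho : R) (zq eq ezq : nat -> R).
Hypothesis h_gt0 : 0 < h.
Hypothesis K_ge0 : 0 <= K.
Hypothesis rho_gt1 : 1 < rho.
Hypothesis zq_ge0 : forall i, 0 <= zq i.
Hypothesis eq_ge0 : forall i, 0 <= eq i.
Hypothesis ezq_ge0 : forall i, 0 <= ezq i.
Hypothesis zq_start : forall i, (n < i)%N -> zq i = 0.

Local Notation nrm := (nrm ip).
Local Notation D := (increment G_proj).

Hypothesis r_bound : forall i, (i <= n)%N -> nrm (r i) ^+ 2 <=
  K * (h ^+ 2 * (\sum_(1 <= j < m.+1) (nrm (y (i + j)%N) ^+ 2 + zq (i + j)%N))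
       + h ^+ 2 * zq i + eq i).
Hypothesis z_bound : forall i, (i <= n)%N -> h * zq i <=
  K * (\sum_(1 <= j < m.+1) nrm (y (i + j)%N - cproj G_proj i (y (i + j)%N)) ^+ 2
       + h * ezq i).

Let mm : R := m%:R.
(** The added 1 guarantees [B2] >= 1, so that the bound below covers the starting indices as
    well. *)
Let B2 : R := 2 * (Kb + 1) ^+ 2.
Let W := rho ^+ (n + m).
Let S := \sum_(n.+1 <= s < (n + m).+1) nrm (y s) ^+ 2.
Let Rr := \sum_(0 <= k < n.+1) rho ^+ k * nrm (r k) ^+ 2.
Let YY := \sum_(0 <= k < n.+1) rho ^+ k * nrm (y k) ^+ 2.
Let ZZ := \sum_(0 <= k < n.+1) rho ^+ k * zq k.

Let rho_gt0 : 0 < rho := lt_trans ltr01 rho_gt1.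
Let rhoX_ge0 k : 0 <= rho ^+ k. Proof. by rewrite exprn_ge0 // ltW. Qed.
Let rhoX_le i j : (i <= j)%N -> rho ^+ i <= rho ^+ j.
Proof. by move=> ij; rewrite ler_weXn2l // ltW. Qed.
Let mm_ge1 : 1 <= mm. Proof. by rewrite ler1n. Qed.
Let B2_ge1 : 1 <= B2.
Proof. by have := Kb_ge0; rewrite /B2; nra. Qed.
Let B2_ge0 : 0 <= B2. Proof. exact: le_trans B2_ge1. Qed.
Let mm_ge0 : 0 <= mm. Proof. exact: le_trans mm_ge1. Qed.
Let sq_ge0 (x : R) : 0 <= x ^+ 2. Proof. exact: sqr_ge0. Qed.
Let S_ge0 : 0 <= S. Proof. exact: sumr_ge0. Qed.

Let sqr_bound (x : R) (a b : nat -> R) p q : 0 <= x ->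
  x <= Kb * (\sum_(n.+1 <= s < (n + m).+1) a s + \sum_(p <= k < q) b k) ->
  x ^+ 2 <= B2 * (mm * \sum_(n.+1 <= s < (n + m).+1) a s ^+ 2 +
                  (\sum_(p <= k < q) b k) ^+ 2).
Proof.
move=> x0; have := sqr_sum_le a n.+1 (n + m).+1; rewrite subSS addKn -/mm.
set A := \sum_(_ <= s < _) a s; set A2 := \sum_(_ <= s < _) a s ^+ 2.
set B := \sum_(_ <= k < _) b k => AA xK.
have A20 : 0 <= mm * A2 by rewrite mulr_ge0 ?sumr_ge0.
have xx : x ^+ 2 <= Kb ^+ 2 * (A + B) ^+ 2.
  rewrite -exprMn ler_pXn2r ?nnegrE //; exact: le_trans xK.
apply: (le_trans xx); apply: (@le_trans _ _ (Kb ^+ 2 * (2 * (mm * A2 + B ^+ 2)))).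
  apply: ler_wpM2l => //; have := sqr_ge0 (A - B); nra.
rewrite mulrCA mulrA; apply: ler_wpM2r; first by rewrite addr_ge0.
by rewrite /B2 ler_pM2l // ler_pXn2r ?nnegrE ?addr_ge0 // lerDl.
Qed.

(** A bound for |D_l y_i|^2 that does not depend on i > l. The forcing remains the square of a sum,
    ready for the weighted Cauchy-Schwarz inequality. *)
Let Bl l := B2 * (mm * \sum_(n.+1 <= s < (n + m).+1) nrm (D l (y s)) ^+ 2 +
  (\sum_(l.+1 <= k < n.+1) nrm (D l (r k))) ^+ 2).

Let Bl_ge0 l : 0 <= Bl l.
Proof. by rewrite mulr_ge0 // addr_ge0 // mulr_ge0 // sumr_ge0. Qed.

Let increment_bound l i : (l < i)%N -> (i <= n + m)%N -> nrm (D l (y i)) ^+ 2 <= Bl l.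
Proof.
move=> li inm; have [lin|nli] := leqP i n.
  have H : nrm (D l (y i)) <= Kb * (\sum_(n.+1 <= s < (n + m).+1) nrm (D l (y s)) +
      \sum_(i <= k < n.+1) nrm (D l (r k))).
    apply: (image_recurrence_bound ipP Kb_bound Kb_ge0 lin) => k /andP[ik kn].
    by apply: increment_recurrence kn => //; apply: leq_trans ik.
  apply: (@sqr_bound _ (fun s => nrm (D l (y s))) (fun k => nrm (D l (r k)))).
    exact: nrm_ge0.
  apply: (le_trans H); apply: ler_wpM2l => //; rewrite lerD2l.
  by apply: sum_nat_sub_le => // k; exact: nrm_ge0.
apply: (@le_trans _ _ (\sum_(n.+1 <= s < (n + m).+1) nrm (D l (y s)) ^+ 2)).
  rewrite (big_rem i) ?mem_index_iota ?nli //= lerDl.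
  by apply: sumr_ge0.
rewrite /Bl; set s := (X in X <= _).
have s0 : 0 <= s by apply: sumr_ge0.
apply: (@le_trans _ _ (B2 * (mm * s))).
  by rewrite mulrA ler_peMl // mulr_ege1.
by rewrite ler_wpM2l // lerDl.
Qed.

(** The weights of the starting terms are replaced by the maximal weight [W]. For the forcing, the
    strict weighted inequality is followed by an exchange of sums and by the fact that the squared
    increments of r_k add up to at most |r_k|^2. *)
Let sum_Bl : \sum_(0 <= l < n + m) rho ^+ l * Bl l <=
  B2 * (mm * W * S + (rho - 1)^-1 * Rr).
Proof.
have rp : 0 <= (rho - 1)^-1 by rewrite invr_ge0 subr_ge0 ltW.
rewrite [leLHS](_ : _ = B2 * (mm * \sum_(0 <= l < n + m) rho ^+ l *
      \sum_(n.+1 <= s < (n + m).+1) nrm (D l (y s)) ^+ 2 +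
    \sum_(0 <= l < n + m) rho ^+ l *
      (\sum_(l.+1 <= k < n.+1) nrm (D l (r k))) ^+ 2)); last first.
  rewrite !mulr_sumr -big_split mulr_sumr; apply: eq_bigr => l _.
  by rewrite /Bl /=; ring.
apply: ler_wpM2l => //; apply: lerD.
  rewrite -mulrA; apply: ler_wpM2l => //.
  apply: (@le_trans _ _ (\sum_(0 <= l < n + m) W *
      \sum_(n.+1 <= s < (n + m).+1) nrm (D l (y s)) ^+ 2)).
    apply: ler_sum_nat => l /andP[_ lnm]; apply: ler_wpM2r; first exact: sumr_ge0.
    by apply: rhoX_le; apply: ltnW.
  rewrite -mulr_sumr; apply: ler_wpM2l; first exact: rhoX_ge0.
  rewrite exchange_big /=.
  by apply: ler_sum => s _; apply: sum_sqr_increment_le.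
apply: (@le_trans _ _ (\sum_(0 <= l < n + m) (rho - 1)^-1 *
    \sum_(0 <= k < n.+1) rho ^+ k * nrm (D l (r k)) ^+ 2)).
  apply: ler_sum => l _.
  apply: (le_trans (weighted_sqr_sum_lt (fun k => nrm (D l (r k))) l n.+1 rho_gt1)).
  apply: ler_wpM2l => //; apply: sum_nat_sub_le => // k.
  by rewrite mulr_ge0.
rewrite -mulr_sumr; apply: ler_wpM2l => //; rewrite exchange_big /=.
apply: ler_sum => k _; rewrite -mulr_sumr; apply: ler_wpM2l => //.
exact: sum_sqr_increment_le.
Qed.

(** The factor [mm ^+ 2] counts overlaps: for each i there are m indices j, and each l lies in at
    most m windows i <= l < i + m. *)
Lemma energy_Z : h * ZZ <= K * (mm ^+ 2 * (B2 * (mm * W * S + (rho - 1)^-1 * Rr))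
  + W * \sum_(0 <= i < n.+1) h * ezq i).
Proof.
pose Q l := rho ^+ l * Bl l.
have Q0 l : 0 <= Q l by rewrite mulr_ge0.
have zi i : (i < n.+1)%N -> h * (rho ^+ i * zq i) <=
    K * (mm * \sum_(0 <= t < m) Q (t + i)%N + W * (h * ezq i)).
  move=> lin; rewrite mulrCA.
  apply: (le_trans (ler_wpM2l (rhoX_ge0 i) (z_bound lin))).
  rewrite mulrCA; apply: ler_wpM2l => //; rewrite mulrDr; apply: lerD; last first.
    apply: ler_wpM2r; first by rewrite mulr_ge0 // ltW.
    by apply: rhoX_le; apply: leq_trans (lin : (i <= n)%N) (leq_addr _ _).
  rewrite [leLHS]mulr_sumr; apply: (@le_trans _ _ (\sum_(1 <= j < m.+1) \sum_(0 <= t < m) Q (t + i)%N)).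
    apply: ler_sum_nat => j /andP[j1 jm].
    rewrite (sqr_nrm_sub_cproj ipP G_subspace G_mono G_proj (b := (i + j)%N)) ?leq_addr //; last first.
      by apply: y_adapted; rewrite leq_add.
    apply: (@le_trans _ _ (\sum_(i <= l < i + j) Q l)).
      rewrite mulr_sumr; apply: ler_sum_nat => l /andP[il lij].
      by rewrite ler_pM // ?rhoX_le // increment_bound // leq_add.
    apply: (@le_trans _ _ (\sum_(i <= l < i + m) Q l)); first by apply: sum_nat_sub_le => //; rewrite leq_add2l.
    by rewrite -{1}(add0n i) big_addn addKn.
  by rewrite sumr_const_nat subn1 mulr_natl.
rewrite [leLHS]mulr_sumr; apply: (@le_trans _ _ (\sum_(0 <= i < n.+1)
    K * (mm * \sum_(0 <= t < m) Q (t + i)%N + W * (h * ezq i)))).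
  by apply: ler_sum_nat => i /andP[_]; exact: zi.
rewrite -mulr_sumr; apply: ler_wpM2l => //; rewrite big_split /= -!mulr_sumr lerD2r.
rewrite expr2 -mulrA; apply: ler_wpM2l => //.
apply: (@le_trans _ _ (mm * \sum_(0 <= l < n + m) Q l)); last by apply: ler_wpM2l.
rewrite exchange_big /= mulr_natl -[X in _ <= _ *+ X]subn0 -sumr_const_nat.
apply: ler_sum_nat => t /andP[_ tm].
under eq_bigr do rewrite addnC.
by apply: sum_nat_shift_le => //; rewrite addSn -addnS leq_add2l.
Qed.

(** The same argument with the projection E_i in place of D_l. The forcing at time i itself now
    occurs, hence the constant rho / (rho - 1). *)
Lemma energy_y i : (i <= n)%N -> rho ^+ i * nrm (y i) ^+ 2 <=
  B2 * (mm * W * S + rho / (rho - 1) * Rr).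
Proof.
move=> lin.
have rp : 0 <= rho / (rho - 1) by rewrite divr_ge0 ?subr_ge0 // ltW.
have H : nrm (cproj G_proj i (y i)) <= Kb * (
    \sum_(n.+1 <= s < (n + m).+1) nrm (cproj G_proj i (y s)) +
    \sum_(i <= k < n.+1) nrm (cproj G_proj i (r k))).
  apply: (image_recurrence_bound ipP Kb_bound Kb_ge0 lin) => k /andP[ik kn].
  exact: cproj_recurrence kn.
have {}H : nrm (y i) <= Kb * (\sum_(n.+1 <= s < (n + m).+1) nrm (y s) +
    \sum_(i <= k < n.+1) nrm (r k)).
  rewrite -(nrm_cproj_id ipP G_subspace G_proj (i := i)); last first.
    by apply: y_adapted; rewrite (leq_trans lin) // leq_addr.
  apply: (le_trans H); apply: ler_wpM2l => //; apply: lerD; apply: ler_sum => k _;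
    exact: is_proj_le (cprojP _ _ _).
have := @sqr_bound _ (fun s => nrm (y s)) (fun k => nrm (r k)) _ _ (nrm_ge0 _ _) H.
move=> /(ler_wpM2l (rhoX_ge0 i)) /le_trans; apply.
rewrite mulrCA; apply: ler_wpM2l => //; rewrite mulrDr; apply: lerD.
  rewrite mulrA [_ * mm]mulrC; apply: ler_wpM2r => //; apply: ler_wpM2l => //.
  by apply: rhoX_le; rewrite (leq_trans lin) // leq_addr.
apply: (le_trans (weighted_sqr_sum_le (fun k => nrm (r k)) i n.+1 rho_gt1)).
apply: ler_wpM2l => //; apply: sum_nat_sub_le => // k.
by rewrite mulr_ge0.
Qed.

(** Since only y_{k+j} with j >= 1 occur, the weight rho^k gains a factor rho^-1 when the index is
    shifted. It is kept for [YY] because it cancels the extra rho of [energy_y]. *)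
Lemma energy_r : Rr <= K * (h ^+ 2 * (mm * (rho^-1 * YY + W * S) + mm * ZZ)
  + h ^+ 2 * ZZ + W * \sum_(0 <= i < n.+1) eq i).
Proof.
have h2 : 0 <= h ^+ 2 by [].
have ri : 0 <= rho^-1 by rewrite invr_ge0 ltW.
apply: (@le_trans _ _ (\sum_(0 <= k < n.+1) rho ^+ k *
   (K * (h ^+ 2 * (\sum_(1 <= j < m.+1) (nrm (y (k + j)%N) ^+ 2 + zq (k + j)%N))
       + h ^+ 2 * zq k + eq k)))).
  by apply: ler_sum_nat => k kn; apply: ler_wpM2l => //; exact: r_bound.
under eq_bigr do rewrite mulrCA.
rewrite -mulr_sumr; apply: ler_wpM2l => //.
under eq_bigr do rewrite !mulrDr.
rewrite !big_split /=; apply: lerD; first apply: lerD.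
- under eq_bigr do rewrite mulrCA mulr_sumr.
  rewrite -mulr_sumr; apply: ler_wpM2l => //; rewrite exchange_big /=.
  rewrite -mulrDr mulr_natl -[X in _ <= _ *+ X]/(m.+1.-1) -subn1 -sumr_const_nat.
  apply: ler_sum_nat => j /andP[j1 jm].
  under eq_bigr do rewrite mulrDr.
  rewrite big_split /=; apply: lerD.
    (* A single summand for all indices up to n + m: the shifted weight where y is unknown, the
       maximal weight [W] on the starting values. *)
    pose F i := (if (i <= n)%N then rho^-1 * rho ^+ i else W) * nrm (y i) ^+ 2.
    have F0 i : 0 <= F i.
      by apply: mulr_ge0 => //; case: ifP => _; [apply: mulr_ge0 | apply: rhoX_ge0].
    apply: (@le_trans _ _ (\sum_(0 <= k < n.+1) F (k + j)%N)).
      apply: ler_sum_nat => k /andP[_ kn]; rewrite /F; apply: ler_wpM2r => //.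
      case: leqP => kj.
        by rewrite -(ler_pM2l rho_gt0) mulrA divff ?gt_eqF // mul1r -exprS rhoX_le // -addn1 leq_add2l.
      by apply: rhoX_le; rewrite (leq_trans (kn : (k <= n)%N)) // leq_addr.
    apply: (@le_trans _ _ (\sum_(0 <= i < (n + m).+1) F i)).
      by apply: sum_nat_shift_le => //; rewrite addSn ltnS leq_add2l.
    rewrite (big_cat_nat _ (n := n.+1)) //=; last by rewrite ltnS leq_addr.
    rewrite /YY /S; apply: lerD; rewrite [leRHS]mulr_sumr; apply: ler_sum_nat => k /andP[k1 k2]; rewrite /F.
      by rewrite (k2 : (k <= n)%N) -[leLHS]mulrA.
    by rewrite leqNgt k1 /=.
  apply: (@le_trans _ _ (\sum_(0 <= k < n.+1) rho ^+ (k + j) * zq (k + j)%N)).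
    by apply: ler_sum => k _; rewrite ler_wpM2r // rhoX_le // leq_addr.
  apply: (@le_trans _ _ (\sum_(0 <= i < (n + m).+1) rho ^+ i * zq i)).
    apply: (sum_nat_shift_le (F := fun i => rho ^+ i * zq i)) => [i|]; first by rewrite mulr_ge0.
    by rewrite addSn ltnS leq_add2l.
  rewrite (big_cat_nat _ (n := n.+1)) //=; last by rewrite ltnS leq_addr.
  rewrite [X in _ + X]big_nat_cond [X in _ + X]big1 ?addr0 //.
  by move=> i /andP[/andP[ni _] _]; rewrite zq_start ?mulr0.
- by rewrite [leRHS]mulr_sumr; apply: ler_sum => k _; rewrite mulrCA lexx.
rewrite [leRHS]mulr_sumr; apply: ler_sum_nat => k /andP[_ kn]; apply: ler_wpM2r => //.
by apply: rhoX_le; rewrite (leq_trans (kn : (k <= n)%N)) // leq_addr.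
Qed.

End weighted_energy.

Local Ltac pos :=
  repeat first [done | apply: addr_ge0 | apply: mulr_ge0 | exact: ltW].

Section hilbert_stability.
Variables (R : realType) (m : nat) (alpha : nat -> R) (T K : R).
Hypothesis m_gt0 : (0 < m)%N.
Hypothesis alpha_bounded :
  forall a, recurrence m alpha a -> exists M : R, forall n, `|a n| <= M.
Hypothesis T_gt0 : 0 < T.
Hypothesis K_ge0 : 0 <= K.

(** The unknowns are x = [Rr] / h and u = x / eta. The estimates for z and y bound their weighted
    sums, times h, by u plus data, and [energy_r] then gives x <= c1 u + c2 W Q. All constants are
    fixed before the space, n and h. *)
Lemma hilbert_stability : exists2 C, 0 <= C &
  forall (V : lmodType R) (ip : V -> V -> R) (G : nat -> V -> Prop)
    (G_proj : forall i u, exists p, is_proj ip (G i) u p)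
    (n : nat) (h : R) (y r : nat -> V) (zq eq ezq : nat -> R),
  semi_inner_product ip -> (forall i, subspace (G i)) ->
  (forall i j u, (i <= j)%N -> G i u -> G j u) ->
  0 < h -> (n + m)%:R * h <= T ->
  (forall i, (i <= n + m)%N -> G i (y i)) ->
  (forall i, (i <= n)%N -> forall w, G i w ->
    ip (\sum_(1 <= j < m.+1) alpha j *: y (i + j)%N + r i - y i) w = 0) ->
  (forall i, 0 <= zq i) -> (forall i, 0 <= eq i) -> (forall i, 0 <= ezq i) ->
  (forall i, (n < i)%N -> zq i = 0) ->
  (forall i, (i <= n)%N -> nrm ip (r i) ^+ 2 <=
    K * (h ^+ 2 * (\sum_(1 <= j < m.+1)
                     (nrm ip (y (i + j)%N) ^+ 2 + zq (i + j)%N))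
         + h ^+ 2 * zq i + eq i)) ->
  (forall i, (i <= n)%N -> h * zq i <=
    K * (\sum_(1 <= j < m.+1)
           nrm ip (y (i + j)%N - cproj G_proj i (y (i + j)%N)) ^+ 2
         + h * ezq i)) ->
  let Q := \sum_(n.+1 <= s < (n + m).+1) nrm ip (y s) ^+ 2 +
           \sum_(0 <= i < n.+1) (h * ezq i + h^-1 * eq i) in
  (forall i, (i <= n)%N -> nrm ip (y i) ^+ 2 <= C * Q) /\
  \sum_(0 <= i < n.+1) h * zq i <= C * Q.
Proof.
have [Kb Kb0 Kb_bound] := recurrence_perturbation_bound m_gt0 alpha_bounded.
(* Constants are introduced opaquely with a defining equation, so that algebraic tactics see them as
   atoms. *)
have [mm Emm] : {x : R | x = m%:R} by exists m%:R.
have [B2 EB2] : {x : R | x = 2 * (Kb + 1) ^+ 2} by exists (2 * (Kb + 1) ^+ 2).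
have [c1 Ec1] : {x : R | x = K * mm * T * B2 + K * (mm + 1) * K * mm ^+ 2 * B2} by eexists.
have [c2 Ec2] : {x : R | x = K * (mm * T * B2 * mm + T * mm
  + (mm + 1) * K * (mm ^+ 2 * B2 * mm + 1) + 1)} by eexists.
(* With this choice c1 u <= eta u / 2 = x / 2, so half of x survives the absorption; the 1 also
   gives eta >= 1 and u <= x. *)
have [eta Eeta] : {x : R | x = 2 * c1 + 1} by eexists.
have [W0 EW0] : {x : R | x = expR (eta * T)} by eexists.
have [Cy ECy] : {x : R | x = B2 * (mm + (1 + eta * T) * (2 * c2)) * W0} by eexists.
have [Cz ECz] : {x : R | x = K * (mm ^+ 2 * B2 * mm + mm ^+ 2 * B2 * (2 * c2) + 1) * W0} by eexists.
have mm1 : 1 <= mm by rewrite Emm ler1n.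
have mm0 : 0 <= mm by apply: le_trans mm1.
have B20 : 0 <= B2 by rewrite EB2 mulr_ge0 // sqr_ge0.
have T0 := ltW T_gt0.
have mm10 : 0 <= mm + 1 by rewrite addr_ge0.
have mm20 : 0 <= mm ^+ 2 by rewrite sqr_ge0.
have c10 : 0 <= c1 by rewrite Ec1; pos.
have c20 : 0 <= c2 by rewrite Ec2; pos.
have eta1 : 1 <= eta by rewrite Eeta lerDr mulr_ge0.
have eta0 : 0 < eta by apply: lt_le_trans eta1.
have W00 : 0 <= W0 by rewrite EW0 expR_ge0.
have Cy0 : 0 <= Cy by rewrite ECy; pos.
have Cz0 : 0 <= Cz by rewrite ECz; pos.
exists (Cy + Cz); first by rewrite addr_ge0.
move=> V ip G G_proj n h y r zq eq ezq ipP Gsub Gmono h0 hT yG yrec zq0 eq0 ezq0 zqs rb zb.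
pose rho := 1 + eta * h.
have eh0 : 0 < eta * h by rewrite mulr_gt0.
have rho1 : 1 < rho by rewrite ltrDl.
have rho0 : 0 < rho by apply: lt_trans rho1.
have rhoB : rho - 1 = eta * h by rewrite /rho addrAC subrr add0r.
have Kbb := Kb_bound V.
have EZ := energy_Z ipP Gsub Gmono m_gt0 yG yrec Kb0 Kbb h0 K_ge0 rho1 ezq0 zb.
have EY i := energy_y ipP Gsub Gmono G_proj m_gt0 yG yrec Kb0 Kbb rho1 (i := i).
have ER := energy_r K_ge0 rho1 zq0 eq0 zqs rb.
move: EZ EY ER; rewrite rhoB -Emm -EB2.
set W := rho ^+ (n + m).
set S := \sum_(n.+1 <= s < (n + m).+1) nrm ip (y s) ^+ 2.
set Rr := \sum_(0 <= k < n.+1) rho ^+ k * nrm ip (r k) ^+ 2.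
set YY := \sum_(0 <= k < n.+1) rho ^+ k * nrm ip (y k) ^+ 2.
set ZZ := \sum_(0 <= k < n.+1) rho ^+ k * zq k.
set H := \sum_(0 <= i < n.+1) h * ezq i.
set E1 := \sum_(0 <= i < n.+1) eq i.
move=> EZ EY ER Q.
have rX0 k : 0 <= rho ^+ k by rewrite exprn_ge0 // ltW.
have S0 : 0 <= S by apply: sumr_ge0 => i _; rewrite sqr_ge0.
have H0 : 0 <= H by apply: sumr_ge0 => i _; rewrite mulr_ge0 // ltW.
have E10 : 0 <= E1 by apply: sumr_ge0.
have Rr0 : 0 <= Rr by apply: sumr_ge0 => i _; rewrite mulr_ge0 // sqr_ge0.
have ZZ0 : 0 <= ZZ by apply: sumr_ge0 => i _; rewrite mulr_ge0.
have W1 : 1 <= W by rewrite exprn_ege1 // ltW.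
have W0' : 0 <= W by apply: le_trans W1.
have QE : Q = S + (H + h^-1 * E1).
  by rewrite /Q /S /H /E1 mulr_sumr -big_split.
have hV0 : 0 <= h^-1 by rewrite invr_ge0 ltW.
have hE0 : 0 <= h^-1 * E1 by rewrite mulr_ge0.
have SQ : S <= Q by rewrite QE lerDl addr_ge0.
have HQ : H <= Q by rewrite QE; lra.
have EQ : h^-1 * E1 <= Q by rewrite QE; lra.
have Q0 : 0 <= Q := le_trans S0 SQ.
have WQ0 : 0 <= W * Q by rewrite mulr_ge0.
have WS : W * S <= W * Q by rewrite ler_wpM2l.
have WH : W * H <= W * Q by rewrite ler_wpM2l.
have WE : W * (h^-1 * E1) <= W * Q by rewrite ler_wpM2l.
have nm1 : (n.+1 <= n + m)%N by rewrite -addn1 leq_add2l.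
have hleT : h <= T.
  apply: le_trans hT; rewrite -[leLHS]mul1r; apply: ler_wpM2r; first exact: ltW.
  by rewrite ler1n (leq_trans _ nm1).
(* (1 + eta h)^(n+m) <= exp(eta h (n + m)) <= exp(eta T): the weights are bounded independently of
   the step size. *)
have WW0 : W <= W0.
  rewrite EW0.
  apply: (@le_trans _ _ (expR (eta * h) ^+ (n + m))).
    by rewrite lerXn2r ?nnegrE ?expR_ge0 // ?(ltW rho0) // expR_ge1Dx.
  rewrite -expRM_natl ler_expR mulrCA ler_wpM2l // ltW //.
pose x := h^-1 * Rr.
have x0 : 0 <= x by rewrite mulr_ge0.
have xR : Rr = h * x by rewrite /x mulrA divff ?gt_eqF // mul1r.
pose u := eta^-1 * x.
have u0 : 0 <= u by rewrite mulr_ge0 // invr_ge0 ltW.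
have xu : x = eta * u by rewrite /u mulrA divff ?gt_eqF // mul1r.
have uR : (eta * h)^-1 * Rr = u.
  by rewrite xR /u; field; rewrite !gt_eqF.
have ux : u <= x by rewrite xu ler_peMl.
(* [energy_y] is summed over n + 1 indices with (n + 1) h <= T; the factor rho^-1 turns rho / (eta
   h) times [Rr] into u. *)
have Yb : h * (rho^-1 * YY) <= T * B2 * (mm * W * S + u).
  have rV : 0 < rho^-1 by rewrite invr_gt0.
  apply: (@le_trans _ _ (h * (rho^-1 * \sum_(0 <= k < n.+1) B2 * (mm * W * S + rho / (eta * h) * Rr)))).
    apply: ler_wpM2l; first exact: ltW.
    apply: ler_wpM2l; first exact: ltW.
    by apply: ler_sum_nat => k kn; apply: EY.
  rewrite sumr_const_nat subn0.
  have -> : rho / (eta * h) * Rr = rho * u by rewrite -uR; ring.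
  rewrite -mulr_natl.
  rewrite [leLHS](_ : _ = ((n.+1)%:R * h) * B2 * (rho^-1 * (mm * W * S) + u)); last by field; rewrite gt_eqF.
  have rV1 : rho^-1 <= 1 by rewrite invf_le1 // ltW.
  have mWS : 0 <= mm * W * S by rewrite !mulr_ge0.
  apply: ler_pM; rewrite ?mulr_ge0 ?(ltW h0) //.
  - by rewrite addr_ge0 // mulr_ge0 // ltW.
  - apply: ler_wpM2r => //; apply: le_trans hT; apply: ler_wpM2r; first exact: ltW.
    by rewrite ler_nat.
  by rewrite lerD2r ler_piMl.
have Zb : h * ZZ <= K * (mm ^+ 2 * (B2 * (mm * W * S + u)) + W * H) by rewrite -uR.
have mWSQ : mm * W * S <= mm * (W * Q) by rewrite -mulrA ler_wpM2l.
have Zb' : h * ZZ <= K * ((mm ^+ 2 * B2 * mm + 1) * (W * Q) + mm ^+ 2 * B2 * u).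
  apply: (le_trans Zb); apply: ler_wpM2l => //.
  apply: (@le_trans _ _ (mm ^+ 2 * (B2 * (mm * (W * Q) + u)) + W * Q)).
    by apply: lerD => //; do 2 apply: ler_wpM2l => //; rewrite lerD2r.
  by rewrite le_eqVlt; apply/orP; left; apply/eqP; ring.
have Yb' : h * (rho^-1 * YY) <= T * B2 * (mm * (W * Q) + u).
  by apply: (le_trans Yb); apply: ler_wpM2l; rewrite ?mulr_ge0 // lerD2r.
have xb : x <= c1 * u + c2 * (W * Q).
  have xb1 : x <= K * (mm * (h * (rho^-1 * YY)) + mm * (h * (W * S)) + (mm + 1) * (h * ZZ)
       + W * (h^-1 * E1)).
    rewrite /x; apply: (le_trans (ler_wpM2l hV0 ER)).
    by rewrite le_eqVlt; apply/orP; left; apply/eqP; field; rewrite !gt_eqF.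
  apply: (le_trans xb1).
  apply: (@le_trans _ _ (K * (mm * (T * B2 * (mm * (W * Q) + u)) + mm * (T * (W * Q))
     + (mm + 1) * (K * ((mm ^+ 2 * B2 * mm + 1) * (W * Q) + mm ^+ 2 * B2 * u)) + W * Q))).
    apply: ler_wpM2l => //; apply: lerD => //; apply: lerD; last by apply: ler_wpM2l.
    apply: lerD; apply: ler_wpM2l => //.
    by apply: ler_pM => //; [exact: ltW | apply: mulr_ge0].
  by rewrite le_eqVlt; apply/orP; left; apply/eqP; rewrite Ec1 Ec2; ring.
(* The absorption: x <= x / 2 + c2 W Q. *)
have u2 : u <= 2 * c2 * (W * Q).
  have : c1 * u <= x / 2.
    by rewrite xu Eeta; have := u0; lra.
  by move: xb ux; lra.
have x2 : x <= 2 * c2 * (W * Q).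
  have : c1 * u <= x / 2.
    by rewrite xu Eeta; have := u0; lra.
  by move: xb; lra.
have WQ : W * Q <= W0 * Q by rewrite ler_wpM2r.
split.
  move=> i lin; apply: (@le_trans _ _ (Cy * Q)); last by rewrite ler_wpM2r // lerDl.
  apply: (@le_trans _ _ (rho ^+ i * nrm ip (y i) ^+ 2)).
    by rewrite ler_peMl ?sqr_ge0 // exprn_ege1 // ltW.
  apply: (le_trans (EY i lin)).
  have -> : rho / (eta * h) * Rr = rho * u by rewrite -uR; ring.
  rewrite ECy [leRHS](_ : _ = B2 * ((mm + (1 + eta * T) * (2 * c2)) * (W0 * Q))); last by ring.
  apply: ler_wpM2l => //.
  apply: (@le_trans _ _ (mm * (W * Q) + (1 + eta * T) * (2 * c2 * (W * Q)))).
    apply: lerD => //; apply: ler_pM => //; first exact: ltW.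
    by rewrite lerD2l ler_wpM2l // ltW.
  rewrite [leLHS](_ : _ = (mm + (1 + eta * T) * (2 * c2)) * (W * Q)); last by ring.
  by apply: ler_wpM2l => //; pos.
apply: (@le_trans _ _ (Cz * Q)); last by rewrite ler_wpM2r // lerDr.
rewrite -mulr_sumr; apply: (@le_trans _ _ (h * ZZ)).
  apply: ler_wpM2l; first exact: ltW.
  by apply: ler_sum => k _; rewrite ler_peMl // exprn_ege1 // ltW.
apply: (le_trans Zb'); rewrite ECz [leRHS](_ : _ = K * ((mm ^+ 2 * B2 * mm + mm ^+ 2 * B2 * (2 * c2) + 1) * (W0 * Q))); last by ring.
apply: ler_wpM2l => //.
apply: (@le_trans _ _ ((mm ^+ 2 * B2 * mm + mm ^+ 2 * B2 * (2 * c2) + 1) * (W * Q))).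
  rewrite [leRHS](_ : _ = (mm ^+ 2 * B2 * mm + 1) * (W * Q) + mm ^+ 2 * B2 * (2 * c2 * (W * Q))); last by ring.
  by rewrite lerD2l ler_wpM2l // mulr_ge0.
by apply: ler_wpM2l => //; pos.
Qed.

End hilbert_stability.

(** * Conditional expectation and square-integrable variables *)

Section sub_sigma_algebra.
Context (R : realType) (dO : measure_display) (Omega : measurableType dO).
Context (P : probability Omega R).
Variable gens : set (set Omega).
Hypothesis gens_measurable : gens `<=` measurable.

Local Notation Om := (g_sigma_algebraType gens).

Lemma measurable_wrtI (xi : Omega -> R) :
  measurable_fun [set: Om] (xi : Om -> R) -> measurable_wrt <<s gens>> xi.
Proof. by move=> H B mB; have := H measurableT B mB; rewrite setTI. Qed.

Lemma measurable_wrtE (xi : Omega -> R) :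
  measurable_wrt <<s gens>> xi -> measurable_fun [set: Om] (xi : Om -> R).
Proof. by move=> H _ B mB; rewrite setTI; exact: H. Qed.

Lemma sub_sigma_measurable A : <<s gens>> A -> measurable A.
Proof.
move: A; apply: smallest_sub => //; split=> [|B mB|F mF].
- exact: measurable0.
- by rewrite setTD; exact: measurableC.
- exact: bigcupT_measurable.
Qed.

Lemma measurable_wrt_fun (xi : Omega -> R) :
  measurable_wrt <<s gens>> xi -> measurable_fun [set: Omega] xi.
Proof. by move=> H _ B mB; rewrite setTI; apply: sub_sigma_measurable; exact: H. Qed.

Definition to_sub (w : Omega) : Om := w.

Lemma measurable_to_sub : measurable_fun [set: Omega] to_sub.
Proof. by move=> _ B mB; rewrite setTI; exact: sub_sigma_measurable. Qed.

HB.instance Definition _ := isMeasurableFun.Build _ _ _ _ to_sub measurable_to_sub.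

(** The charge A -> E[xi; A] and the measure P are pushed forward by [to_sub], the identity map into
    the space with the smaller sigma-algebra; [eta] is the Radon-Nikodym derivative there. *)
Lemma condexp_exists (xi : Omega -> R) :
  P.-integrable [set: Omega] (EFin \o xi) ->
  exists eta, is_condexp P <<s gens>> xi eta.
Proof.
move=> ixi.
pose mu' := distribution P to_sub.
pose nu0 : {charge set Om -> \bar R} := pushforward (induced_charge ixi) to_sub.
pose nu := nu0 measurable_to_sub.
have numu : nu `<< mu'.
  apply: (dominates_pushforward (nu := induced_charge ixi)).
    exact: measurable_to_sub.
  apply/null_content_dominatesP => A mA PA0.
  apply: null_set_integral => //.
  by apply: (measurable_funS measurableT) => //; exact: measurable_int ixi.
pose f := Radon_Nikodym nu mu'.
have fi : mu'.-integrable [set: Om] f by exact: Radon_Nikodym_integrable.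
have ff x : f x \is a fin_num by exact: Radon_Nikodym_fin_num.
pose eta : Omega -> R := fun w => fine (f w).
have Ef : (EFin \o eta) = (f \o to_sub).
  by apply/funext => w; rewrite /= fineK.
have mf := measurable_int mu' fi.
have ie : P.-integrable [set: Omega] (f \o to_sub).
  have /integrableP[_] := fi.
  rewrite ge0_integral_pushforward //; last exact: measurableT_comp.
  rewrite preimage_setT => fiy; apply/integrableP; split => //.
  exact: (measurableT_comp mf measurable_to_sub).
exists eta; split => //.
- by rewrite Ef.
- by apply: measurable_wrtI; exact: (measurableT_comp (fine_measurable measurableT) mf).
move=> A GA.
have -> : (\int[P]_(w in A) (eta w)%:E = \int[mu']_(w in (A : set Om)) f w)%E.
  have ieA : P.-integrable (to_sub @^-1` A) (f \o to_sub).
    by apply: integrableS ie => //; exact: sub_sigma_measurable.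
  rewrite (integral_pushforward measurable_to_sub mf ieA GA).
  by apply: eq_integral => w _; rewrite /= fineK.
by rewrite -Radon_Nikodym_integral.
Qed.

End sub_sigma_algebra.

(** * Expectations and the space of square-integrable functions *)

Section square_integrable.
Context (R : realType) (dO : measure_display) (Omega : measurableType dO).
Context (P : probability Omega R).
Implicit Types (x y g th : Omega -> R).

Definition L1 x := P.-integrable [set: Omega] (EFin \o x).
Definition Ex x : R := \int[P]_w x w.

Lemma L1_measurable x : L1 x -> measurable_fun [set: Omega] x.
Proof. by move=> /measurable_int/measurable_EFinP. Qed.

Lemma L1_dominated x g : measurable_fun [set: Omega] x -> L1 g ->
  (forall w, `|x w| <= `|g w|) -> L1 x.
Proof.
move=> mx Lg xg; apply: le_integrable Lg => //; first exact/measurable_EFinP.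
by move=> w _ /=; rewrite lee_fin.
Qed.

Lemma L1_cst (c : R) : L1 (fun=> c).
Proof. exact: finite_measure_integrable_cst. Qed.

Lemma L1_bounded x (M : R) : measurable_fun [set: Omega] x ->
  (forall w, `|x w| <= M) -> L1 x.
Proof.
move=> mx xM; apply: (L1_dominated mx (L1_cst M)) => w.
by rewrite (le_trans (xM w)) // ler_norm.
Qed.

Lemma L1D x y : L1 x -> L1 y -> L1 (fun w => x w + y w).
Proof. move=> Lx Ly; exact: (integrableD measurableT Lx Ly). Qed.

Lemma L1Z (c : R) x : L1 x -> L1 (fun w => c * x w).
Proof. move=> Lx; exact: (integrableZl measurableT c Lx). Qed.

Lemma L1B x y : L1 x -> L1 y -> L1 (fun w => x w - y w).
Proof. move=> Lx Ly; exact: (integrableB measurableT Lx Ly). Qed.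

Lemma L1_norm x : L1 x -> L1 (fun w => `|x w|).
Proof.
move=> Lx; apply: (L1_dominated _ Lx) => [|w]; last by rewrite normr_id.
by apply: measurableT_comp => //; exact: L1_measurable.
Qed.

Lemma L1_mul_bounded x th (M : R) : measurable_fun [set: Omega] th ->
  (forall w, `|th w| <= M) -> L1 x -> L1 (fun w => th w * x w).
Proof.
move=> mth thM Lx; apply: (L1_dominated _ (L1Z M Lx)).
  by apply: measurable_funM => //; exact: L1_measurable.
move=> w; rewrite !normrM ler_wpM2r //.
by rewrite (le_trans (thM w)) // ler_norm.
Qed.

Lemma ExD x y : L1 x -> L1 y -> Ex (fun w => x w + y w) = Ex x + Ex y.
Proof. by move=> Lx Ly; rewrite /Ex RintegralD. Qed.

Lemma ExB x y : L1 x -> L1 y -> Ex (fun w => x w - y w) = Ex x - Ex y.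
Proof. by move=> Lx Ly; rewrite /Ex RintegralB. Qed.

Lemma ExZ (c : R) x : L1 x -> Ex (fun w => c * x w) = c * Ex x.
Proof. by move=> Lx; rewrite /Ex RintegralZl. Qed.

Lemma Ex_ge0 x : (forall w, 0 <= x w) -> 0 <= Ex x.
Proof. by move=> x0; apply: Rintegral_ge0 => w _; exact: x0. Qed.

Lemma le_Ex x y : L1 x -> L1 y -> (forall w, x w <= y w) -> Ex x <= Ex y.
Proof. by move=> Lx Ly xy; apply: le_Rintegral. Qed.

Lemma Ex_cst (c : R) : Ex (fun=> c) = c.
Proof.
rewrite /Ex (Rintegral_cst P measurableT c).
by rewrite -[RHS]mulr1; congr (_ * _); exact: (congr1 fine (probability_setT P)).
Qed.

Lemma normr_Ex x : L1 x -> `|Ex x| <= Ex (fun w => `|x w|).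
Proof. by move=> Lx; apply: le_normr_Rintegral. Qed.

Lemma EFin_Ex x : L1 x -> (Ex x)%:E = (\int[P]_w (x w)%:E)%E.
Proof. by move=> Lx; rewrite /Ex /Rintegral fineK // integrable_fin_num. Qed.

Lemma eq_Ex x y : x =1 y -> Ex x = Ex y.
Proof. by move=> xy; apply: eq_Rintegral => w _. Qed.

Lemma Lfun2P x : x \in Lfun P 2%:E <->
  measurable_fun [set: Omega] x /\ L1 (fun w => x w ^+ 2).
Proof.
split=> [xL|[mx /integrableP[_ ix]]].
  split; last exact: Lfun2_integrable_sqr.
  by move: xL; rewrite inE => /andP[]; rewrite inE.
apply/andP; split; rewrite inE //= /finite_norm unlock /Lnorm.
rewrite poweR_lty //; apply: le_lt_trans ix.
rewrite le_eqVlt; apply/orP; left; apply/eqP; apply: eq_integral => w _ /=.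
by rewrite powR_mulrn // normrX.
Qed.

Lemma L2_measurable x : x \in Lfun P 2%:E -> measurable_fun [set: Omega] x.
Proof. by move=> /Lfun2P[]. Qed.

Lemma L2_dominated x g : measurable_fun [set: Omega] x -> g \in Lfun P 2%:E ->
  (forall w, `|x w| <= `|g w|) -> x \in Lfun P 2%:E.
Proof.
move=> mx /Lfun2P[mg Lg] xg; apply/Lfun2P; split => //.
apply: (L1_dominated _ Lg) => [|w]; first exact: measurable_funX.
by rewrite !normrX lerXn2r // nnegrE.
Qed.

Lemma L2_bounded x (M : R) : measurable_fun [set: Omega] x ->
  (forall w, `|x w| <= M) -> x \in Lfun P 2%:E.
Proof.
move=> mx xM; apply: (L2_dominated mx (Lfun_cst P M 2)) => w /=.
by rewrite (le_trans (xM w)) // ler_norm.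
Qed.

Lemma L2D x y : x \in Lfun P 2%:E -> y \in Lfun P 2%:E ->
  (fun w => x w + y w) \in Lfun P 2%:E.
Proof.
move=> /Lfun2P[mx Lx] /Lfun2P[my Ly]; apply/Lfun2P; split.
  exact: measurable_funD.
apply: (L1_dominated _ (L1Z 2 (L1D Lx Ly))) => [|w].
  by apply: measurable_funX; exact: measurable_funD.
rewrite ger0_norm ?sqr_ge0 // ger0_norm; last first.
  by rewrite mulr_ge0 // addr_ge0 // sqr_ge0.
by have := sqr_ge0 (x w - y w); nra.
Qed.

Lemma L2Z (c : R) x : x \in Lfun P 2%:E -> (fun w => c * x w) \in Lfun P 2%:E.
Proof.
move=> /Lfun2P[mx Lx]; apply/Lfun2P; split; first exact: measurable_funM.
by under eq_fun do rewrite exprMn; exact: L1Z.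
Qed.

Lemma L2B x y : x \in Lfun P 2%:E -> y \in Lfun P 2%:E ->
  (fun w => x w - y w) \in Lfun P 2%:E.
Proof.
move=> Lx Ly; under eq_fun do rewrite -mulN1r.
by apply: L2D => //; exact: L2Z.
Qed.

Lemma L2_sum (I : Type) (r : seq I) (F : I -> Omega -> R) :
  (forall i, F i \in Lfun P 2%:E) -> (fun w => \sum_(i <- r) F i w) \in Lfun P 2%:E.
Proof.
move=> LF; elim: r => [|i r IH].
  by under eq_fun do rewrite big_nil; exact: (Lfun_cst P 0 2).
by under eq_fun do rewrite big_cons; exact: L2D.
Qed.

Lemma L2_norm x : x \in Lfun P 2%:E -> (fun w => `|x w|) \in Lfun P 2%:E.
Proof.
move=> Lx; apply: (L2_dominated _ Lx) => [|w]; last by rewrite normr_id.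
by apply: measurableT_comp => //; exact: L2_measurable.
Qed.

Lemma L2_mul x y : x \in Lfun P 2%:E -> y \in Lfun P 2%:E -> L1 (fun w => x w * y w).
Proof. by move=> Lx Ly; apply/Lfun1_integrable; exact: Lfun2_mul_Lfun1. Qed.

Lemma L2_L1 x : x \in Lfun P 2%:E -> L1 x.
Proof.
move=> Lx; have := L2_mul (Lfun_cst P 1 2) Lx.
by rewrite /L1; under eq_fun do rewrite /= mul1r.
Qed.

Definition L2space := LfunType P (lee1n 2 : (1 <= 2%:R%:E)%E).

(** Outside L2 the value is the default 0, so the equations about [to_L2] carry a membership
    hypothesis. *)
Definition to_L2 x : L2space := insubd (0 : L2space) x.

Lemma to_L2E x : x \in Lfun P 2%:E -> to_L2 x = x :> (Omega -> R).
Proof. by move=> Lx; rewrite /to_L2 insubdK. Qed.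

Lemma L2spaceP (u : L2space) : (u : Omega -> R) \in Lfun P 2%:E.
Proof. exact: LfunP. Qed.

Definition L2ip (u v : L2space) : R := Ex (fun w => u w * v w).

Lemma L2ipP : semi_inner_product L2ip.
Proof.
split=> [u v|u v w|c u w|u].
- by apply: eq_Ex => w; rewrite mulrC.
- rewrite /L2ip -ExD; try exact: L2_mul (L2spaceP _) (L2spaceP _).
  by apply: eq_Ex => o; rewrite -mulrDl.
- rewrite /L2ip -ExZ; last exact: L2_mul (L2spaceP _) (L2spaceP _).
  by apply: eq_Ex => o; rewrite mulrA.
- by apply: Ex_ge0 => w; rewrite -expr2 sqr_ge0.
Qed.

Lemma Ex_cauchy_schwarz x y : x \in Lfun P 2%:E -> y \in Lfun P 2%:E ->
  Ex (fun w => x w * y w) <=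
  Num.sqrt (Ex (fun w => x w ^+ 2)) * Num.sqrt (Ex (fun w => y w ^+ 2)).
Proof.
move=> Lx Ly; have := ip_le_nrm L2ipP (to_L2 x) (to_L2 y).
rewrite /nrm /L2ip !to_L2E // => H.
under [X in Num.sqrt X * _]eq_Ex do rewrite expr2.
under [X in _ * Num.sqrt X]eq_Ex do rewrite expr2.
by rewrite (le_trans (ler_norm _)).
Qed.

End square_integrable.

Section staircase.
Variable R : realType.

(** The integer part of t capped at n, written as a sum of threshold indicators so that composition
    with an adapted function gives a sum of indicators of adapted events. *)
Definition staircase (n : nat) (t : R) : R := \sum_(0 <= k < n) (k.+1%:R <= t)%R%:R.

Lemma staircase_bound n t : 0 <= t <= n%:R -> `|t - staircase n t| <= 1.
Proof.
move=> /andP[t0 tn].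
have H : forall k, (k%:R <= t -> staircase k t = k%:R) /\
    (t < k%:R -> t - 1 <= staircase k t <= t).
  elim=> [|k [IH1 IH2]].
    by split; rewrite /staircase big_geq // => /lt_geF; rewrite t0.
  have -> : staircase k.+1 t = staircase k t + (k.+1%:R <= t)%R%:R.
    by rewrite /staircase big_nat_recr.
  split=> [kt|tk].
    by rewrite kt IH1 ?natr1 // (le_trans _ kt) // ler_nat.
  rewrite (lt_geF tk) addr0; have [kt|tk'] := leP k%:R t; last exact: IH2.
  by rewrite IH1 // kt lerBlDr natr1 ltW.
have [H1 H2] := H n; have [nt|tn'] := leP n%:R t.
  by rewrite H1 // (_ : t = n%:R) ?subrr ?normr0 //; apply/le_anti; rewrite tn nt.
by have /andP[h1 h2] := H2 tn'; rewrite ger0_norm; lra.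
Qed.

End staircase.

Section condexp_L2.
Context (R : realType) (dO : measure_display) (Omega : measurableType dO).
Context (P : probability Omega R).
Variable gens : set (set Omega).
Hypothesis gens_measurable : gens `<=` measurable.
Local Notation G := (<<s gens>>).
Local Notation L1 := (L1 P).
Local Notation Ex := (Ex P).
Implicit Types (x y xi eta th : Omega -> R).

Lemma Ex_indic A x : measurable A -> L1 x ->
  (Ex (fun w => \1_A w * x w))%:E = (\int[P]_(w in A) (x w)%:E)%E.
Proof.
move=> mA Lx; rewrite EFin_Ex; last first.
  apply: (L1_mul_bounded (M := 1)) => // w; rewrite indicE.
  by case: (_ \in _); rewrite ?normr1 ?normr0.
rewrite [RHS]integral_mkcond; apply: eq_integral => w _.
by rewrite patchE indicE; case: ifP; rewrite ?mul1r ?mul0r.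
Qed.

(** A function with values in [0, 1] is, up to 1/n uniformly, the mean of the indicators of the n
    events {n th >= k + 1}. Each contributes 0, so |E[th x]| <= E|x| / n for every n > 0. *)
Lemma Ex_orth_unit x th : L1 x ->
  (forall A, G A -> (\int[P]_(w in A) (x w)%:E = 0)%E) ->
  measurable_wrt G th -> (forall w, 0 <= th w <= 1) ->
  Ex (fun w => th w * x w) = 0.
Proof.
move=> Lx x0 mth th01.
have mth' := measurable_wrt_fun gens_measurable mth.
pose A (n k : nat) : set Omega := [set w | k.+1%:R <= n%:R * th w].
have GA n k : G (A n k).
  have -> : A n k = (fun w => n%:R * th w) @^-1` `[k.+1%:R, +oo[.
    by apply/seteqP; split=> w; rewrite /A /= in_itv /= andbT.
  have H : measurable_wrt G (fun w => n%:R * th w).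
    by apply: measurable_wrtI; apply: measurable_funM => //; exact: measurable_wrtE.
  exact: H.
have mA n k : measurable (A n k) by apply: sub_sigma_measurable (GA n k).
have ind1 (B : set Omega) w : `|\1_B w : R| <= 1.
  by rewrite indicE; case: (_ \in _); rewrite ?normr1 ?normr0.
pose s (n : nat) w : R := n%:R^-1 * \sum_(0 <= k < n) \1_(A n k) w.
have Ls n k : L1 (fun w => \1_(A n k) w * x w) by apply: (L1_mul_bounded (M := 1)).
have Es n : Ex (fun w => s n w * x w) = 0 /\ L1 (fun w => s n w * x w).
  have E0 k : Ex (fun w => \1_(A n k) w * x w) = 0.
    by apply: EFin_inj; rewrite Ex_indic // x0.
  have [Z1 Z2] : Ex (fun w => \sum_(0 <= k < n) (\1_(A n k) w * x w)) = 0 /\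
      L1 (fun w => \sum_(0 <= k < n) (\1_(A n k) w * x w)).
    elim: {1 3}n => [|j [IH1 IH2]].
      split; first by rewrite -[RHS](Ex_cst P 0); apply: eq_Ex => w; rewrite big_geq.
      by under eq_fun do rewrite big_geq //; exact: L1_cst.
    split.
      under eq_Ex do rewrite big_nat_recr //=.
      by rewrite ExD // IH1 E0 addr0.
    by under eq_fun do rewrite big_nat_recr //=; exact: L1D.
  split.
    transitivity (n%:R^-1 * Ex (fun w => \sum_(0 <= k < n) (\1_(A n k) w * x w))).
      rewrite -ExZ //; apply: eq_Ex => w.
      by rewrite /s -mulrA mulr_suml.
    by rewrite Z1 mulr0.
  have := L1Z n%:R^-1 Z2; rewrite (_ : (fun w => _) = fun w => s n w * x w) //.
  by apply/funext => w; rewrite /s -mulrA mulr_suml.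
have Lt : L1 (fun w => th w * x w).
  apply: (L1_mul_bounded (M := 1)) => // w; have /andP[t0 t1] := th01 w.
  by rewrite ger0_norm.
have close n w : (0 < n)%N -> `|th w - s n w| <= n%:R^-1.
  move=> n0; have np : 0 < n%:R :> R by rewrite ltr0n.
  rewrite -(ler_pM2l np) mulfV ?gt_eqF // -{1}(gtr0_norm np) -normrM mulrBr /s.
  rewrite mulrA mulfV ?gt_eqF // mul1r.
  rewrite (_ : \sum_(0 <= k < n) _ = staircase n (n%:R * th w)); last first.
    apply: eq_bigr => k _; rewrite indicE; congr ((_ : bool)%:R).
    by apply/idP/idP; rewrite inE.
  apply: staircase_bound; have /andP[t0 t1] := th01 w.
  by rewrite mulr_ge0 //= ler_piMr.
have bound n : (0 < n)%N -> `|Ex (fun w => th w * x w)| * n%:R <= Ex (fun w => `|x w|).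
  move=> n0; have np : 0 < n%:R :> R by rewrite ltr0n.
  have [Es0 Lsn] := Es n.
  rewrite -[X in `|X|]subr0 -Es0 -ExB // -ler_pdivlMr // mulrC -ExZ; last exact: L1_norm.
  apply: (le_trans (normr_Ex (L1B Lt Lsn))); apply: le_Ex => [||w].
  - exact/L1_norm/L1B.
  - exact/L1Z/L1_norm.
  by rewrite -mulrBl normrM ler_wpM2r // close.
apply/eqP; rewrite -normr_eq0; apply: contraT => e0.
have ep : 0 < `|Ex (fun w => th w * x w)| by rewrite lt0r e0 /=.
set e := `|_| in bound ep.
pose N := (Num.truncn (Ex (fun w => `|x w|) / e)).+1.
have := bound N isT; rewrite mulrC -ler_pdivlMr // leNgt.
by rewrite truncnS_gt.
Qed.

Lemma condexp_pull_bounded xi eta th M : is_condexp P G xi eta ->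
  measurable_wrt G th -> (forall w, `|th w| <= M) ->
  Ex (fun w => th w * xi w) = Ex (fun w => th w * eta w).
Proof.
move=> [Lxi Leta meta E] mth thM.
have mth' := measurable_wrt_fun gens_measurable mth.
have M0 : 0 <= M := le_trans (normr_ge0 _) (thM point).
pose x w := xi w - eta w; have Lx : L1 x by exact: L1B.
have x0 A : G A -> (\int[P]_(w in A) (x w)%:E = 0)%E.
  move=> GA; have mA := sub_sigma_measurable gens_measurable GA.
  have iA y : L1 y -> P.-integrable A (EFin \o y) by move=> Ly; exact: integrableS Ly.
  have := integralB mA (iA _ Lxi) (iA _ Leta).
  rewrite -(E A GA) => H; transitivity (\int[P]_(w in A) ((xi w)%:E - (eta w)%:E))%E => //.
  by rewrite H /= subee // integrable_fin_num // iA.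
(* An affine rescaling into [0, 1]; M + 1 keeps the denominator positive when M = 0. The constant
   part contributes E[x] = 0. *)
pose t w := (M + 1 + th w) / (2 * (M + 1)).
have M1 : 0 < 2 * (M + 1) by lra.
have t01 w : 0 <= t w <= 1.
  have := thM w; rewrite ler_norml => /andP[h1 h2].
  apply/andP; split; last by rewrite ler_pdivrMr //; lra.
  by apply: divr_ge0; lra.
have mt : measurable_wrt G t.
  apply: measurable_wrtI; apply: measurable_funM => //; apply: measurable_funD => //.
  exact: measurable_wrtE.
have Z1 := Ex_orth_unit Lx x0 mt t01.
have Z2 : Ex x = 0.
  have GT : G setT by exact: (@measurableT _ (g_sigma_algebraType gens)).
  by apply: EFin_inj; rewrite EFin_Ex // x0.
have Ltxi : L1 (fun w => th w * xi w) by apply: (L1_mul_bounded (M := M)).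
have Lteta : L1 (fun w => th w * eta w) by apply: (L1_mul_bounded (M := M)).
apply/eqP; rewrite -subr_eq0 -ExB //.
have Ltx : L1 (fun w => t w * x w).
  apply: (L1_mul_bounded (M := 1)) => // [|w].
    exact: measurable_wrt_fun mt.
  by have /andP[a1 a2] := t01 w; rewrite ger0_norm.
rewrite (_ : Ex _ = Ex (fun w => 2 * (M + 1) * (t w * x w) - (M + 1) * x w)).
  by rewrite ExB ?ExZ ?Z1 ?Z2 ?mulr0 ?subrr //; exact: L1Z.
apply: eq_Ex => w; rewrite /t /x; field.
by apply/eqP; lra.
Qed.

(** Large values are set to 0 and not clipped, so that the product of the truncation with x is the
    square of the truncation. *)
Definition truncate (n : nat) x w : R := if `|x w| <= n%:R then x w else 0.

Lemma truncate_bound n x w : `|truncate n x w| <= n%:R.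
Proof. by rewrite /truncate; case: ifP => //; rewrite normr0. Qed.

Lemma truncate_norm n x w : `|truncate n x w| <= `|x w|.
Proof. by rewrite /truncate; case: ifP => //; rewrite normr0. Qed.

Lemma truncate_eventually x w n : (Num.truncn `|x w| < n)%N -> truncate n x w = x w.
Proof.
move=> xn; rewrite /truncate ifT // ltW // (lt_le_trans (truncnS_gt _)) //.
by rewrite ler_nat.
Qed.

Lemma measurable_wrt_truncate n x : measurable_wrt G x -> measurable_wrt G (truncate n x).
Proof.
move=> /measurable_wrtE mx; apply: measurable_wrtI; apply: measurable_fun_ifT => //.
by apply: measurable_fun_ler => //; exact: measurableT_comp.
Qed.

End condexp_L2.

Section condexp_square_integrable.
Context (R : realType) (dO : measure_display) (Omega : measurableType dO).
Context (P : probability Omega R).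
Variable gens : set (set Omega).
Hypothesis gens_measurable : gens `<=` measurable.
Local Notation G := (<<s gens>>).
Local Notation L1 := (L1 P).
Local Notation Ex := (Ex P).
Implicit Types (x y xi eta th : Omega -> R).

(* Duality: testing [xi] on bounded adapted functions decides square integrability of [eta],
   also when [xi] itself is only integrable. *)
Lemma condexp_L2 xi eta (c : R) : is_condexp P G xi eta -> 0 <= c ->
  (forall th M, measurable_wrt G th -> (forall w, `|th w| <= M) ->
     Ex (fun w => th w * xi w) <= c * Num.sqrt (Ex (fun w => th w ^+ 2))) ->
  eta \in Lfun P 2%:E /\ Ex (fun w => eta w ^+ 2) <= c ^+ 2.
Proof.
move=> ce c0 H; have [Lxi Leta mwe _] := ce.
have me := measurable_wrt_fun gens_measurable mwe.
have mt n := measurable_wrt_truncate n mwe.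
have mt' n := measurable_wrt_fun gens_measurable (mt n).
have bn n w : `|truncate n eta w ^+ 2| <= n%:R ^+ 2.
  by rewrite normrX lerXn2r ?nnegrE // truncate_bound.
have Ltn n : L1 (fun w => truncate n eta w ^+ 2).
  by apply: L1_bounded (bn n); exact: measurable_funX.
(* Testing with the truncation of eta itself gives a <= c sqrt(a) for its second moment a, hence a
   <= c^2 for all n; monotone convergence then removes the truncation. *)
have E2 n : Ex (fun w => truncate n eta w ^+ 2) <= c ^+ 2.
  have := H _ _ (mt n) (truncate_bound n eta).
  rewrite (condexp_pull_bounded gens_measurable ce (mt n) (truncate_bound n eta)).
  rewrite (@eq_Ex _ _ _ P (fun w => truncate n eta w * eta w)
     (fun w => truncate n eta w ^+ 2)); last first.
    by move=> w; rewrite /truncate; case: ifP; rewrite ?mul0r ?expr0n // expr2.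
  set a := Ex _; have a0 : 0 <= a by apply: Ex_ge0 => w; exact: sqr_ge0.
  rewrite -{1}(sqr_sqrtr a0) -{3}(sqr_sqrtr a0); have := sqrtr_ge0 a.
  set s := Num.sqrt a; move=> s0; have [->|sn] := eqVneq s 0.
    by rewrite expr0n sqr_ge0.
  by rewrite [X in X <= _ -> _]expr2 ler_pM2r ?lt0r ?sn // => sc; rewrite lerXn2r ?nnegrE.
have key : (\int[P]_w (eta w ^+ 2)%:E <= (c ^+ 2)%:E)%E.
  pose g n w := ((truncate n eta w ^+ 2)%:E : \bar R).
  have mg n : measurable_fun [set: Omega] (g n).
    by apply/measurable_EFinP; exact: measurable_funX.
  have g0 n w : [set: Omega] w -> (0 <= g n w)%E by rewrite lee_fin sqr_ge0.
  have gnd w : [set: Omega] w -> nondecreasing_seq (g ^~ w).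
    move=> _ p q pq; rewrite /g lee_fin /truncate; case: ifP => [h|_].
      by rewrite ifT // (le_trans h) // ler_nat.
    by rewrite expr0n sqr_ge0.
  have lg w : limn (g ^~ w) = (eta w ^+ 2)%:E.
    apply/cvg_lim => //; apply: cvg_near_cst.
    exists (Num.truncn `|eta w|).+1 => // n /= xn.
    by rewrite /g truncate_eventually.
  have := @cvg_monotone_convergence _ _ _ P setT measurableT g mg g0 gnd.
  under eq_integral do rewrite lg.
  move=> /cvg_lim <- //; apply: lime_le.
    apply: ereal_nondecreasing_is_cvgn => p q pq; apply: ge0_le_integral => //.
    - by move=> w wT; exact: g0.
    - by move=> w wT; exact: (gnd w wT p q pq).
  by apply: nearW => n; rewrite -EFin_Ex // lee_fin.
have Le : L1 (fun w => eta w ^+ 2).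
  apply/integrableP; split; first by apply/measurable_EFinP; exact: measurable_funX.
  apply: le_lt_trans (ltry (c ^+ 2)); apply: le_trans key.
  rewrite le_eqVlt; apply/orP; left; apply/eqP; apply: eq_integral => w _ /=.
  by rewrite ger0_norm ?sqr_ge0.
split; first by apply/Lfun2P.
by rewrite -lee_fin EFin_Ex.
Qed.

Lemma condexp_L2_L2 xi eta : is_condexp P G xi eta -> xi \in Lfun P 2%:E ->
  eta \in Lfun P 2%:E.
Proof.
move=> ce Lxi.
have [] // := condexp_L2 (c := Num.sqrt (Ex (fun w => xi w ^+ 2))) ce (sqrtr_ge0 _).
move=> th M mth thM.
have Lth : th \in Lfun P 2%:E.
  by apply: L2_bounded thM; exact: measurable_wrt_fun mth.
by rewrite [leRHS]mulrC; exact: Ex_cauchy_schwarz.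
Qed.

(** Dominated convergence, with |x th| as majorant, passes from bounded test functions to
    square-integrable ones. *)
Lemma Ex_orth_truncate x th : measurable_fun [set: Omega] x ->
  measurable_wrt G th -> L1 (fun w => x w * th w) ->
  (forall n, Ex (fun w => x w * truncate n th w) = 0) ->
  Ex (fun w => x w * th w) = 0.
Proof.
move=> mx mth Lx H; have mth' := measurable_wrt_fun gens_measurable mth.
have mt n := measurable_wrt_fun gens_measurable (measurable_wrt_truncate n mth).
have [] := @dominated_convergence _ _ _ P setT measurableT
  (fun n w => (x w * truncate n th w)%:E) (fun w => (x w * th w)%:E)
  (fun w => (`|x w * th w|)%:E).
- by move=> n; apply/measurable_EFinP; exact: measurable_funM.
- by apply/measurable_EFinP; exact: measurable_funM.
- apply: aeW => w _; apply: cvg_near_cst.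
  exists (Num.truncn `|th w|).+1 => // n /= xn.
  by rewrite truncate_eventually.
- exact: L1_norm Lx.
- apply: aeW => w n _ /=; rewrite lee_fin !normrM ler_wpM2l //.
  exact: truncate_norm.
move=> _ _.
have -> : (fun n => \int[P]_w (x w * truncate n th w)%:E)%E = (fun=> 0%E).
  apply/funext => n; rewrite -EFin_Ex ?H //.
  apply: (L1_dominated _ Lx) => [|w]; first exact: measurable_funM.
  by rewrite !normrM ler_wpM2l // truncate_norm.
by rewrite -EFin_Ex // => cv; apply: EFin_inj; rewrite -(cvg_lim _ cv) // lim_cst.
Qed.

Lemma condexp_orth xi eta th : is_condexp P G xi eta -> xi \in Lfun P 2%:E ->
  measurable_wrt G th -> th \in Lfun P 2%:E ->
  Ex (fun w => (xi w - eta w) * th w) = 0.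
Proof.
move=> ce Lxi mth Lth; have Leta := condexp_L2_L2 ce Lxi.
have Lx := L2B Lxi Leta.
apply: (Ex_orth_truncate (L2_measurable Lx) mth (L2_mul Lx Lth)) => n.
have mtn := measurable_wrt_truncate n mth.
have := condexp_pull_bounded gens_measurable ce mtn (truncate_bound n th).
have Lt : truncate n th \in Lfun P 2%:E.
  by apply: L2_bounded (truncate_bound n th); exact: measurable_wrt_fun mtn.
move=> H; transitivity (Ex (fun w => truncate n th w * xi w - truncate n th w * eta w)).
  by apply: eq_Ex => w; rewrite mulrC mulrBr.
by rewrite ExB ?H ?subrr //; exact: L2_mul.
Qed.

Definition adapted (u : L2space P) : Prop := measurable_wrt G u.

Lemma adapted_subspace : subspace adapted.
Proof.
split=> [u v Gu Gv|c u Gu]; apply: measurable_wrtI.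
  by apply: measurable_funD; exact: measurable_wrtE.
by apply: measurable_funM => //; exact: measurable_wrtE.
Qed.

(** The bridge between probability and the abstract part: conditional expectations are orthogonal
    projections onto the adapted subspace. *)
Lemma condexp_is_proj xi eta : is_condexp P G xi eta -> xi \in Lfun P 2%:E ->
  is_proj (@L2ip _ _ _ P) adapted (to_L2 P xi) (to_L2 P eta).
Proof.
move=> ce Lxi; have Leta := condexp_L2_L2 ce Lxi.
split; first by rewrite /adapted to_L2E //; case: ce.
move=> th Gth; rewrite /L2ip -[RHS](condexp_orth ce Lxi Gth (L2spaceP th)).
apply: eq_Ex => w; transitivity ((to_L2 P xi w - to_L2 P eta w) * th w) => //.
by rewrite !to_L2E.
Qed.

Lemma adapted_proj (u : L2space P) : exists p, is_proj (@L2ip _ _ _ P) adapted u p.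
Proof.
have Lu := L2spaceP u.
have [eta ce] := condexp_exists gens_measurable (L2_L1 Lu).
exists (to_L2 P eta); have := condexp_is_proj ce Lu.
by rewrite (_ : to_L2 P u = u) //; apply/val_inj; rewrite /= to_L2E.
Qed.

End condexp_square_integrable.

(** * Brownian increments *)

Section density.
Context d (T : measurableType d) (R : realType).
Variables (mu nu : {measure set T -> \bar R}) (f : T -> R).
Hypothesis mf : measurable_fun [set: T] f.
Hypothesis f_ge0 : forall x, 0 <= f x.
Hypothesis nu_density : forall B, measurable B ->
  (nu B = \int[mu]_(x in B) (f x)%:E)%E.

Import HBNNSimple.

Lemma integral_density_nnsfun (g : {nnsfun T >-> R}) :
  (\int[nu]_x (g x)%:E = \int[mu]_x (g x * f x)%:E)%E.
Proof.
have fin := fimfunP g.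
have mpre y : measurable (g @^-1` [set y]) by exact: measurable_sfunP.
rewrite integralT_nnsfun sintegralE.
rewrite [RHS](eq_integral (fun x => \sum_(y \in range g)
    (y * (\1_(g @^-1` [set y]) x * f x))%:E)%E); last first.
  move=> x _; rewrite fsbig_finite // sumEFin; congr EFin.
  rewrite {1}(fimfunE g x) fsbig_finite // mulr_suml.
  by apply: eq_bigr => y _; rewrite mulrA.
have y_ge0 y : range g y -> 0 <= y by move=> [x _ <-].
rewrite ge0_integral_fsum //; last 2 first.
- move=> y; apply/measurable_EFinP; apply: measurable_funM => //.
  by apply: measurable_funM => //; exact: measurable_indic.
- move=> y x _; rewrite lee_fin indicE; case: (boolP (x \in _)); last by rewrite mul0r mulr0.
  by rewrite inE => <-; rewrite mul1r mulr_ge0.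
rewrite !fsbig_finite // big_seq [RHS]big_seq; apply: eq_bigr => y.
rewrite in_fset_set // inE => /y_ge0 y0.
rewrite nu_density // integral_mkcond.
transitivity (\int[mu]_x (y%:E * (\1_(g @^-1` [set y]) x * f x)%:E))%E => //.
rewrite ge0_integralZl //.
- congr (_ * _)%E; apply: eq_integral => x _.
  by rewrite patchE indicE; case: ifP; rewrite ?mul1r ?mul0r.
- apply/measurable_EFinP; apply: measurable_funM => //; exact: measurable_indic.
- by move=> x _; rewrite lee_fin mulr_ge0.
Qed.

(** Used for the Gaussian density with respect to Lebesgue measure, and for P restricted to an
    event, whose density is an indicator. *)
Lemma ge0_integral_density (g : T -> R) : measurable_fun [set: T] g ->
  (forall x, 0 <= g x) ->
  (\int[nu]_x (g x)%:E = \int[mu]_x (g x * f x)%:E)%E.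
Proof.
move=> mg g0.
have mg' : measurable_fun [set: T] (EFin \o g) by exact/measurable_EFinP.
pose g_ := nnsfun_approx measurableT mg'.
have cg x : EFin \o g_ ^~ x @ \oo --> (g x)%:E.
  by apply: (cvg_nnsfun_approx measurableT mg') => // y _; rewrite /= lee_fin.
have ndg x p q : (p <= q)%N -> g_ p x <= g_ q x.
  by move=> pq; exact/lefP/nd_nnsfun_approx.
have mg_ n : measurable_fun [set: T] (g_ n) by [].
transitivity (limn (fun n => \int[nu]_x (g_ n x)%:E)%E).
  rewrite -monotone_convergence //=.
  - by apply: eq_integral => x _; apply/esym/cvg_lim => //; exact: cg.
  - by move=> n; apply/measurable_EFinP.
  - by move=> n x _; rewrite lee_fin.
  - by move=> x _ p q pq; rewrite lee_fin ndg.
under eq_fun do rewrite integral_density_nnsfun.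
rewrite -monotone_convergence //=.
- apply: eq_integral => x _; apply/cvg_lim => //.
  under eq_fun do rewrite EFinM.
  by rewrite EFinM; apply: cvgeZr => //; exact: cg.
- by move=> n; apply/measurable_EFinP; apply: measurable_funM.
- by move=> n x _; rewrite lee_fin mulr_ge0.
- by move=> x _ p q pq; rewrite lee_fin ler_wpM2r // ndg.
Qed.

End density.

(** * Moments of the centred Gaussian law *)

Section normal_moments.
Variables (R : realType) (s : R).
Hypothesis s_gt0 : 0 < s.
Local Notation N := (normal_prob 0 s).
Local Notation lam := (@lebesgue_measure R).

Let normal_pdf_val (t x : R) : t != 0 ->
  normal_pdf 0 t x = normal_peak t * expR (- x ^+ 2 / (t ^+ 2 *+ 2)).
Proof. by move=> t0; rewrite normal_pdfE //= /normal_fun subr0. Qed.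

(* u exp(-u) <= 1 with u = x^2 / 4 s^2 trades the factor x^2 for a wider Gaussian. *)
Lemma normal_pdf_mul_sqr (x : R) : x ^+ 2 * normal_pdf 0 s x <=
  4 * Num.sqrt 2 * s ^+ 2 * normal_pdf 0 (Num.sqrt 2 * s) x.
Proof.
have s0 : s != 0 by rewrite gt_eqF.
have r2 : 0 < Num.sqrt 2 :> R by rewrite sqrtr_gt0.
pose s' := Num.sqrt 2 * s.
have s'0 : s' != 0 by rewrite mulf_neq0 // gt_eqF.
have s'2 : s' ^+ 2 = 2 * s ^+ 2 by rewrite exprMn sqr_sqrtr.
rewrite -/s' !normal_pdf_val //.
have pk : normal_peak s = Num.sqrt 2 * normal_peak s'.
  rewrite /normal_peak s'2.
  have -> : 2 * s ^+ 2 * pi *+ 2 = 2 * (s ^+ 2 * pi *+ 2) by rewrite mulrnAr mulrA.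
  rewrite sqrtrM // invfM mulrA.
  by rewrite divff ?mul1r // gt_eqF.
pose u := x ^+ 2 / (4 * s ^+ 2).
have u0 : 0 <= u by apply: divr_ge0; [|apply: mulr_ge0 => //]; exact: sqr_ge0.
have -> : - x ^+ 2 / (s ^+ 2 *+ 2) = - u - u.
  by rewrite /u -mulr_natl; field; rewrite s0.
have -> : - x ^+ 2 / (s' ^+ 2 *+ 2) = - u.
  by rewrite /u s'2 -mulr_natl; field; rewrite s0.
have -> : x ^+ 2 = 4 * s ^+ 2 * u by rewrite /u; field; rewrite s0.
rewrite expRD pk.
have ue : u * expR (- u) <= 1.
  rewrite expRN ler_pdivrMr ?expR_gt0 // mul1r.
  by apply: le_trans (expR_ge1Dx u); rewrite lerDr.
rewrite [leLHS](_ : _ = 4 * Num.sqrt 2 * s ^+ 2 * (normal_peak s' * expR (- u)) * (u * expR (- u))); last by ring.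
by rewrite ler_piMr // !mulr_ge0 ?sqr_ge0 ?expR_ge0 ?normal_peak_ge0 // ltW.
Qed.

(** An upper bound proportional to s^2 suffices, since the factor only enters the stability
    constant; the exact variance is not computed. *)
Lemma normal_second_moment :
  (\int[N]_x (x ^+ 2)%:E <= (4 * Num.sqrt 2 * s ^+ 2)%:E)%E.
Proof.
have s0 : s != 0 by rewrite gt_eqF.
have r2 : 0 < Num.sqrt 2 :> R by rewrite sqrtr_gt0.
pose s' := Num.sqrt 2 * s.
have s'0 : s' != 0 by rewrite mulf_neq0 // gt_eqF.
have s'2 : s' ^+ 2 = 2 * s ^+ 2 by rewrite exprMn sqr_sqrtr.
have mpdf t : measurable_fun [set: R] (fun x => (normal_pdf 0 t x)%:E).
  by apply/measurable_EFinP; exact: measurable_normal_pdf.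
have dens B : measurable B -> (N B = \int[lam]_(x in B) (normal_pdf 0 s x)%:E)%E by [].
rewrite (@ge0_integral_density _ (measurableTypeR R) R lam N (normal_pdf 0 s)
  (measurable_normal_pdf 0 s) (normal_pdf_ge0 0 s) dens _
  (exprn_measurable 2) (fun x => sqr_ge0 x)).
apply: (@le_trans _ _ (\int[lam]_x ((4 * Num.sqrt 2 * s ^+ 2)%:E * (normal_pdf 0 s' x)%:E))%E).
  apply: ge0_le_integral => //.
  - by move=> x _; rewrite lee_fin mulr_ge0 ?sqr_ge0 // normal_pdf_ge0.
  - apply/measurable_EFinP; apply: measurable_funM; first exact: exprn_measurable.
    exact: measurable_normal_pdf.
  - by apply: measurable_funeM; exact: mpdf.
  by move=> x _; rewrite -EFinM lee_fin; exact: normal_pdf_mul_sqr.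
rewrite ge0_integralZl //.
- by rewrite integral_normal_pdf mule1.
- exact: mpdf.
- by move=> x _; rewrite lee_fin normal_pdf_ge0.
- by rewrite lee_fin mulr_ge0 ?sqr_ge0 // mulr_ge0 // ltW.
Qed.

Lemma normal_symmetric (B : set (measurableTypeR R)) : measurable B ->
  pushforward N (-%R : R -> measurableTypeR R) B = N B.
Proof.
have s0 : s != 0 by rewrite gt_eqF.
move=> mB; rewrite /pushforward /normal_prob.
have mo : measurable_fun [set: R] (-%R : R -> measurableTypeR R) by exact: oppr_measurable.
have mpdf : measurable_fun [set: R] (fun x => (normal_pdf 0 s x)%:E).
  by apply/measurable_EFinP; exact: measurable_normal_pdf.
transitivity (\int[pushforward lam (-%R : R -> measurableTypeR R)]_(x in B) (normal_pdf 0 s x)%:E)%E.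
  rewrite ge0_integral_pushforward //.
  - by apply: eq_integral => x _ /=; rewrite !normal_pdf_val // sqrrN.
  - exact: measurable_funTS.
  - by move=> x _; rewrite lee_fin normal_pdf_ge0.
by apply: eq_measure_integral => A mA _; exact: lebesgue_measureN.
Qed.

(** Vanishing of the mean, expressed through nonnegative integrals so that it follows from the
    symmetry of the law alone. *)
Lemma normal_pos_neg_part :
  (\int[N]_x (Num.max (- x) 0)%:E = \int[N]_x (Num.max x 0)%:E)%E.
Proof.
have mo : measurable_fun [set: measurableTypeR R] (-%R : measurableTypeR R -> measurableTypeR R) by exact: oppr_measurable.
have mm : measurable_fun [set: measurableTypeR R] (fun x : measurableTypeR R => (Num.max (x : R) 0)%:E).
  by apply/measurable_EFinP; apply: measurable_maxr.
rewrite -[LHS](ge0_integral_pushforward mo N measurableT mm); last first.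
  by move=> x _; rewrite lee_fin le_max lexx orbT.
by apply: eq_measure_integral => A mA _; exact: normal_symmetric.
Qed.

End normal_moments.

Section brownian_increments.
Context (R : realType) (dO : measure_display) (Omega : measurableType dO).
Context (P : probability Omega R) (d : nat).
Variable W : R -> Omega -> 'cV[R]_d.
Hypothesis W_bm : brownian_motion P W.

(** The generators of [natural_filtration], named so that the results on generated sigma-algebras
    apply to it by conversion. *)
Definition past_events (t : R) : set (set Omega) :=
  [set A | exists s k B,
     [/\ 0 <= s <= t, measurable B & A = [set w | B (W s w k 0)]]].

Lemma past_events_measurable t : past_events t `<=` measurable.
Proof.
move=> _ [s [k [B [/andP[s0 _] mB ->]]]].
have [mW _ _ _ _] := W_bm.
by have := mW s k s0 measurableT B mB; rewrite setTI.
Qed.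

Lemma natural_filtration_mono s t : s <= t ->
  natural_filtration W s `<=` natural_filtration W t.
Proof.
move=> st; apply: sub_sigma_algebra2 => _ [u [k [B [/andP[u0 us] mB ->]]]].
by exists u, k, B; split => //; rewrite u0 (le_trans us).
Qed.

Lemma measurable_wrt_mono s t (x : Omega -> R) : s <= t ->
  measurable_wrt (natural_filtration W s) x -> measurable_wrt (natural_filtration W t) x.
Proof. by move=> st mx B mB; apply: natural_filtration_mono st _ _; exact: mx. Qed.

Variables (s t : R) (k : 'I_d).
Hypothesis s_ge0 : 0 <= s.
Hypothesis s_lt_t : s < t.

Local Notation F := (natural_filtration W s).
Local Notation sigma := (Num.sqrt (t - s)).
Local Notation N := (normal_prob 0 sigma).
Let sigma_gt0 : 0 < sigma. Proof. by rewrite sqrtr_gt0 subr_gt0. Qed.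

Definition bm_increment (w : Omega) : R := W t w k 0 - W s w k 0.

Let mW u : 0 <= u -> measurable_fun [set: Omega] (fun w => W u w k 0).
Proof. by case: W_bm => mW _ _ _ _ u0; exact: mW. Qed.

Let t_ge0 : 0 <= t. Proof. exact: le_trans s_ge0 (ltW s_lt_t). Qed.

Lemma measurable_bm_increment : measurable_fun [set: Omega] bm_increment.
Proof. by apply: measurable_funB; exact: mW. Qed.

Lemma filtration_measurable A : F A -> measurable A.
Proof. exact: (sub_sigma_measurable (@past_events_measurable s)). Qed.

Lemma bm_increment_law A (B : set R) : F A -> measurable B ->
  P (bm_increment @^-1` B `&` A) = (P A * N B)%E.
Proof.
move=> FA mB; have [_ _ indep law _] := W_bm.
pose B' (j : 'I_d) : set R := if j == k then B else setT.
have mB' j : measurable (B' j) by rewrite /B'; case: ifP.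
have E : [set w | forall j, B' j ((W t w - W s w) j 0)] = bm_increment @^-1` B.
  apply/seteqP; split=> w /=.
    by move=> /(_ k); rewrite /B' eqxx !mxE.
  by move=> Bw j; rewrite /B'; case: eqP => // ->; rewrite !mxE.
have := indep s t A B' s_ge0 s_lt_t FA mB'; rewrite /= E setIC => ->; congr (_ * _)%E.
rewrite -E law // (bigD1 k) //= big1 ?mule1 /B' ?eqxx // => j /negbTE ->.
exact: (probability_setT (normal_prob 0 sigma)).
Qed.

(** By independence, the image under the increment of P restricted to A is P(A) times the normal
    law. *)
Lemma bm_increment_integral A (g : R -> R) : F A -> measurable_fun [set: R] g ->
  (forall x, 0 <= g x) ->
  (\int[P]_(w in A) (g (bm_increment w))%:E = P A * \int[N]_x (g x)%:E)%E.
Proof.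
move=> FA mg g0; have mA := filtration_measurable FA.
have mi := measurable_bm_increment.
have mgE : measurable_fun [set: R] (EFin \o g) by exact/measurable_EFinP.
have PA : P A = (fine (P A))%:E by rewrite fineK // fin_num_measure.
have PA0 : 0 <= fine (P A) by rewrite fine_ge0.
transitivity (\int[mrestr P mA]_w (g (bm_increment w))%:E)%E.
  rewrite (@ge0_integral_density _ _ R P (mrestr P mA) (\1_A : Omega -> R)) //.
  - rewrite [LHS]integral_mkcond; apply: eq_integral => w _.
    by rewrite patchE indicE; case: ifP; rewrite ?mulr1 ?mulr0.
  - by move=> B mB; rewrite /mrestr integral_indic // setIC.
  - exact: measurableT_comp.
have mi' : measurable_fun [set: Omega] (bm_increment : Omega -> measurableTypeR R) := mi.
have mg' : measurable_fun [set: measurableTypeR R] (fun x : measurableTypeR R => (g x)%:E).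
  exact: mgE.
transitivity (\int[pushforward (mrestr P mA) (bm_increment : Omega -> measurableTypeR R)]_x (g x)%:E)%E.
  by rewrite (ge0_integral_pushforward mi' _ measurableT mg') // => x _; rewrite lee_fin.
transitivity (\int[mscale (NngNum PA0) N]_x (g x)%:E)%E.
  apply: eq_measure_integral => B mB _.
  transitivity ((fine (P A))%:E * N B)%E => //.
  by rewrite -PA; exact: bm_increment_law.
rewrite ge0_integral_mscale //; last by move=> x _; rewrite lee_fin.
by rewrite [in RHS]PA.
Qed.

Let c := 4 * Num.sqrt 2 : R.

Let c_ge0 : 0 <= c. Proof. by rewrite mulr_ge0. Qed.

Let sigma2 : sigma ^+ 2 = t - s.
Proof. by rewrite sqr_sqrtr // subr_ge0 ltW. Qed.

Lemma filtration_setT : F [set: Omega].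
Proof. exact: (@measurableT _ (g_sigma_algebraType (past_events s))). Qed.

Lemma bm_increment_L2 : bm_increment \in Lfun P 2%:E.
Proof.
apply/Lfun2P; split; first exact: measurable_bm_increment.
apply/integrableP; split.
  by apply/measurable_EFinP; apply: measurable_funX; exact: measurable_bm_increment.
have := bm_increment_integral filtration_setT (exprn_measurable 2) (fun x => sqr_ge0 x).
rewrite probability_setT mul1e => E.
under eq_integral => w _ do rewrite /= ger0_norm ?sqr_ge0 //.
rewrite E; apply: le_lt_trans (normal_second_moment sigma_gt0) _.
exact: ltry.
Qed.

Lemma condexp_bm_increment_sqr : exists2 v : R, 0 <= v <= c * (t - s) &
  is_condexp P F (fun w => bm_increment w ^+ 2) (fun=> v).
Proof.
have [_ L1sq] := (Lfun2P _ _).1 bm_increment_L2.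
have Nv := normal_second_moment sigma_gt0.
have N0 : (0 <= \int[N]_x (x ^+ 2)%:E)%E.
  by apply: integral_ge0 => x _; rewrite lee_fin sqr_ge0.
have Nf : (\int[N]_x (x ^+ 2)%:E)%E \is a fin_num.
  by rewrite ge0_fin_numE // (le_lt_trans Nv) // ltry.
exists (fine (\int[N]_x (x ^+ 2)%:E)).
  apply/andP; split; first exact: fine_ge0.
  by rewrite -lee_fin fineK //; apply: le_trans Nv _; rewrite sigma2.
split => //; first exact: L1_cst.
  by apply: (@measurable_wrtI _ _ _ (past_events s)); exact: measurable_cst.
move=> A FA; have mA := filtration_measurable FA.
rewrite (bm_increment_integral FA (exprn_measurable 2) (fun x => sqr_ge0 x)).
by rewrite integral_cst // muleC fineK.
Qed.

Lemma condexp_bm_increment : is_condexp P F bm_increment (fun=> 0).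
Proof.
have Li := L2_L1 bm_increment_L2.
split => //; first exact: L1_cst.
  by apply: (@measurable_wrtI _ _ _ (past_events s)); exact: measurable_cst.
move=> A FA; have mA := filtration_measurable FA.
rewrite integral0 integralE.
have mp : measurable_fun [set: R] (fun x : R => Num.max x 0) by exact: measurable_maxr.
have mn : measurable_fun [set: R] (fun x : R => Num.max (- x) 0).
  by apply: measurable_maxr => //; exact: oppr_measurable.
have -> : (\int[P]_(w in A) ((fun w => (bm_increment w)%:E)^\+)%E w)%E =
    (P A * \int[N]_x (Num.max x 0)%:E)%E.
  rewrite -(bm_increment_integral FA mp); last by move=> x; rewrite le_max lexx orbT.
  by apply: eq_integral => w _; rewrite funeposE EFin_max.
have -> : (\int[P]_(w in A) ((fun w => (bm_increment w)%:E)^\-)%E w)%E =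
    (P A * \int[N]_x (Num.max (- x) 0)%:E)%E.
  rewrite -(bm_increment_integral FA mn); last by move=> x; rewrite le_max lexx orbT.
  by apply: eq_integral => w _; rewrite funenegE EFin_max.
rewrite normal_pos_neg_part //; apply/esym/subee.
have -> : (P A * \int[N]_x (Num.max x 0)%:E)%E =
    (\int[P]_(w in A) (Num.max (bm_increment w) 0)%:E)%E.
  by rewrite -(bm_increment_integral FA mp) // => x; rewrite le_max lexx orbT.
apply: integrable_fin_num => //; apply: (integrableS measurableT) => //.
apply: (L1_dominated _ Li) => [|w].
  by apply: measurable_maxr => //; exact: measurable_bm_increment.
by rewrite ger0_norm ?le_max ?lexx ?orbT // ge_max ler_norm normr_ge0.
Qed.

End brownian_increments.

Section finite_sums.
Context (R : realType) (dO : measure_display) (Omega : measurableType dO).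
Context (P : probability Omega R).

Lemma sum_nat_ind (Q : (Omega -> R) -> Prop) (F : nat -> Omega -> R) a b :
  Q (fun=> 0) -> (forall x y, Q x -> Q y -> Q (fun w => x w + y w)) ->
  (forall j, (a <= j < b)%N -> Q (F j)) -> Q (fun w => \sum_(a <= j < b) F j w).
Proof.
move=> Q0 QD; elim: b => [|b IH] QF.
  by under eq_fun do rewrite big_geq //.
have [ab|ba] := leqP a b; last by under eq_fun do rewrite big_geq //.
under eq_fun do rewrite big_nat_recr //=.
apply: QD; last by apply: QF; rewrite ab /=.
by apply: IH => j /andP[aj jb]; apply: QF; rewrite aj ltnS ltnW.
Qed.

Lemma L1_sum (F : nat -> Omega -> R) a b :
  (forall j, (a <= j < b)%N -> L1 P (F j)) -> L1 P (fun w => \sum_(a <= j < b) F j w).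
Proof. by apply: (@sum_nat_ind (fun x => L1 P x)); [exact: L1_cst | exact: L1D]. Qed.

Lemma L2_sum_nat (F : nat -> Omega -> R) a b :
  (forall j, (a <= j < b)%N -> F j \in Lfun P 2%:E) ->
  (fun w => \sum_(a <= j < b) F j w) \in Lfun P 2%:E.
Proof.
by apply: (@sum_nat_ind (fun x => x \in Lfun P 2%:E)); [exact: (Lfun_cst P 0 2) | exact: L2D].
Qed.

Lemma Ex_sum (F : nat -> Omega -> R) a b :
  (forall j, (a <= j < b)%N -> L1 P (F j)) ->
  Ex P (fun w => \sum_(a <= j < b) F j w) = \sum_(a <= j < b) Ex P (F j).
Proof.
have [ab|ba] := leqP a b; last first.
  move=> _; rewrite big_geq ?(ltnW ba) // -[RHS](Ex_cst P 0).
  by apply: eq_Ex => w; rewrite big_geq // ltnW.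
elim: b ab => [|b IH].
  rewrite leqn0 => /eqP -> _; rewrite big_geq // -[RHS](Ex_cst P 0).
  by apply: eq_Ex => w; rewrite big_geq.
rewrite leq_eqVlt => /orP[/eqP <- _|].
  rewrite big_geq // -[RHS](Ex_cst P 0).
  by apply: eq_Ex => w; rewrite big_geq.
rewrite ltnS => ab LF; rewrite big_nat_recr //= -IH //; last first.
  by move=> j /andP[aj jb]; apply: LF; rewrite aj ltnS ltnW.
under eq_Ex do rewrite big_nat_recr //=.
rewrite ExD //; last by apply: LF; rewrite ab /=.
by apply: L1_sum => j /andP[aj jb]; apply: LF; rewrite aj ltnS ltnW.
Qed.

End finite_sums.

Section brownian_coefficient.
Context (R : realType) (dO : measure_display) (Omega : measurableType dO).
Context (P : probability Omega R) (d : nat).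
Variable W : R -> Omega -> 'cV[R]_d.
Hypothesis W_bm : brownian_motion P W.
Variables (s : R) (k : 'I_d).
Hypothesis s_ge0 : 0 <= s.

Local Notation F := (natural_filtration W s).
Local Notation Ex := (Ex P).
Local Notation nr x := (Num.sqrt (Ex (fun w => x w ^+ 2))).
Local Notation cB := (4 * Num.sqrt 2).
Let gm := past_events_measurable W_bm (t := s).

(** Since th p is known at time s and the increment B is centred given the past, y may be replaced
    by y - p. Cauchy-Schwarz then leaves E[(th B)^2], which factorises because the conditional
    second moment of B is a constant. *)
Lemma Ex_bm_increment_test (t : R) (y p th : Omega -> R) (M : R) : s < t ->
  y \in Lfun P 2%:E -> p \in Lfun P 2%:E -> measurable_wrt F p ->
  measurable_wrt F th -> (forall w, `|th w| <= M) ->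
  `|Ex (fun w => th w * (y w * bm_increment W s t k w))| <=
    Num.sqrt (cB * (t - s)) * nr (fun w => y w - p w) * nr th.
Proof.
move=> st Ly Lp mp mth thM; set B := bm_increment W s t k.
have LB : B \in Lfun P 2%:E by exact: bm_increment_L2.
have mth' : measurable_fun [set: Omega] th by exact: (measurable_wrt_fun gm mth).
have M0 : 0 <= M := le_trans (normr_ge0 _) (thM point).
have bL2 x : x \in Lfun P 2%:E -> (fun w => th w * x w) \in Lfun P 2%:E.
  move=> Lx; apply: (L2_dominated _ (L2Z M Lx)) => [|w].
    by apply: measurable_funM => //; exact: (L2_measurable Lx).
  by rewrite !normrM ler_wpM2r // (le_trans (thM w)) // ler_norm.
have orth : Ex (fun w => B w * (th w * p w)) = 0.
  have mtp : measurable_wrt F (fun w => th w * p w).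
    apply: (@measurable_wrtI _ _ _ (past_events W s)).
    by apply: measurable_funM; exact: measurable_wrtE.
  have := condexp_orth gm (condexp_bm_increment W_bm k s_ge0 st) LB mtp (bL2 _ Lp).
  by under eq_Ex do rewrite subr0.
have -> : Ex (fun w => th w * (y w * B w)) =
    Ex (fun w => (y w - p w) * (th w * B w)).
  rewrite -[RHS]addr0 -orth -ExD.
  - by apply: eq_Ex => w; ring.
  - exact: (L2_mul (L2B Ly Lp) (bL2 _ LB)).
  - exact: (L2_mul LB (bL2 _ Lp)).
have Lyp := L2B Ly Lp; have LtB := bL2 _ LB.
have H : `|Ex (fun w => (y w - p w) * (th w * B w))| <=
    nr (fun w => y w - p w) * nr (fun w => th w * B w).
  rewrite ler_norml Ex_cauchy_schwarz // andbT lerNl.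
  have := Ex_cauchy_schwarz (L2Z (-1) Lyp) LtB.
  under eq_Ex do rewrite mulN1r mulNr -mulN1r.
  rewrite ExZ ?mulN1r; last exact: L2_mul.
  by under [X in Num.sqrt X * _]eq_Ex do rewrite mulN1r sqrrN.
apply: (le_trans H); rewrite [leRHS]mulrAC [leRHS]mulrC.
apply: ler_wpM2l; first exact: sqrtr_ge0.
have [v /andP[v0 vc] cv] := condexp_bm_increment_sqr W_bm k s_ge0 st.
have mth2 : measurable_wrt F (fun w => th w ^+ 2).
  apply: (@measurable_wrtI _ _ _ (past_events W s)).
  by apply: measurable_funX; exact: measurable_wrtE.
have th2M w : `|th w ^+ 2| <= M ^+ 2 by rewrite normrX lerXn2r ?nnegrE.
have Lth2 : L1 P (fun w => th w ^+ 2).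
  by apply: L1_bounded th2M; exact: measurable_funX.
have E : Ex (fun w => (th w * B w) ^+ 2) = v * Ex (fun w => th w ^+ 2).
  under eq_Ex do rewrite exprMn.
  rewrite (condexp_pull_bounded gm cv mth2 th2M).
  by under eq_Ex do rewrite mulrC; rewrite ExZ.
rewrite E; have e0 : 0 <= Ex (fun w => th w ^+ 2) by apply: Ex_ge0 => w; exact: sqr_ge0.
rewrite -sqrtrM; last by rewrite mulr_ge0 ?mulr_ge0 // subr_ge0 ltW.
by rewrite ler_wsqrtr // ler_wpM2r.
Qed.

(* Subtracting adapted [p j] from [y j] is free because the increments are centred given
   the past: this is what keeps the Z-error of the order of the martingale increments of Y. *)
Lemma condexp_bm_sum (m : nat) (t lam : nat -> R) (y p : nat -> Omega -> R) zeta :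
  (forall j, (1 <= j < m.+1)%N -> s < t j) ->
  (forall j, (1 <= j < m.+1)%N -> y j \in Lfun P 2%:E) ->
  (forall j, (1 <= j < m.+1)%N -> p j \in Lfun P 2%:E /\ measurable_wrt F (p j)) ->
  is_condexp P F (fun w => \sum_(1 <= j < m.+1)
    lam j * y j w * bm_increment W s (t j) k w) zeta ->
  zeta \in Lfun P 2%:E /\ nr zeta <= \sum_(1 <= j < m.+1)
    `|lam j| * (Num.sqrt (cB * (t j - s)) * nr (fun w => y j w - p j w)).
Proof.
move=> st Ly Lp ce; set c := \sum_(_ <= _ < _) _.
have c0 : 0 <= c by apply: sumr_ge0 => j _; rewrite !mulr_ge0 ?sqrtr_ge0.
(* The products of y with increments are only known to be integrable; duality yields the square
   integrability of [zeta] and its norm bound together. *)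
have [|Lz zc] := condexp_L2 gm ce c0; last first.
  split=> //; rewrite -(ler_pXn2r (n := 2)) ?nnegrE ?sqrtr_ge0 // sqr_sqrtr //.
  by apply: Ex_ge0 => w; exact: sqr_ge0.
move=> th M mth thM.
have mth' : measurable_fun [set: Omega] th by exact: (measurable_wrt_fun gm mth).
have LT j : (1 <= j < m.+1)%N ->
    L1 P (fun w => lam j * (th w * (y j w * bm_increment W s (t j) k w))).
  move=> jm; apply: L1Z; apply: (L1_mul_bounded mth' thM).
  by apply: L2_mul; [exact: Ly | exact: bm_increment_L2 (st _ jm)].
have -> : Ex (fun w => th w * \sum_(1 <= j < m.+1)
      lam j * y j w * bm_increment W s (t j) k w) =
    \sum_(1 <= j < m.+1) Ex (fun w => lam j * (th w * (y j w * bm_increment W s (t j) k w))).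
  rewrite -Ex_sum //; apply: eq_Ex => w; rewrite mulr_sumr.
  by apply: eq_bigr => j _; ring.
rewrite mulr_suml; apply: ler_sum_nat => j jm.
have [Lpj mpj] := Lp _ jm.
rewrite ExZ; last first.
  apply: (L1_mul_bounded mth' thM).
  by apply: L2_mul; [exact: Ly | exact: bm_increment_L2 (st _ jm)].
apply: (le_trans (ler_norm _)); rewrite normrM -[leRHS]mulrA.
apply: ler_wpM2l => //.
exact: Ex_bm_increment_test (st _ jm) (Ly _ jm) Lpj mpj mth thM.
Qed.

End brownian_coefficient.

(** * One step of the scheme *)

Section euclidean_norm.
Variable R : realType.

Lemma sum_sqr_le_sqr_sum (I : Type) (r : seq I) (F : I -> R) :
  (forall i, 0 <= F i) -> \sum_(i <- r) F i ^+ 2 <= (\sum_(i <- r) F i) ^+ 2.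
Proof.
move=> F0; elim: r => [|i r IH]; first by rewrite !big_nil expr0n.
rewrite !big_cons sqrrD (le_trans (lerD (lexx _) IH)) // lerD2r lerDl.
by rewrite mulrn_wge0 // mulr_ge0 // sumr_ge0.
Qed.

Lemma enorm_ge0 p q (A : 'M[R]_(p, q)) : 0 <= enorm A.
Proof. exact: sqrtr_ge0. Qed.

Lemma sqr_enorm p q (A : 'M[R]_(p, q)) : enorm A ^+ 2 = \sum_i \sum_j A i j ^+ 2.
Proof.
by rewrite sqr_sqrtr //; apply: sumr_ge0 => i _; apply: sumr_ge0 => j _; exact: sqr_ge0.
Qed.

Lemma enorm_le_sum p q (A : 'M[R]_(p, q)) : enorm A <= \sum_i \sum_j `|A i j|.
Proof.
have s0 : 0 <= \sum_i \sum_j `|A i j| by apply: sumr_ge0 => i _; exact: sumr_ge0.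
rewrite -(ler_pXn2r (n := 2)) ?nnegrE ?enorm_ge0 // sqr_enorm.
apply: le_trans (sum_sqr_le_sqr_sum _ _) => [|i]; last exact: sumr_ge0.
apply: ler_sum => i _; apply: le_trans (sum_sqr_le_sqr_sum _ _) => //.
by apply: ler_sum => j _; rewrite real_normK ?num_real.
Qed.

Lemma enorm0 p q : enorm (0 : 'M[R]_(p, q)) = 0.
Proof.
rewrite /enorm big1 ?sqrtr0 // => i _; apply: big1 => j _.
by rewrite mxE expr0n.
Qed.

End euclidean_norm.

(** * Measurability of Lipschitz functions of random variables *)

Section lipschitz_composition.
Context d (T : measurableType d) (R : realType) (I : finType).
Variables (phi : (I -> R) -> R) (L : R).
Hypothesis L_ge0 : 0 <= L.
Hypothesis phi_lip : forall u v, `|phi u - phi v| <= L * \sum_i `|u i - v i|.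

(** An enumeration of the rational points of the space; numbers that encode no point are sent to the
    origin. *)
Let grid (n : nat) : I -> R :=
  if unpickle n is Some q then fun i => ratr ((q : {ffun I -> rat}) i) else fun=> 0.

(* McShane: [phi v] is the infimum of the cones with vertices on a countable dense set. *)
Lemma measurable_lipschitz_comp (v : I -> T -> R) :
  (forall i, measurable_fun [set: T] (v i)) ->
  measurable_fun [set: T] (fun w => phi (fun i => v i w)).
Proof.
move=> mv.
pose h n w := phi (grid n) + L * \sum_i `|v i w - grid n i|.
have lb w n : phi (fun i => v i w) <= h n w.
  by rewrite -lerBlDl (le_trans (ler_norm _)).
have mh n : measurable_fun [set: T] (h n).
  apply: measurable_funD => //; apply: measurable_funM => //.
  apply: measurable_sum => i; apply: measurableT_comp => //.
  exact: measurable_funB.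
have hlb w : has_lbound (range (h ^~ w)).
  by exists (phi (fun i => v i w)) => _ [n _ <-]; exact: lb.
have -> : (fun w => phi (fun i => v i w)) = (fun w => infs (h ^~ w) 0%N).
  apply/funext => w; apply/le_anti/andP; split.
    apply: lb_le_inf; first by exists (h 0%N w), 0%N.
    by move=> _ [n _ <-]; exact: lb.
  apply/ler_addgt0Pr => e e0.
  (* The Lipschitz error is counted twice, in the value at the vertex and in the slope of the cone;
     both fit into e, and K > 0 even when L = 0. *)
  pose K := 2 * L * (#|I|%:R + 1) + 1.
  have K0 : 0 < K by rewrite ltr_wpDl // !mulr_ge0 // addr_ge0.
  have eK : 0 < e / K by rewrite divr_gt0.
  have appr i : exists q : rat, `|v i w - ratr q| <= e / K.
    have [|q] := @rat_in_itvoo R (v i w) (v i w + e / K); first by rewrite ltrDl.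
    rewrite in_itv /= => /andP[q1 q2]; exists q.
    by rewrite ler_norml; apply/andP; split; lra.
  have [q qP] := choice appr.
  pose n := pickle [ffun i => q i].
  have gn i : grid n i = ratr (q i) by rewrite /grid /n pickleK ffunE.
  apply: (@le_trans _ _ (h n w)).
    apply: ge_inf; last by exists n.
    by exists (phi (fun i => v i w)) => _ [k _ <-]; exact: lb.
  have close : \sum_i `|v i w - grid n i| <= #|I|%:R * (e / K).
    rewrite mulr_natl -sumr_const; apply: ler_sum => i _.
    by rewrite gn qP.
  have h1 : phi (grid n) <= phi (fun i => v i w) + L * (#|I|%:R * (e / K)).
    rewrite -lerBlDl (le_trans (ler_norm _)) // (le_trans (phi_lip _ _)) //.
    rewrite ler_wpM2l // (le_trans _ close) // le_eqVlt; apply/orP; left; apply/eqP.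
    by apply: eq_bigr => i _; rewrite distrC.
  have h2 : L * \sum_i `|v i w - grid n i| <= L * (#|I|%:R * (e / K)) by rewrite ler_wpM2l.
  apply: (le_trans (lerD h1 h2)); rewrite -addrA lerD2l -mulr2n -mulr_natl.
  rewrite [leLHS](_ : _ = 2 * L * #|I|%:R / K * e); last by ring.
  rewrite ler_piMl ?(ltW e0) // ler_pdivrMr // mul1r /K.
  by have := L_ge0; lra.
apply: measurable_fun_infs => // w _; exact: hlb.
Qed.

End lipschitz_composition.

Section l2_norm.
Context (R : realType) (dO : measure_display) (Omega : measurableType dO).
Context (P : probability Omega R).
Implicit Types (x y g xi eta : Omega -> R).
Local Notation Ex := (Ex P).

Definition l2norm x : R := Num.sqrt (Ex (fun w => x w ^+ 2)).

Lemma l2norm_ge0 x : 0 <= l2norm x. Proof. exact: sqrtr_ge0. Qed.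

Lemma sqr_l2norm x : l2norm x ^+ 2 = Ex (fun w => x w ^+ 2).
Proof. by rewrite sqr_sqrtr //; apply: Ex_ge0 => w; exact: sqr_ge0. Qed.

Lemma nrm_to_L2 x : x \in Lfun P 2%:E -> nrm (@L2ip _ _ _ P) (to_L2 P x) = l2norm x.
Proof.
by move=> Lx; rewrite /nrm /L2ip to_L2E.
Qed.

Lemma le_l2norm x g : measurable_fun [set: Omega] x -> g \in Lfun P 2%:E ->
  (forall w, `|x w| <= `|g w|) -> l2norm x <= l2norm g.
Proof.
move=> mx Lg xg; have Lx := L2_dominated mx Lg xg.
have [_ Lx2] := (Lfun2P _ _).1 Lx; have [_ Lg2] := (Lfun2P _ _).1 Lg.
rewrite /l2norm ler_wsqrtr //; apply: le_Ex => // w.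
by rewrite -[leLHS]ger0_norm ?sqr_ge0 // -[leRHS]ger0_norm ?sqr_ge0 // !normrX lerXn2r ?nnegrE.
Qed.

Lemma to_L2D x y : x \in Lfun P 2%:E -> y \in Lfun P 2%:E ->
  to_L2 P (fun w => x w + y w) = to_L2 P x + to_L2 P y.
Proof.
move=> Lx Ly; apply/val_inj/funext => w.
transitivity (x w + y w); first by rewrite -[LHS]/(to_L2 P _ w) to_L2E //; exact: L2D.
by transitivity (to_L2 P x w + to_L2 P y w) => //; rewrite !to_L2E.
Qed.

Lemma to_L2Z (c : R) x : x \in Lfun P 2%:E ->
  to_L2 P (fun w => c * x w) = c *: to_L2 P x.
Proof.
move=> Lx; apply/val_inj/funext => w.
transitivity (c * x w); first by rewrite -[LHS]/(to_L2 P _ w) to_L2E //; exact: L2Z.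
by transitivity (c * to_L2 P x w) => //; rewrite !to_L2E.
Qed.

Lemma to_L2_sum (F : nat -> Omega -> R) a b :
  (forall j, (a <= j < b)%N -> F j \in Lfun P 2%:E) ->
  to_L2 P (fun w => \sum_(a <= j < b) F j w) = \sum_(a <= j < b) to_L2 P (F j).
Proof.
have E0 c e : (e <= c)%N -> to_L2 P (fun w => \sum_(c <= j < e) F j w) =
    \sum_(c <= j < e) to_L2 P (F j).
  move=> ec; rewrite [RHS]big_geq // -(scale0r (to_L2 P (fun=> 0))) -to_L2Z; last exact: (Lfun_cst P 0 2).
  by congr (to_L2 P _); apply/funext => w; rewrite big_geq // mul0r.
elim: b => [|b IH] LF; first exact: E0.
have [ab|ba] := leqP a b; last exact: E0.
have LF' j : (a <= j < b)%N -> F j \in Lfun P 2%:E.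
  by move=> /andP[aj jb]; apply: LF; rewrite aj ltnS ltnW.
rewrite big_nat_recr //= -IH // -to_L2D; last 2 first.
- exact: L2_sum_nat.
- by apply: LF; rewrite ab /=.
by congr (to_L2 P _); apply/funext => w; rewrite big_nat_recr.
Qed.

Lemma l2normD x y : x \in Lfun P 2%:E -> y \in Lfun P 2%:E ->
  l2norm (fun w => x w + y w) <= l2norm x + l2norm y.
Proof.
move=> Lx Ly; rewrite -!nrm_to_L2 //; last exact: L2D.
by rewrite to_L2D //; apply: nrmD; exact: L2ipP.
Qed.

Lemma l2normZ (c : R) x : x \in Lfun P 2%:E -> l2norm (fun w => c * x w) = `|c| * l2norm x.
Proof.
move=> Lx; rewrite -!nrm_to_L2 //; last exact: L2Z.
by rewrite to_L2Z //; apply: nrmZ; exact: L2ipP.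
Qed.

Lemma l2norm_abs x : l2norm (fun w => `|x w|) = l2norm x.
Proof. by congr (Num.sqrt _); apply: eq_Ex => w; rewrite real_normK ?num_real. Qed.

Lemma eq_l2norm x y : x =1 y -> l2norm x = l2norm y.
Proof. by move=> xy; congr (Num.sqrt _); apply: eq_Ex => w; rewrite xy. Qed.

Lemma l2norm_sum (F : nat -> Omega -> R) a b :
  (forall j, (a <= j < b)%N -> F j \in Lfun P 2%:E) ->
  l2norm (fun w => \sum_(a <= j < b) F j w) <= \sum_(a <= j < b) l2norm (F j).
Proof.
move=> LF; rewrite -nrm_to_L2; last exact: L2_sum_nat.
rewrite to_L2_sum // (le_trans (nrm_sum (@L2ipP _ _ _ P) _ _)) //.
by apply: ler_sum_nat => j jm; rewrite nrm_to_L2 ?LF.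
Qed.

Lemma l2norm_sum_ord n (F : 'I_n -> Omega -> R) : (forall i, F i \in Lfun P 2%:E) ->
  l2norm (fun w => \sum_i F i w) <= \sum_i l2norm (F i).
Proof.
move=> LF; rewrite -[X in _ <= X]big_enum /=.
rewrite (eq_l2norm (y := fun w => \sum_(i <- enum 'I_n) F i w)); last first.
  by move=> w; rewrite big_enum.
elim: (enum _) => [|i r IH].
  rewrite big_nil (eq_l2norm (y := fun w => 0 * 0)); last by move=> w; rewrite big_nil mulr0.
  by rewrite (l2normZ 0 (Lfun_cst P 0 2)) normr0 mul0r.
rewrite big_cons (eq_l2norm (y := fun w => F i w + \sum_(k <- r) F k w)); last first.
  by move=> w; rewrite big_cons.
by rewrite (le_trans (l2normD (LF i) (L2_sum _ LF))) // lerD2l.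
Qed.

Lemma condexpB (G : set (set Omega)) xi1 eta1 xi2 eta2 gens :
  gens `<=` measurable -> G = <<s gens>> ->
  is_condexp P G xi1 eta1 -> is_condexp P G xi2 eta2 ->
  is_condexp P G (fun w => xi1 w - xi2 w) (fun w => eta1 w - eta2 w).
Proof.
move=> gm EG [Lx1 Le1 m1 E1] [Lx2 Le2 m2 E2]; split.
- exact: (L1B Lx1 Lx2).
- exact: (L1B Le1 Le2).
- rewrite EG; apply: measurable_wrtI; rewrite EG in m1 m2.
  by apply: measurable_funB; exact: measurable_wrtE.
move=> A GA; have mA : measurable A.
  by rewrite EG in GA; exact: (sub_sigma_measurable gm).
have iA x : L1 P x -> P.-integrable A (EFin \o x) by move=> Lx; exact: integrableS Lx.
transitivity (\int[P]_(w in A) ((eta1 w)%:E - (eta2 w)%:E))%E => //.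
rewrite (integralB mA (iA _ Le1) (iA _ Le2)) /= E1 // E2 //.
by rewrite -(integralB mA (iA _ Lx1) (iA _ Lx2)).
Qed.

Lemma l2norm_condexp gens xi eta : gens `<=` measurable ->
  is_condexp P <<s gens>> xi eta -> xi \in Lfun P 2%:E -> l2norm eta <= l2norm xi.
Proof.
move=> gm ce Lxi; have Leta := condexp_L2_L2 gm ce Lxi.
have := is_proj_le (@L2ipP _ _ _ P) (condexp_is_proj gm ce Lxi).
by rewrite !nrm_to_L2.
Qed.

End l2_norm.

Section driver.
Context (R : realType) (dO : measure_display) (Omega : measurableType dO).
Context (P : probability Omega R) (d : nat).
Variable (g : 'cV[R]_d -> R -> 'rV[R]_d -> R) (L : R).
Hypothesis L_ge0 : 0 <= L.
Hypothesis g_lip : forall x1 x2 y1 y2 z1 z2, `|g x1 y1 z1 - g x2 y2 z2| <=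
  L * (enorm (x1 - x2) + `|y1 - y2| + enorm (z1 - z2)).

Lemma measurable_driver dT (S : measurableType dT) (x : S -> 'cV[R]_d) (y : S -> R)
    (z : S -> 'rV[R]_d) :
  (forall k, measurable_fun [set: S] (fun w => x w k 0)) ->
  measurable_fun [set: S] y -> (forall k, measurable_fun [set: S] (fun w => z w 0 k)) ->
  measurable_fun [set: S] (fun w => g (x w) (y w) (z w)).
Proof.
move=> mx my mz.
pose I := (('I_d + unit) + 'I_d)%type.
pose phi (u : I -> R) := g (\col_k u (inl (inl k))) (u (inl (inr tt))) (\row_k u (inr k)).
pose v (i : I) (w : S) : R := match i with
  | inl (inl k) => x w k 0 | inl (inr _) => y w | inr k => z w 0 k end.
rewrite (_ : (fun w => _) = fun w => phi (fun i => v i w)); last first.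
  apply/funext => w; congr g.
  - by apply/matrixP => i j; rewrite !mxE ord1.
  - by apply/matrixP => i j; rewrite !mxE ord1.
apply: (measurable_lipschitz_comp L_ge0); last first.
  by case=> [[k|[]]|k] /=; [exact: mx|exact: my|exact: mz].
move=> u u'; rewrite (le_trans (g_lip _ _ _ _ _ _)) // ler_wpM2l //.
rewrite !big_sumType /= (big_pred1 tt) // lerD // ?lerD //.
- rewrite (le_trans (enorm_le_sum _)) //; apply: ler_sum => k _.
  by rewrite big_ord1 !mxE.
- rewrite (le_trans (enorm_le_sum _)) // big_ord1; apply: ler_sum => k _.
  by rewrite !mxE.
Qed.

Lemma L2_driver gens (x : Omega -> 'cV[R]_d) (y : Omega -> R) (z : Omega -> 'rV[R]_d) :
  gens `<=` measurable ->
  L2_mx P <<s gens>> x -> L2 P <<s gens>> y -> L2_mx P <<s gens>> z ->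
  L2 P <<s gens>> (fun w => g (x w) (y w) (z w)).
Proof.
move=> gm Lx [my Ly] Lz.
have mg : measurable_wrt <<s gens>> (fun w => g (x w) (y w) (z w)).
  apply: measurable_wrtI; apply: measurable_driver.
  - by move=> k; apply: measurable_wrtE; exact: (Lx k 0).1.
  - exact: measurable_wrtE.
  - by move=> k; apply: measurable_wrtE; exact: (Lz 0 k).1.
split=> //.
pose b w := `|g 0 0 0| + L * (\sum_k `|x w k 0| + `|y w| + \sum_k `|z w 0 k|).
have Lb : b \in Lfun P 2%:E.
  apply: L2D; first exact: (Lfun_cst P `|g 0 0 0| 2).
  apply: L2Z; apply: L2D; first apply: L2D.
  - by apply: L2_sum => k; apply: L2_norm; exact: (Lx k 0).2.
  - exact: L2_norm.
  - by apply: L2_sum => k; apply: L2_norm; exact: (Lz 0 k).2.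
apply: L2_dominated Lb _; first exact: (measurable_wrt_fun gm).
move=> w; rewrite [leRHS]ger0_norm; last first.
  by rewrite addr_ge0 // mulr_ge0 // !addr_ge0 // sumr_ge0.
rewrite -[X in `|X| <= _](addrNK (g 0 0 0)) (le_trans (ler_normD _ _)) // addrC lerD2l.
rewrite (le_trans (g_lip _ _ _ _ _ _)) // ler_wpM2l // !subr0 !lerD //.
- by rewrite (le_trans (enorm_le_sum _)) //; apply: ler_sum => k _; rewrite big_ord1.
- by rewrite (le_trans (enorm_le_sum _)) // big_ord1.
Qed.

End driver.

Section one_step.
Context (R : realType) (dO : measure_display) (Omega : measurableType dO).
Context (P : probability Omega R) (d : nat) (T : R).
Context (W X : R -> Omega -> 'cV[R]_d).
Context (f : R -> 'cV[R]_d -> R -> 'rV[R]_d -> R).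
Context (m : nat) (alphat gammat alpha gamma : nat -> R).
Context (lam : R -> nat -> R).
Local Notation L2P := (Lfun P 2%:E).
Local Notation l2norm := (l2norm P).

Definition row_l2norm (z : Omega -> 'rV[R]_d) : R := \sum_k l2norm (fun w => z w 0 k).

Lemma row_l2norm_ge0 z : 0 <= row_l2norm z.
Proof. by apply: sumr_ge0 => k _; exact: l2norm_ge0. Qed.

(** The outputs [y], [z] are separated from [Y i], [Z i]: with [Y i - eps] as output this is a
    perturbed step. In particular the [Z i] entering the driver need not be the output [z]. *)
Definition step (h : R) (i : nat) (Y : nat -> Omega -> R) (Z : nat -> Omega -> 'rV[R]_d)
    (Yt y : Omega -> R) (z : Omega -> 'rV[R]_d) : Prop :=
  let t (i : nat) : R := i%:R * h in
  let F (i : nat) := natural_filtration W (t i) in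
  let fpi (i : nat) (w : Omega) : R := f (t i) (X (t i) w) (Y i w) (Z i w) in
  [/\ is_condexp P (F i)
        (fun w => \sum_(1 <= j < m.+1) alphat j * Y (i + j)%N w
                + \sum_(1 <= j < m.+1) gammat j * h * fpi (i + j)%N w)
        Yt,
      is_condexp P (F i)
        (fun w => \sum_(1 <= j < m.+1) alpha j * Y (i + j)%N w
                + gamma 0%N * h * f (t i) (X (t i) w) (Yt w) (Z i w)
                + \sum_(1 <= j < m.+1) gamma j * h * fpi (i + j)%N w)
        y &
      is_condexp_mx P (F i)
        (fun w => \sum_(1 <= j < m.+1)
           (lam h j * Y (i + j)%N w) *:
           (W (t (i + j)%N) w - W (t i) w)^T)
        z].

Lemma eq_step h i Y Z Y' Z' Yt y z :
  (forall j, (i < j <= i + m)%N -> Y j = Y' j) ->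
  (forall j, (i <= j <= i + m)%N -> Z j = Z' j) ->
  step h i Y Z Yt y z -> step h i Y' Z' Yt y z.
Proof.
move=> eY eZ; have eYj j : (1 <= j < m.+1)%N -> Y (i + j)%N = Y' (i + j)%N.
  by move=> jm; apply: eY; lia.
have eZj j : (1 <= j < m.+1)%N -> Z (i + j)%N = Z' (i + j)%N.
  by move=> jm; apply: eZ; lia.
have eZi : Z i = Z' i by apply: eZ; lia.
case=> A B C; split.
- congr (is_condexp _ _ _ _) : A; apply/funext => w.
  by congr (_ + _); apply: eq_big_nat => j jm; rewrite eYj // eZj.
- congr (is_condexp _ _ _ _) : B; apply/funext => w; rewrite eZi.
  by congr (_ + _ + _); apply: eq_big_nat => j jm; rewrite eYj // eZj.
- move=> k l; congr (is_condexp _ _ _ _) : (C k l); apply/funext => w.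
  by congr (fun_of_matrix _ _ _); apply: eq_big_nat => j jm; rewrite eYj.
Qed.

Hypothesis T_gt0 : 0 < T.
Hypothesis W_bm : brownian_motion P W.
Hypothesis m_gt0 : (0 < m)%N.
Variable Lf : R.
Hypothesis Lf_ge0 : 0 <= Lf.
Hypothesis f_lip : forall t : R, 0 <= t <= T -> forall x1 x2 y1 y2 z1 z2,
  `|f t x1 y1 z1 - f t x2 y2 z2| <= Lf * (enorm (x1 - x2) + `|y1 - y2| + enorm (z1 - z2)).

Let A : R := \sum_(0 <= j < m.+1) (`|alphat j| + `|gammat j| + `|gamma j|).

Let A_ge0 : 0 <= A.
Proof. by apply: sumr_ge0 => j _; rewrite !addr_ge0. Qed.

Let le_A j : (j <= m)%N -> [/\ `|alphat j| <= A, `|gammat j| <= A & `|gamma j| <= A].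
Proof.
move=> jm; have AE : `|alphat j| + `|gammat j| + `|gamma j| <= A.
  rewrite /A big_mkord (bigD1 (Ordinal (jm : (j < m.+1)%N))) //= lerDl.
  by apply: sumr_ge0 => l _; rewrite !addr_ge0.
have := normr_ge0 (alphat j); have := normr_ge0 (gammat j); have := normr_ge0 (gamma j).
by split; lra.
Qed.

Lemma l2norm_le_sum (x : Omega -> R) (c : R) (q : nat -> Omega -> R) a b :
  0 <= c -> measurable_fun [set: Omega] x ->
  (forall j, (a <= j < b)%N -> q j \in L2P) ->
  (forall w, `|x w| <= c * \sum_(a <= j < b) q j w) ->
  x \in L2P /\ l2norm x <= c * \sum_(a <= j < b) l2norm (q j).
Proof.
move=> c0 mx Lq xq; pose g w := c * \sum_(a <= j < b) q j w.
have Ls : (fun w => \sum_(a <= j < b) q j w) \in L2P by exact: L2_sum_nat.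
have Lg : g \in L2P by exact: L2Z.
have xg w : `|x w| <= `|g w| by rewrite (le_trans (xq w)) // ler_norm.
split; first exact: L2_dominated Lg xg.
rewrite (le_trans (le_l2norm mx Lg xg)) // l2normZ // ger0_norm // ler_wpM2l //.
exact: l2norm_sum.
Qed.

Section difference.
Variables (h : R) (i : nat).
Hypothesis h_gt0 : 0 < h.
Hypothesis ih_le : (i + m)%:R * h <= T.

Lemma grid_time j : (j <= m)%N -> 0 <= (i + j)%:R * h <= T.
Proof.
move=> jm; apply/andP; split; first by rewrite mulr_ge0 ?ler0n ?ltW.
by rewrite (le_trans _ ih_le) // (ler_wpM2r (ltW h_gt0)) // ler_nat leq_add2l.
Qed.

Variables (Y Y' : nat -> Omega -> R) (Z Z' : nat -> Omega -> 'rV[R]_d).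
Variables (Yt Yt' eY eY' : Omega -> R) (eZ eZ' : Omega -> 'rV[R]_d).
Hypothesis stepY : step h i Y Z Yt eY eZ.
Hypothesis stepY' : step h i Y' Z' Yt' eY' eZ'.

Let y j w : R := Y j w - Y' j w.
Let z j w : 'rV[R]_d := Z j w - Z' j w.
Let q j w : R := `|y j w| + \sum_k `|z j w 0 k|.

Hypothesis Ly : forall j, (1 <= j < m.+1)%N -> y (i + j)%N \in L2P.

Let F := natural_filtration W (i%:R * h).

Let FE : F = <<s past_events W (i%:R * h)>>. Proof. by []. Qed.
Let gm := past_events_measurable W_bm (t := i%:R * h).

(** The singular factor 1/h of the coefficients is compensated by sqrt h on the left and the sqrt(j
    h) of the Brownian increment. The adapted [p] is free: it will be E_i y_{i+j} for sufficiency
    and a constant for necessity. *)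
Lemma step_difference_Z (KL : R) (p : nat -> Omega -> R) k : 0 <= KL ->
  (forall j, (j <= m)%N -> `|lam h j| <= KL / h) ->
  (forall j, (1 <= j < m.+1)%N -> p j \in L2P /\ measurable_wrt F (p j)) ->
  (fun w => eZ w 0 k - eZ' w 0 k) \in L2P /\
  Num.sqrt h * l2norm (fun w => eZ w 0 k - eZ' w 0 k) <=
    KL * Num.sqrt (4 * Num.sqrt 2 * m%:R) *
      \sum_(1 <= j < m.+1) l2norm (fun w => y (i + j)%N w - p j w).
Proof.
move=> KL0 lamK Lp.
have [_ _ cZ] := stepY; have [_ _ cZ'] := stepY'.
have cd := condexpB gm FE (cZ 0 k) (cZ' 0 k).
have ih0 : 0 <= i%:R * h by rewrite mulr_ge0 ?ler0n ?ltW.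
have lt_t j : (1 <= j < m.+1)%N -> i%:R * h < (i + j)%:R * h.
  by move=> /andP[j1 _]; rewrite ltr_pM2r // ltr_nat -[X in (X < _)%N]addn0 ltn_add2l.
have cd' : is_condexp P F (fun w => \sum_(1 <= j < m.+1) lam h j * y (i + j)%N w *
    bm_increment W (i%:R * h) ((i + j)%:R * h) k w) (fun w => eZ w 0 k - eZ' w 0 k).
  congr (is_condexp _ _ _ _) : cd; apply/funext => w.
  rewrite !summxE -sumrB; apply: eq_bigr => j _; rewrite !mxE /y /bm_increment.
  by ring.
have [Lz row_l2norm] := condexp_bm_sum (t := fun j => (i + j)%:R * h) W_bm ih0 lt_t Ly Lp cd'.
split=> //.
have sh0 : 0 <= Num.sqrt h by exact: sqrtr_ge0.
rewrite (le_trans (ler_wpM2l sh0 row_l2norm)) // mulr_sumr [leRHS]mulr_sumr.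
apply: ler_sum_nat => j /andP[j1 jm]; rewrite ltnS in jm.
rewrite -/(l2norm _) !mulrA ler_wpM2r ?l2norm_ge0 //.
have -> : (i + j)%:R * h - i%:R * h = j%:R * h by rewrite natrD; ring.
rewrite (mulrA _ j%:R h) (sqrtrM h); last by rewrite !mulr_ge0 ?ler0n ?sqrtr_ge0.
rewrite [leLHS](_ : _ = `|lam h j| * Num.sqrt h ^+ 2 * Num.sqrt (4 * Num.sqrt 2 * j%:R));
  last by ring.
rewrite (sqr_sqrtr (ltW h_gt0)).
apply: ler_pM => //; first by rewrite mulr_ge0 // ltW.
- by rewrite -ler_pdivlMr ?lamK.
- by rewrite ler_wsqrtr // ler_wpM2l ?mulr_ge0 ?sqrtr_ge0 ?ler0n // ler_nat.
Qed.

Hypothesis Lz : forall j k, (j <= m)%N -> (fun w => z (i + j)%N w 0 k) \in L2P.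

Let Lzs j : (j <= m)%N -> (fun w => \sum_k `|z (i + j)%N w 0 k|) \in L2P.
Proof. by move=> jm; apply: L2_sum => k; apply: L2_norm; exact: Lz. Qed.

Let l2_zs j : (j <= m)%N -> l2norm (fun w => \sum_k `|z (i + j)%N w 0 k|) <= row_l2norm (z (i + j)%N).
Proof.
move=> jm; apply: (le_trans (l2norm_sum_ord _)) => [k|].
  by apply: L2_norm; exact: Lz.
by apply: ler_sum => k _; rewrite l2norm_abs.
Qed.

Let Lq j : (1 <= j < m.+1)%N -> q (i + j)%N \in L2P.
Proof. by move=> jm; apply: L2D; [apply: L2_norm; exact: Ly|apply: Lzs; lia]. Qed.

Let l2_q j : (1 <= j < m.+1)%N -> l2norm (q (i + j)%N) <= l2norm (y (i + j)%N) + row_l2norm (z (i + j)%N).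
Proof.
move=> jm; apply: (le_trans (l2normD _ _)); first by apply: L2_norm; exact: Ly.
  by apply: Lzs; lia.
by rewrite l2norm_abs lerD2l l2_zs //; lia.
Qed.

Let fpi (Y : nat -> Omega -> R) (Z : nat -> Omega -> 'rV[R]_d) j w : R := f (j%:R * h) (X (j%:R * h) w) (Y j w) (Z j w).

Let fpi_lip j w : (1 <= j < m.+1)%N ->
  `|fpi Y Z (i + j)%N w - fpi Y' Z' (i + j)%N w| <= Lf * q (i + j)%N w.
Proof.
move=> jm; rewrite (le_trans (f_lip (grid_time _) _ _ _ _ _ _)) //; first lia.
rewrite ler_wpM2l // subrr enorm0 add0r lerD2l (le_trans (enorm_le_sum _)) // big_ord1.
by apply: ler_sum => k _; rewrite !mxE.
Qed.

(** [A * Lf] comes from the corrector; the inner [A * (1 + T * Lf)] bounds the predictor difference,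
    with h <= T, and the 1 the terms entering the driver directly. *)
Definition drift_const : R := A * Lf * (A * (1 + T * Lf) + 1).

Lemma drift_const_ge0 : 0 <= drift_const.
Proof. by rewrite !mulr_ge0 // addr_ge0 // mulr_ge0 // addr_ge0 // mulr_ge0 // ltW. Qed.

Let le_sum_fpi (g : nat -> R) w : (forall j, (j <= m)%N -> `|g j| <= A) ->
  `|\sum_(1 <= j < m.+1) g j * h * fpi Y Z (i + j)%N w -
    \sum_(1 <= j < m.+1) g j * h * fpi Y' Z' (i + j)%N w| <=
  A * h * Lf * \sum_(1 <= j < m.+1) q (i + j)%N w.
Proof.
move=> gA; rewrite -sumrB (le_trans (ler_norm_sum _ _ _)) // [leRHS]mulr_sumr.
apply: ler_sum_nat => j jm; rewrite -mulrBr normrM -mulrA ler_pM //.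
  by rewrite normrM (ger0_norm (ltW h_gt0)) ler_wpM2r ?gA ?(ltW h_gt0) //; lia.
exact: fpi_lip.
Qed.

Let le_sum_y (g : nat -> R) w : (forall j, (j <= m)%N -> `|g j| <= A) ->
  `|\sum_(1 <= j < m.+1) g j * Y (i + j)%N w - \sum_(1 <= j < m.+1) g j * Y' (i + j)%N w|
  <= A * \sum_(1 <= j < m.+1) q (i + j)%N w.
Proof.
move=> gA; rewrite -sumrB (le_trans (ler_norm_sum _ _ _)) // [leRHS]mulr_sumr.
apply: ler_sum_nat => j jm; rewrite -mulrBr normrM ler_pM ?gA //; first lia.
by rewrite lerDl sumr_ge0.
Qed.

(* The remainder [rho] collects the driver differences of predictor and corrector. *)
Lemma step_difference_Y : exists rho, [/\ rho \in L2P,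
  l2norm rho <= drift_const * h * (\sum_(1 <= j < m.+1)
    (l2norm (y (i + j)%N) + row_l2norm (z (i + j)%N)) + row_l2norm (z i)) &
  is_condexp P F (fun w => \sum_(1 <= j < m.+1) alpha j * y (i + j)%N w + rho w)
    (fun w => eY w - eY' w)].
Proof.
set S := \sum_(1 <= j < m.+1) (l2norm (y (i + j)%N) + row_l2norm (z (i + j)%N)).
have S0 : 0 <= S by apply: sumr_ge0 => j _; rewrite addr_ge0 ?l2norm_ge0 ?row_l2norm_ge0.
have h0 := ltW h_gt0.
have hT : h <= T.
  by rewrite (le_trans _ ih_le) // -{1}[h]mul1r (ler_wpM2r h0) // ler1n; lia.
have [ct cy _] := stepY; have [ct' cy' _] := stepY'.
have S_q : \sum_(1 <= j < m.+1) l2norm (q (i + j)%N) <= S by exact: ler_sum_nat.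
have cdt := condexpB gm FE ct ct'.
set xt := (X in is_condexp _ _ X _) in cdt.
(* Only the difference of the two predictor inputs is dominated by L2 quantities; its measurability
   is read off from the integrability contained in [is_condexp]. *)
have mxt : measurable_fun [set: Omega] xt by apply: (@L1_measurable _ _ _ P); case: cdt.
have c1 : 0 <= A * (1 + h * Lf) by rewrite mulr_ge0 // addr_ge0 // mulr_ge0.
have [Lxt l2xt] : xt \in L2P /\ l2norm xt <= A * (1 + h * Lf) * \sum_(1 <= j < m.+1) l2norm (q (i + j)%N).
  apply: l2norm_le_sum => // w; rewrite /xt opprD addrACA (le_trans (ler_normD _ _)) //.
  rewrite mulrDr mulr1 mulrDl lerD //.
    by apply: le_sum_y => j jm; have [] := le_A jm.
  by rewrite mulrA; apply: le_sum_fpi => j jm; have [] := le_A jm.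
have Lyt := condexp_L2_L2 gm cdt Lxt.
have l2yt : l2norm (fun w => Yt w - Yt' w) <= A * (1 + h * Lf) * S.
  rewrite (le_trans (l2norm_condexp gm cdt Lxt)) // (le_trans l2xt) //.
  by rewrite ler_wpM2l.
have cd := condexpB gm FE cy cy'.
set x := (X in is_condexp _ _ X _) in cd.
have mx : measurable_fun [set: Omega] x by apply: (@L1_measurable _ _ _ P); case: cd.
pose ay w : R := \sum_(1 <= j < m.+1) alpha j * y (i + j)%N w.
have Lay : ay \in L2P by apply: L2_sum_nat => j jm; apply: L2Z; exact: Ly.
pose rho w := x w - ay w.
have mrho : measurable_fun [set: Omega] rho by apply: measurable_funB => //; exact: L2_measurable Lay.
pose gz w : R := `|Yt w - Yt' w| + \sum_k `|z i w 0 k|.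
pose g w := A * h * Lf * gz w + A * h * Lf * \sum_(1 <= j < m.+1) q (i + j)%N w.
have Lzi : (fun w => \sum_k `|z i w 0 k|) \in L2P by have := Lzs (leq0n m); rewrite addn0.
have Lgz : gz \in L2P by apply: L2D => //; exact: L2_norm.
have l2gz : l2norm gz <= A * (1 + h * Lf) * S + row_l2norm (z i).
  have := l2_zs (leq0n m); rewrite addn0 => nzi.
  by rewrite (le_trans (l2normD (L2_norm Lyt) Lzi)) // lerD // l2norm_abs.
have Lsq : (fun w => \sum_(1 <= j < m.+1) q (i + j)%N w) \in L2P by exact: L2_sum_nat.
have Lg : g \in L2P by apply: L2D; exact: L2Z.
have AhL : 0 <= A * h * Lf by rewrite !mulr_ge0.
have rhog w : `|rho w| <= `|g w|.
  apply: le_trans (ler_norm _).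
  have -> : rho w = (gamma 0%N * h * (f (i%:R * h) (X (i%:R * h) w) (Yt w) (Z i w) -
      f (i%:R * h) (X (i%:R * h) w) (Yt' w) (Z' i w))) +
    (\sum_(1 <= j < m.+1) gamma j * h * fpi Y Z (i + j)%N w -
     \sum_(1 <= j < m.+1) gamma j * h * fpi Y' Z' (i + j)%N w).
    have ayE : ay w = \sum_(1 <= j < m.+1) alpha j * Y (i + j)%N w -
        \sum_(1 <= j < m.+1) alpha j * Y' (i + j)%N w.
      by rewrite -sumrB; apply: eq_bigr => j _; rewrite -mulrBr.
    by rewrite /rho ayE /x /fpi; ring.
  rewrite (le_trans (ler_normD _ _)) // lerD //; last first.
    by apply: le_sum_fpi => j jm; have [] := le_A jm.
  rewrite normrM -mulrA ler_pM //.
    by rewrite normrM (ger0_norm h0) ler_wpM2r //; have [] := le_A (leq0n m).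
  have it : 0 <= i%:R * h <= T by have := grid_time (leq0n m); rewrite addn0.
  rewrite (le_trans (f_lip it _ _ _ _ _ _)) // ler_wpM2l // subrr enorm0 add0r lerD2l.
  rewrite (le_trans (enorm_le_sum _)) // big_ord1.
  by apply: ler_sum => k _; rewrite !mxE.
exists rho; split; first exact: L2_dominated mrho Lg rhog.
- rewrite (le_trans (le_l2norm mrho Lg rhog)) // (le_trans (l2normD (L2Z _ Lgz) (L2Z _ Lsq))) //.
  rewrite !l2normZ // (ger0_norm AhL) -mulrDr.
  have l2s : l2norm (fun w => \sum_(1 <= j < m.+1) q (i + j)%N w) <= S.
    by rewrite (le_trans (l2norm_sum _)).
  have Z0 : 0 <= row_l2norm (z i) by exact: row_l2norm_ge0.
  rewrite (le_trans (ler_wpM2l AhL (lerD l2gz l2s))) //.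
  rewrite /drift_const [leRHS](_ : _ = A * h * Lf * ((A * (1 + T * Lf) + 1) * (S + row_l2norm (z i))));
    last by ring.
  rewrite ler_wpM2l // -subr_ge0.
  have -> : (A * (1 + T * Lf) + 1) * (S + row_l2norm (z i)) -
      (A * (1 + h * Lf) * S + row_l2norm (z i) + S) =
    A * Lf * (T - h) * S + A * (1 + T * Lf) * row_l2norm (z i) by ring.
  rewrite addr_ge0 // !mulr_ge0 ?subr_ge0 ?addr_ge0 ?mulr_ge0 //; exact: ltW.
- congr (is_condexp _ _ _ _) : cd; apply/funext => w.
  by rewrite /rho addrC subrK.
Qed.

End difference.
End one_step.

Section step_existence.
Context (R : realType) (dO : measure_display) (Omega : measurableType dO).
Context (P : probability Omega R) (d : nat) (T : R).
Context (W X : R -> Omega -> 'cV[R]_d).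
Context (f : R -> 'cV[R]_d -> R -> 'rV[R]_d -> R).
Context (m : nat) (alphat gammat alpha gamma : nat -> R).
Context (lam : R -> nat -> R).
Local Notation L2P := (Lfun P 2%:E).
Local Notation step := (step P W X f m alphat gammat alpha gamma lam).

Hypothesis W_bm : brownian_motion P W.
Hypothesis X_L2 : forall t, 0 <= t <= T -> L2_mx P (natural_filtration W t) (X t).
Variable Lf : R.
Hypothesis Lf_ge0 : 0 <= Lf.
Hypothesis f_lip : forall t : R, 0 <= t <= T -> forall x1 x2 y1 y2 z1 z2,
  `|f t x1 y1 z1 - f t x2 y2 z2| <= Lf * (enorm (x1 - x2) + `|y1 - y2| + enorm (z1 - z2)).

Variable h : R.
Hypothesis h_gt0 : 0 < h.

Definition square_adapted i (Y : nat -> Omega -> R) (Z : nat -> Omega -> 'rV[R]_d) :=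
  L2 P (natural_filtration W (i%:R * h)) (Y i) /\
  L2_mx P (natural_filtration W (i%:R * h)) (Z i).

Let gm (t : R) := past_events_measurable W_bm (t := t).

(** [z] depends on later values of Y only and is produced first; then [Z' i] is free. The exact
    scheme takes [Z' i] = [z], the shifted scheme prescribes another value. *)
Lemma step_exists i Y Z : (i + m)%:R * h <= T ->
  (forall j, (i < j <= i + m)%N -> square_adapted j Y Z) ->
  exists z, L2_mx P (natural_filtration W (i%:R * h)) z /\
  forall Z', (forall j, (i < j <= i + m)%N -> Z' j = Z j) ->
    L2_mx P (natural_filtration W (i%:R * h)) (Z' i) ->
  exists Yt y, L2 P (natural_filtration W (i%:R * h)) y /\ step h i Y Z' Yt y z.
Proof.
move=> ihT YZ; have ih0 : 0 <= i%:R * h by rewrite mulr_ge0 ?ler0n // ltW.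
have ij j : (1 <= j < m.+1)%N -> (i < i + j <= i + m)%N by lia.
have LY j : (1 <= j < m.+1)%N -> Y (i + j)%N \in L2P by move=> /ij /YZ [[]].
have lt_t j : (1 <= j < m.+1)%N -> i%:R * h < (i + j)%:R * h.
  by move=> /andP[j1 _]; rewrite ltr_pM2r // ltr_nat; lia.
have : forall k, exists zk, is_condexp P (natural_filtration W (i%:R * h))
    (fun w => \sum_(1 <= j < m.+1) lam h j * Y (i + j)%N w *
       bm_increment W (i%:R * h) ((i + j)%:R * h) k w) zk.
  move=> k; apply: (condexp_exists (gm (t := _))); apply: L1_sum => j jm.
  by apply: L2_mul; [apply: L2Z; exact: LY|apply: (bm_increment_L2 W_bm k ih0); exact: lt_t].
move=> /choice[zk czk].
have Lzk k : L2 P (natural_filtration W (i%:R * h)) (zk k).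
  split; first by case: (czk k).
  have := czk k => /(condexp_bm_sum (p := fun _ _ => 0) W_bm ih0 lt_t LY)[] // j jm.
  split; first exact: (Lfun_cst P 0 2).
  by apply: measurable_wrtI; exact: measurable_cst.
exists (fun w => \row_k zk k w); split.
  move=> i0 k; rewrite (_ : (fun w => _) = zk k) //.
  by apply/funext => w; rewrite mxE.
move=> Z' Z'E LZ'.
have Lf' j : (1 <= j < m.+1)%N -> (fun w => f ((i + j)%:R * h) (X ((i + j)%:R * h) w)
    (Y (i + j)%N w) (Z' (i + j)%N w)) \in L2P.
  move=> jm; have [LYj LZj] := YZ _ (ij _ jm).
  have it : 0 <= (i + j)%:R * h <= T by apply: (grid_time h_gt0 ihT); lia.
  have := L2_driver Lf_ge0 (f_lip it) (gm (t := _)) (X_L2 it) LYj LZj.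
  by rewrite Z'E ?ij // => -[].
have Lst : (fun w => \sum_(1 <= j < m.+1) alphat j * Y (i + j)%N w
    + \sum_(1 <= j < m.+1) gammat j * h * f ((i + j)%:R * h) (X ((i + j)%:R * h) w)
    (Y (i + j)%N w) (Z' (i + j)%N w)) \in L2P.
  by apply: L2D; apply: L2_sum_nat => j jm; apply: L2Z; [exact: LY|exact: Lf'].
have [Yt cYt] := condexp_exists (gm (t := i%:R * h)) (L2_L1 Lst).
have LYt : L2 P (natural_filtration W (i%:R * h)) Yt.
  by split; [case: cYt|exact: (condexp_L2_L2 (gm (t := _)) cYt Lst)].
have it : 0 <= i%:R * h <= T by have := grid_time h_gt0 ihT (leq0n m); rewrite addn0.
have [_ Lfi] := L2_driver Lf_ge0 (f_lip it) (gm (t := _)) (X_L2 it) LYt LZ'.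
have Ls : (fun w => \sum_(1 <= j < m.+1) alpha j * Y (i + j)%N w
    + gamma 0%N * h * f (i%:R * h) (X (i%:R * h) w) (Yt w) (Z' i w)
    + \sum_(1 <= j < m.+1) gamma j * h * f ((i + j)%:R * h) (X ((i + j)%:R * h) w)
    (Y (i + j)%N w) (Z' (i + j)%N w)) \in L2P.
  apply: L2D; first apply: L2D.
  - by apply: L2_sum_nat => j jm; apply: L2Z; exact: LY.
  - exact: L2Z.
  - by apply: L2_sum_nat => j jm; apply: L2Z; exact: Lf'.
have [y cy] := condexp_exists (gm (t := i%:R * h)) (L2_L1 Ls).
exists Yt, y; split.
  by split; [case: cy|exact: (condexp_L2_L2 (gm (t := _)) cy Ls)].
split=> // i0 k; rewrite (_ : (fun w => (\row__ _) _ _) = zk k); last first.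
  by apply/funext => w; rewrite mxE.
congr (is_condexp _ _ _ _) : (czk k); apply/funext => w.
by rewrite summxE; apply: eq_bigr => j _; rewrite !mxE ord1.
Qed.

(** Descending construction below c from prescribed values on c, ..., N, which must contain at least
    m grid points. *)
Lemma scheme_extend N c Y0 Z0 : (c + m <= N.+1)%N -> N%:R * h <= T ->
  (forall i, (c <= i <= N)%N -> square_adapted i Y0 Z0) ->
  exists Y Z, [/\ (forall i, (c <= i)%N -> Y i = Y0 i /\ Z i = Z0 i),
    (forall i, (i <= N)%N -> square_adapted i Y Z) &
    forall i, (i < c)%N -> exists Yt, step h i Y Z Yt (Y i) (Z i)].
Proof.
move=> cN NT; elim: c cN Y0 Z0 => [|c IH] cN Y0 Z0 YZ0; first by exists Y0, Z0.
have [|j jc|z [Lz Sz]] := step_exists (i := c) (Y := Y0) (Z := Z0).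
- by apply: le_trans NT; rewrite (ler_wpM2r (ltW h_gt0)) // ler_nat; lia.
- by apply: YZ0; lia.
pose Z1 j := if j == c then z else Z0 j.
have [|/=|Yt [y [Ly Sy]]] := Sz Z1.
- by move=> j jc; rewrite /Z1 gtn_eqF //; lia.
- by rewrite /Z1 eqxx.
pose Y1 j := if j == c then y else Y0 j.
have [|i ic|Y [Z [YZ1 LYZ SYZ]]] := IH _ Y1 Z1; first lia.
  rewrite /square_adapted /Y1 /Z1; case: eqP => [->//|ic'].
  by apply: YZ0; lia.
exists Y, Z; split=> [i ci|//|i].
  by have [-> ->] := YZ1 i (ltnW ci); rewrite /Y1 /Z1 gtn_eqF.
rewrite ltnS leq_eqVlt => /orP[/eqP->|]; last exact: SYZ.
exists Yt; have [-> ->] := YZ1 c (leqnn c).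
have -> : Y1 c = y by rewrite /Y1 eqxx.
have -> : Z1 c = z by rewrite /Z1 eqxx.
apply: eq_step Sy => j jc.
  by have [|-> _] := YZ1 j; [lia|rewrite /Y1 gtn_eqF //; lia].
by have [|_ ->] := YZ1 j; first lia.
Qed.

End step_existence.

(** * The stability inequality in real numbers *)

Section real_stability.
Context (R : realType) (dO : measure_display) (Omega : measurableType dO).
Context (P : probability Omega R) (d : nat).
Implicit Types (x : Omega -> R) (z : Omega -> 'rV[R]_d).
Local Notation L2P := (Lfun P 2%:E).
Local Notation l2norm := (l2norm P).

Definition row_sqr_l2norm z : R := \sum_k l2norm (fun w => z w 0 k) ^+ 2.

Lemma row_sqr_l2norm_ge0 z : 0 <= row_sqr_l2norm z.
Proof. by apply: sumr_ge0 => k _; exact: sqr_ge0. Qed.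

Lemma expectation_Ex x : L1 P x -> ('E_P[x] = (Ex P x)%:E)%E.
Proof. by move=> Lx; rewrite unlock EFin_Ex. Qed.

Lemma L1_sqr x : x \in L2P -> L1 P (fun w => x w ^+ 2).
Proof. by move=> /Lfun2P[]. Qed.

Lemma L1_sqr_enorm z : (forall k, (fun w => z w 0 k) \in L2P) ->
  L1 P (fun w => enorm (z w) ^+ 2) /\ Ex P (fun w => enorm (z w) ^+ 2) = row_sqr_l2norm z.
Proof.
move=> Lz; have E : (fun w => enorm (z w) ^+ 2) = (fun w => \sum_k z w 0 k ^+ 2).
  by apply/funext => w; rewrite sqr_enorm big_ord1.
rewrite E /row_sqr_l2norm -(big_enum (R := R)) /=.
rewrite (_ : (fun w => _) = fun w => \sum_(k <- enum 'I_d) z w 0 k ^+ 2); last first.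
  by apply/funext => w; rewrite big_enum.
elim: (enum _) => [|k r [L1r Er]].
  rewrite big_nil (_ : (fun w => _) = fun=> 0) ?Ex_cst; last by apply/funext => w; rewrite big_nil.
  by split=> //; exact: L1_cst.
rewrite (_ : (fun w => _) = fun w => z w 0 k ^+ 2 + \sum_(k <- r) z w 0 k ^+ 2); last first.
  by apply/funext => w; rewrite big_cons.
split; first by apply: L1D => //; apply: L1_sqr; exact: Lz.
by rewrite big_cons ExD // ?Er ?sqr_l2norm //; apply: L1_sqr; exact: Lz.
Qed.

Lemma ae_eq_l2norm x y : measurable_fun [set: Omega] x -> measurable_fun [set: Omega] y ->
  {ae P, forall w, x w = y w} -> l2norm (fun w => y w - x w) = 0.
Proof.
move=> mx my xy; rewrite /l2norm (_ : Ex _ _ = 0) ?sqrtr0 //.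
rewrite -(Ex_cst P 0) /Ex /Rintegral; congr fine; apply: ae_eq_integral => //.
- by apply/measurable_EFinP; apply: measurable_funX; exact: measurable_funB.
- by apply: filterS xy => w -> _; rewrite subrr expr0n.
Qed.

Lemma stability_inequalityE (n N : nat) (h C : R) (y eY : nat -> Omega -> R)
    (z eZ : nat -> Omega -> 'rV[R]_d) : (n <= N)%N ->
  (forall i, (i <= N)%N -> y i \in L2P) ->
  (forall i k, (i <= N)%N -> (fun w => z i w 0 k) \in L2P) ->
  (forall i, (i <= n)%N -> eY i \in L2P) ->
  (forall i k, (i <= n)%N -> (fun w => eZ i w 0 k) \in L2P) ->
  (\big[maxe/0]_(0 <= i < n.+1) 'E_P[fun w => (`|y i w| ^+ 2)%R]
   + \sum_(0 <= i < n.+1) h%:E * 'E_P[fun w => (enorm (z i w) ^+ 2)%R]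
   <= C%:E * (\big[maxe/0]_(n.+1 <= k < N.+1) 'E_P[fun w => (`|y k w| ^+ 2)%R]
    + \sum_(0 <= i < n.+1)
      'E_P[fun w => (h * enorm (eZ i w) ^+ 2 + h^-1 * `|eY i w| ^+ 2)%R]))%E =
  (\big[Num.max/0]_(0 <= i < n.+1) l2norm (y i) ^+ 2 + \sum_(0 <= i < n.+1) h * row_sqr_l2norm (z i) <=
   C * (\big[Num.max/0]_(n.+1 <= k < N.+1) l2norm (y k) ^+ 2
    + \sum_(0 <= i < n.+1) (h * row_sqr_l2norm (eZ i) + h^-1 * l2norm (eY i) ^+ 2))).
Proof.
move=> nN Ly Lz LeY LeZ.
have Ey x : x \in L2P -> ('E_P[fun w => (`|x w| ^+ 2)%R] = (l2norm x ^+ 2)%:E)%E.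
  move=> Lx; rewrite expectation_Ex; last by apply: L1_sqr; exact: L2_norm.
  by rewrite sqr_l2norm; congr EFin; apply: eq_Ex => w; rewrite real_normK ?num_real.
have maxE a b : (b <= N.+1)%N ->
    (\big[maxe/0]_(a <= i < b) 'E_P[fun w => (`|y i w| ^+ 2)%R])%E =
    (\big[Num.max/0]_(a <= i < b) l2norm (y i) ^+ 2)%:E.
  move=> bN; rewrite -EFin_bigmax; apply: eq_big_nat => i /andP[_ ib].
  by rewrite Ey // Ly // -ltnS (leq_trans ib).
rewrite !maxE ?ltnS //.
have -> : (\sum_(0 <= i < n.+1) h%:E * 'E_P[fun w => (enorm (z i w) ^+ 2)%R])%E =
    (\sum_(0 <= i < n.+1) h * row_sqr_l2norm (z i))%:E.
  rewrite -sumEFin; apply: eq_big_nat => i /andP[_ ib].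
  have [|L E] := @L1_sqr_enorm (z i); first by move=> k; apply: Lz; lia.
  by rewrite expectation_Ex // E EFinM.
have -> : (\sum_(0 <= i < n.+1)
    'E_P[fun w => (h * enorm (eZ i w) ^+ 2 + h^-1 * `|eY i w| ^+ 2)%R])%E =
    (\sum_(0 <= i < n.+1) (h * row_sqr_l2norm (eZ i) + h^-1 * l2norm (eY i) ^+ 2))%:E.
  rewrite -sumEFin; apply: eq_big_nat => i /andP[_ ib].
  have [|L E] := @L1_sqr_enorm (eZ i); first by move=> k; apply: LeZ; lia.
  have Le : L1 P (fun w => `|eY i w| ^+ 2) by apply: L1_sqr; apply: L2_norm; apply: LeY; lia.
  rewrite expectation_Ex ?ExD ?ExZ ?E //; last first; try exact: L1Z.
    by apply: L1D; exact: L1Z.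
  have /expectation_Ex := Le; rewrite Ey; last by apply: LeY; lia.
  by case=> <-.
by rewrite -!EFinD -EFinM lee_fin.
Qed.

End real_stability.

(** * The two implications *)

Section sufficiency.
Context (R : realType) (dO : measure_display) (Omega : measurableType dO).
Context (P : probability Omega R) (d : nat) (T : R).
Context (W X : R -> Omega -> 'cV[R]_d).
Context (f : R -> 'cV[R]_d -> R -> 'rV[R]_d -> R).
Context (m : nat) (alphat gammat alpha gamma : nat -> R).
Context (lam : R -> nat -> R).
Local Notation L2P := (Lfun P 2%:E).
Local Notation l2norm := (l2norm P).
Local Notation row_l2norm := (row_l2norm P).
Local Notation row_sqr_l2norm := (row_sqr_l2norm P).
Local Notation ip := (@L2ip _ _ _ P).

Lemma sqr_sum_ord_le (F : 'I_d -> R) : (\sum_i F i) ^+ 2 <= d%:R * \sum_i F i ^+ 2.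
Proof.
pose G (k : nat) : R := oapp F 0 (insub k).
have GE (i : 'I_d) : G i = F i by rewrite /G valK.
have := sqr_sum_le G 0 d; rewrite subn0 !big_mkord.
by under eq_bigr do rewrite GE; under [X in _ <= _ * X]eq_bigr do rewrite GE.
Qed.

Lemma sqr_row_l2norm_le (z : Omega -> 'rV[R]_d) : row_l2norm z ^+ 2 <= d%:R * row_sqr_l2norm z.
Proof. exact: sqr_sum_ord_le. Qed.

Hypothesis T_gt0 : 0 < T.
Hypothesis W_bm : brownian_motion P W.
Hypothesis m_gt0 : (0 < m)%N.
Variable Lf : R.
Hypothesis Lf_ge0 : 0 <= Lf.
Hypothesis f_lip : forall t : R, 0 <= t <= T -> forall x1 x2 y1 y2 z1 z2,
  `|f t x1 y1 z1 - f t x2 y2 z2| <= Lf * (enorm (x1 - x2) + `|y1 - y2| + enorm (z1 - z2)).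
Hypothesis lam_cond : forall N : nat, (0 < N)%N ->
  lambda_cond m (T / N%:R) (lam (T / N%:R)).

Lemma nrm_L2 (u : L2space P) : nrm ip u = l2norm u.
Proof. by []. Qed.

Lemma to_L2_fun (u : L2space P) x : x \in L2P ->
  l2norm (fun w => x w - u w) = nrm ip (to_L2 P x - u).
Proof.
move=> Lx; rewrite nrm_L2; apply: eq_l2norm => w.
by transitivity (to_L2 P x w - u w); first by rewrite to_L2E.
Qed.

(** [hilbert_stability] is applied to the L2 space with the adapted subspaces of the grid times; the
    one-step estimates supply its hypotheses on r and z. *)
Lemma bounded_recurrence_stable :
  (forall a, recurrence m alpha a -> exists M : R, forall n, `|a n| <= M) ->
  L2_stable P T W X f m alphat gammat alpha gamma lam.
Proof.
move=> rec_bdd; have [KL KL0 lamK] := lambda_bound R m.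
have [D D0 DE] : exists2 D : R, 0 <= D & D = drift_const T m alphat gammat gamma Lf.
  by eexists; last reflexivity; exact: drift_const_ge0.
have [KZ KZ0 KZE] : exists2 KZ : R, 0 <= KZ & KZ = KL * Num.sqrt (4 * Num.sqrt 2 * m%:R).
  by eexists; last reflexivity; rewrite mulr_ge0 ?sqrtr_ge0.
(* The first two summands serve the drift estimate; the constant 2 together with the last summand
   serves the estimate of z. *)
pose K : R := 8 * D ^+ 2 * m%:R * (1 + d%:R) + 2 + 2 * d%:R * KZ ^+ 2 * m%:R.
have K0 : 0 <= K by rewrite !addr_ge0 // !mulr_ge0 ?sqr_ge0 ?ler0n.
have [C C0 stab] := hilbert_stability m_gt0 rec_bdd T_gt0 K0.
(* The factor m converts the sum over the m starting errors into their maximum; the 2 adds the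
   separate bounds for Y and Z. *)
exists (2 * C * m%:R) => N Y Yb Z Zb epsY epsZ h F mN Leps.
move=> [LYZ SYZ] [LYZb SYZb] Zstart.
set n := (N - m)%N in Leps SYZ SYZb Zstart *.
have {}SYZ i : (i <= n)%N -> exists Yt, step P W X f m alphat gammat alpha gamma lam h i Y Z Yt
    (fun w => Y i w - 0) (fun w => Z i w - 0) by exact: SYZ.
have {}SYZb i : (i <= n)%N -> exists Yt, step P W X f m alphat gammat alpha gamma lam h i Yb Zb Yt
    (fun w => Yb i w - epsY i w) (fun w => Zb i w - epsZ i w) by exact: SYZb.
have nmN : (n + m = N)%N by rewrite subnK.
have N0 : (0 < N)%N by exact: leq_trans mN.
have h0 : 0 < h by rewrite divr_gt0 // ltr0n.
have NhT : N%:R * h <= T by rewrite /h mulrC divfK // pnatr_eq0 -lt0n.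
pose y i w : R := Y i w - Yb i w.
pose z i w : 'rV[R]_d := Z i w - Zb i w.
have Ly i : (i <= N)%N -> y i \in L2P.
  by move=> iN; apply: L2B; [case: (LYZ _ iN) => -[]|case: (LYZb _ iN) => -[]].
have Lz i k : (i <= N)%N -> (fun w => z i w 0 k) \in L2P.
  move=> iN; rewrite (_ : (fun w => _) = fun w => Z i w 0 k - Zb i w 0 k).
    by apply: L2B; [case: (LYZ _ iN) => _ /(_ 0 k)[]|case: (LYZb _ iN) => _ /(_ 0 k)[]].
  by apply/funext => w; rewrite !mxE.
have LeY i : (i <= n)%N -> epsY i \in L2P by move=> /Leps[[]].
have LeZ i k : (i <= n)%N -> (fun w => epsZ i w 0 k) \in L2P.
  by move=> /Leps[_ /(_ 0 k)[]].
have nN : (n <= N)%N by exact: leq_subr.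
rewrite (stability_inequalityE h _ nN Ly Lz LeY LeZ).
pose gm i := past_events_measurable W_bm (t := i%:R * h).
have ijT i : (i <= n)%N -> (i + m)%:R * h <= T.
  by move=> ni; apply: le_trans NhT; rewrite (ler_wpM2r (ltW h0)) // ler_nat -nmN leq_add2r.
have LyS i : (i <= n)%N -> forall j, (1 <= j < m.+1)%N -> y (i + j)%N \in L2P.
  by move=> ni j /andP[_ jm]; apply: Ly; rewrite -nmN leq_add.
have LzS i : (i <= n)%N -> forall j k, (j <= m)%N ->
    (fun w => (Z (i + j)%N w - Zb (i + j)%N w) 0 k) \in L2P.
  by move=> ni j k jm; apply: Lz; rewrite -nmN leq_add.
have : forall i, exists rho, (i <= n)%N -> [/\ rho \in L2P,
    l2norm rho <= D * h * (\sum_(1 <= j < m.+1) (l2norm (y (i + j)%N) + row_l2norm (z (i + j)%N)) + row_l2norm (z i)) &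
    is_condexp P (F i) (fun w => \sum_(1 <= j < m.+1) alpha j * y (i + j)%N w + rho w)
      (fun w => y i w + epsY i w)].
  move=> i; have [ni|] := leqP i n; last by exists (fun=> 0).
  have [Yt S] := SYZ _ ni; have [Ytb Sb] := SYZb _ ni.
  have [rho [Lr l2r cr]] := step_difference_Y T_gt0 W_bm m_gt0 Lf_ge0 f_lip h0
    (ijT _ ni) S Sb (LyS _ ni) (LzS _ ni).
  exists rho => _; split=> //; first by rewrite DE.
  by congr (is_condexp _ _ _ _) : cr; apply/funext => w; rewrite /y subr0 opprB addrCA addrC.
move=> /choice[rho rhoP].
pose v i := to_L2 P (y i).
have nv i : (i <= N)%N -> nrm ip (v i) = l2norm (y i) by move=> iN; rewrite nrm_to_L2 ?Ly.
(* The perturbation sits in the second scheme, so y_i + epsY_i, not y_i, is the conditional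
   expectation; hence the minus sign. *)
pose r i := to_L2 P (rho i) - to_L2 P (epsY i).
pose zq i := if (i <= n)%N then row_sqr_l2norm (z i) else 0.
pose eq i := l2norm (epsY i) ^+ 2; pose ezq i := row_sqr_l2norm (epsZ i).
have zq0 i : 0 <= zq i by rewrite /zq; case: ifP => // _; exact: row_sqr_l2norm_ge0.
have nzq i : (i <= N)%N -> row_l2norm (z i) ^+ 2 <= d%:R * zq i.
  move=> iN; rewrite /zq; case: leqP => [_|ni]; first exact: sqr_row_l2norm_le.
  rewrite mulr0 /row_l2norm big1 ?expr0n // => k _; rewrite -[RHS](@ae_eq_l2norm _ _ _ P
    (fun w => Zb i w 0 k) (fun w => Z i w 0 k)).
  - by apply: eq_l2norm => w; rewrite !mxE.
  - by have [_ /(_ 0 k)[_ /L2_measurable]] := LYZb _ iN.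
  - by have [_ /(_ 0 k)[_ /L2_measurable]] := LYZ _ iN.
  - by apply: filterS (Zstart i _) => [w ->|]; rewrite ?ni.
have [|||||||||||||Cy Cz] := stab _ ip (fun i => adapted (past_events W (i%:R * h)))
  (fun i u => adapted_proj (gm i) u) n h v r zq eq ezq.
- exact: L2ipP.
- by move=> i; apply: adapted_subspace; exact: gm.
- by move=> i j u ij; apply: measurable_wrt_mono; rewrite (ler_wpM2r (ltW h0)) // ler_nat.
- exact: h0.
- by rewrite nmN.
- move=> i; rewrite nmN => iN; rewrite /adapted to_L2E ?Ly //.
  have [[mY _] _] := LYZ _ iN; have [[mYb _] _] := LYZb _ iN.
  by apply: measurable_wrtI; apply: measurable_funB; exact: measurable_wrtE.
- move=> i ni w Gw; have [Lr _ cr] := rhoP _ ni.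
  have Ls : (fun w => \sum_(1 <= j < m.+1) alpha j * y (i + j)%N w) \in L2P.
    by apply: L2_sum_nat => j jm; apply: L2Z; exact: LyS.
  have [_ /(_ w Gw) <-] := condexp_is_proj (gm i) cr (L2D Ls Lr).
  have iN := leq_trans ni nN.
  congr (ip _ w); rewrite (to_L2D Ls Lr) (to_L2D (Ly _ iN) (LeY _ ni)).
  rewrite to_L2_sum => [|j jm]; last by apply: L2Z; exact: LyS.
  rewrite [in RHS](eq_big_nat _ _ (F2 := fun j => alpha j *: v (i + j)%N)) => [|j jm].
    by rewrite /r opprD !addrA [in RHS]addrAC.
  by rewrite to_L2Z //; exact: LyS.
- exact: zq0.
- by move=> i; exact: sqr_ge0.
- by move=> i; exact: row_sqr_l2norm_ge0.
- by move=> i ni; rewrite /zq leqNgt ni.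
- move=> i ni; have [Lr l2r _] := rhoP _ ni.
  have iN := leq_trans ni nN.
  have ijN j : (1 <= j < m.+1)%N -> (i + j <= N)%N.
    by move=> /andP[_ jm]; rewrite -nmN leq_add.
  set S := \sum_(1 <= j < m.+1) (l2norm _ + row_l2norm _) in l2r.
  have S0 : 0 <= S by apply: sumr_ge0 => j _; rewrite addr_ge0 ?l2norm_ge0 ?row_l2norm_ge0.
  have nz0 := row_l2norm_ge0 P (z i).
  have nr : nrm ip (r i) <= D * h * (S + row_l2norm (z i)) + l2norm (epsY i).
    rewrite /r (le_trans (nrmD (@L2ipP _ _ _ P) _ _)) // (nrmN (@L2ipP _ _ _ P)).
    by rewrite (nrm_to_L2 Lr) (nrm_to_L2 (LeY _ ni)) lerD2r.
  have nr2 : nrm ip (r i) ^+ 2 <= (D * h * (S + row_l2norm (z i)) + l2norm (epsY i)) ^+ 2.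
    by rewrite lerXn2r ?nnegrE ?(le_trans _ nr) ?nrm_ge0.
  rewrite (le_trans nr2) //; apply: (@drift_sqr_le _ D h m%:R d%:R).
  + by rewrite ler1n.
  + exact: ler0n.
  + exact: zq0.
  + by apply: sumr_ge0 => j _; rewrite addr_ge0 ?sqr_ge0 ?zq0.
  + rewrite (eq_big_nat _ _ (F2 := fun j => l2norm (y (i + j)%N) ^+ 2 + zq (i + j)%N)).
      apply: sqr_sumD_le; [exact: ler0n| |] => j jm.
        by apply: nzq; exact: ijN.
      exact: zq0.
    by move=> j jm; rewrite nv ?ijN.
  + exact: nzq.
  + by rewrite /K lerDl !mulr_ge0 ?sqr_ge0 ?ler0n.
- move=> i ni; rewrite {1}/zq ni /row_sqr_l2norm.
  have iN := leq_trans ni nN.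
  have [Yt S] := SYZ _ ni; have [Ytb Sb] := SYZb _ ni.
  set p := cproj _ i.
  have pP u : adapted (past_events W (i%:R * h)) (p u).
    exact: (cprojP (fun i u => adapted_proj (gm i) u) i u).1.
  pose g := \sum_(1 <= j < m.+1) nrm ip (v (i + j)%N - p (v (i + j)%N)).
  have g0 : 0 <= g by apply: sumr_ge0 => j _; exact: nrm_ge0.
  have zk k : h * l2norm (fun w => z i w 0 k) ^+ 2 <=
      2 * KZ ^+ 2 * g ^+ 2 + 2 * (h * l2norm (fun w => epsZ i w 0 k) ^+ 2).
    have [||Lzt nzt] := step_difference_Z (p := fun j => (p (v (i + j)%N) : L2space P) : Omega -> R) W_bm h0 S Sb
      (LyS _ ni) k KL0.
    - by move=> j jm; apply: lamK => //; exact: lam_cond.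
    - by split; [exact: L2spaceP|exact: pP].
    apply: (martingale_sqr_le (ltW h0) _ _ g0 (zt := l2norm _) (L := KZ)); try exact: l2norm_ge0.
      rewrite KZE; apply: le_trans nzt _; rewrite ler_wpM2l //.
        by rewrite mulr_ge0 ?sqrtr_ge0.
      by apply: ler_sum_nat => j jm; rewrite to_L2_fun //; exact: LyS.
    (* The difference of the Z-values is that of the unperturbed outputs minus [epsZ]. *)
    rewrite (@eq_l2norm _ _ _ P _ (fun w => ((Z i w - 0) 0 k - (Zb i w - epsZ i w) 0 k)
      + (-1) * epsZ i w 0 k)); last by move=> w; rewrite !mxE; ring.
    by rewrite (le_trans (l2normD Lzt (L2Z _ (LeZ _ k ni)))) // l2normZ ?LeZ // normrN1 mul1r.
  have hsum : h * \sum_k l2norm (fun w => z i w 0 k) ^+ 2 <=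
      d%:R * (2 * KZ ^+ 2 * g ^+ 2) + 2 * (h * ezq i).
    rewrite mulr_sumr (le_trans (ler_sum _ (fun k _ => zk k))) // big_split /=.
    by rewrite sumr_const card_ord [d%:R * _]mulr_natl /ezq /row_sqr_l2norm !mulr_sumr.
  apply: le_trans hsum _.
  apply: (@martingale_sum_le _ h d%:R KZ m%:R).
  - exact: ltW.
  - exact: ler0n.
  - exact: ler0n.
  - exact: row_sqr_l2norm_ge0.
  - by apply: sumr_ge0 => j _; exact: sqr_ge0.
  - have := sqr_sum_le (fun j => nrm ip (v (i + j)%N - p (v (i + j)%N))) 1 m.+1.
    by rewrite subn1.
  - by rewrite /K -[leRHS]addrA lerDr !mulr_ge0 ?sqr_ge0 ?ler0n.
have Q_le : \sum_(n.+1 <= s < (n + m).+1) nrm ip (v s) ^+ 2 +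
   \sum_(0 <= i < n.+1) (h * ezq i + h^-1 * eq i) <=
   m%:R * (\big[Num.max/0]_(n.+1 <= k < N.+1) l2norm (y k) ^+ 2 +
  \sum_(0 <= i < n.+1) (h * row_sqr_l2norm (epsZ i) + h^-1 * l2norm (epsY i) ^+ 2)).
  rewrite mulrDr lerD //.
    rewrite nmN [in leRHS](_ : m = N.+1 - n.+1)%N; last by rewrite subSS -nmN addKn.
    rewrite (le_trans _ (sum_le_bigmax _)) //; last by move=> i _; exact: sqr_ge0.
    by apply: ler_sum_nat => i /andP[_ iN]; rewrite nv.
  rewrite ler_peMl ?ler1n //; apply: sumr_ge0 => i _.
  by rewrite addr_ge0 // mulr_ge0 ?row_sqr_l2norm_ge0 ?sqr_ge0 // ?invr_ge0 ltW.
move: Cy Cz Q_le; set B := (X in _ <= m%:R * X); set Q := (X in X <= m%:R * B).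
move=> Cy Cz QB; have CQ : C * Q <= C * m%:R * B by rewrite -mulrA ler_wpM2l.
rewrite [leRHS](_ : _ = 2 * C * m%:R * B) //.
rewrite [leRHS](_ : _ = C * m%:R * B + C * m%:R * B); last by ring.
have Q0 : 0 <= C * Q by apply: le_trans (Cy 0%N _); rewrite ?sqr_ge0.
rewrite lerD // (le_trans _ CQ) //.
  rewrite big_nat; apply: bigmax_le => // i ib.
  by rewrite -nv ?Cy // (leq_trans _ nN) // -ltnS (andP ib).2.
rewrite (le_trans _ Cz) //; apply: ler_sum_nat => i ib.
by rewrite /zq -ltnS (andP ib).2.
Qed.

End sufficiency.

Section necessity.
Context (R : realType) (dO : measure_display) (Omega : measurableType dO).
Context (P : probability Omega R) (d : nat) (T : R).
Context (W X : R -> Omega -> 'cV[R]_d).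
Context (f : R -> 'cV[R]_d -> R -> 'rV[R]_d -> R).
Context (m : nat) (alphat gammat alpha gamma : nat -> R).
Context (lam : R -> nat -> R).
Local Notation L2P := (Lfun P 2%:E).
Local Notation l2norm := (l2norm P).
Local Notation row_l2norm := (row_l2norm P).
Local Notation row_sqr_l2norm := (row_sqr_l2norm P).
Local Notation step := (step P W X f m alphat gammat alpha gamma lam).

Lemma l2norm_cst (c : R) : l2norm (fun=> c) = `|c|.
Proof. by rewrite /l2norm Ex_cst sqrtr_sqr. Qed.

Lemma l2norm_eq0 x : (forall w, x w = 0) -> l2norm x = 0.
Proof. by move=> x0; rewrite (@eq_l2norm _ _ _ P _ (fun=> 0)) // l2norm_cst normr0. Qed.

Lemma condexp_cst gens (c : R) : is_condexp P <<s gens>> (fun=> c) (fun=> c).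
Proof.
split=> //; try exact: L1_cst.
by apply: measurable_wrtI; exact: measurable_cst.
Qed.

Lemma L2_cst gens (c : R) : L2 P <<s gens>> (fun=> c).
Proof.
split; last exact: (Lfun_cst P c 2).
by apply: measurable_wrtI; exact: measurable_cst.
Qed.

Hypothesis T_gt0 : 0 < T.
Hypothesis W_bm : brownian_motion P W.
Hypothesis X_L2 : forall t, 0 <= t <= T -> L2_mx P (natural_filtration W t) (X t).
Hypothesis m_gt0 : (0 < m)%N.
Variable Lf : R.
Hypothesis Lf_ge0 : 0 <= Lf.
Hypothesis f_lip : forall t : R, 0 <= t <= T -> forall x1 x2 y1 y2 z1 z2,
  `|f t x1 y1 z1 - f t x2 y2 z2| <= Lf * (enorm (x1 - x2) + `|y1 - y2| + enorm (z1 - z2)).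
Let D := drift_const T m alphat gammat gamma Lf.

Let gm (t : R) := past_events_measurable W_bm (t := t).

Lemma L2D_wrt gens x y : L2 P <<s gens>> x -> L2 P <<s gens>> y ->
  L2 P <<s gens>> (fun w => x w + y w).
Proof.
move=> [mx Lx] [my Ly]; split; last exact: L2D.
by apply: measurable_wrtI; apply: measurable_funD; exact: measurable_wrtE.
Qed.

Lemma L2B_wrt gens x y : L2 P <<s gens>> x -> L2 P <<s gens>> y ->
  L2 P <<s gens>> (fun w => x w - y w).
Proof.
move=> [mx Lx] [my Ly]; split; last exact: L2B.
by apply: measurable_wrtI; apply: measurable_funB; exact: measurable_wrtE.
Qed.

(* Shifting an exact step by a deterministic solution [c] of the recurrence costs
   a perturbation of order [h]. *)
Lemma shifted_step h i Y Z Yb Zb Yt (c : nat -> R) : 0 < h -> (i + m)%:R * h <= T ->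
  lambda_cond m h (lam h) ->
  (forall j, (i <= j <= i + m)%N -> square_adapted P W h j Y Z) ->
  step h i Y Z Yt (Y i) (Z i) ->
  (forall j, (i <= j <= i + m)%N -> Yb j = (fun w => Y j w + c j) /\ Zb j = Z j) ->
  c i = \sum_(1 <= j < m.+1) alpha j * c (i + j)%N ->
  exists eY eZ, [/\ L2 P (natural_filtration W (i%:R * h)) eY,
    L2_mx P (natural_filtration W (i%:R * h)) eZ,
    exists Ytb, step h i Yb Zb Ytb (fun w => Yb i w - eY w) (fun w => Zb i w - eZ w),
    l2norm eY <= D * h * \sum_(1 <= j < m.+1) `|c (i + j)%N| & row_sqr_l2norm eZ = 0].
Proof.
move=> h0 ihT lamh LYZ S Ybc cE.
have ij j : (1 <= j < m.+1)%N -> (i <= i + j <= i + m)%N by lia.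
have ii : (i <= i <= i + m)%N by lia.
have LYZb j : (i <= j <= i + m)%N -> square_adapted P W h j Yb Zb.
  move=> jm; have [Ly Lz] := LYZ _ jm; rewrite /square_adapted.
  have [-> ->] := Ybc _ jm; split=> //.
  by apply: (L2D_wrt Ly); exact: L2_cst.
(* An exact step is run on the shifted data; the perturbations are the gaps between the prescribed
   [Yb i], [Zb i] and its outputs. *)
have [|zt [Lzt Szt]] := step_exists alphat gammat alpha gamma lam W_bm X_L2 Lf_ge0 f_lip h0 ihT (Y := Yb) (Z := Zb).
  by move=> j jm; apply: LYZb; lia.
have [//||Ytb [v [Lv Sv]]] := Szt Zb; first by have [] := LYZb _ ii.
have ZbE j : (i <= j <= i + m)%N -> Zb j = Z j by move=> /Ybc[].
have yE j w : (i <= j <= i + m)%N -> Yb j w - Y j w = c j.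
  by move=> /Ybc[-> _]; rewrite addrC addKr.
have l2y j : (i <= j <= i + m)%N -> l2norm (fun w => Yb j w - Y j w) = `|c j|.
  by move=> jm; rewrite -l2norm_cst; apply: eq_l2norm => w; exact: yE.
have Ly j : (1 <= j < m.+1)%N -> (fun w => Yb (i + j)%N w - Y (i + j)%N w) \in L2P.
  by move=> /ij jm; have [[_ Lb] _] := LYZb _ jm; have [[_ L] _] := LYZ _ jm; exact: L2B.
have Lz j k : (j <= m)%N -> (fun w => (Zb (i + j)%N w - Z (i + j)%N w) 0 k) \in L2P.
  move=> jm; rewrite ZbE; last by rewrite leq_addr leq_add2l.
  rewrite (_ : (fun w => _) = fun=> 0); first exact: (Lfun_cst P 0 2).
  by apply/funext => w; rewrite subrr mxE.
have nz0 j : (i <= j <= i + m)%N -> row_l2norm (fun w => Zb j w - Z j w) = 0.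
  move=> jm; apply: big1 => k _; apply: l2norm_eq0 => w.
  by rewrite ZbE // subrr mxE.
have [rho [Lrho l2rho crho]] := step_difference_Y T_gt0 W_bm m_gt0 Lf_ge0 f_lip h0 ihT Sv S Ly Lz.
have [KL KL0 lamK] := lambda_bound R m.
have zk k : l2norm (fun w => Zb i w 0 k - zt w 0 k) = 0.
  (* With p equal to the deterministic shift, y - p vanishes identically: adding constants to Y does
     not change Z, up to a null set. *)
  have [||Lzk l2zk] := step_difference_Z (p := fun j => fun=> c (i + j)%N) W_bm h0 Sv S Ly k KL0.
  - by move=> j jm; exact: lamK.
  - by move=> j jm; have [] := @L2_cst (past_events W (i%:R * h)) (c (i + j)%N).
  rewrite big_nat big1 ?mulr0 in l2zk; last first.
    move=> j jm; apply: l2norm_eq0 => w.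
    by rewrite yE ?subrr // ij.
  move: l2zk; rewrite pmulr_rle0 ?sqrtr_gt0 // => z0.
  apply/eqP; rewrite eq_le l2norm_ge0 andbT -[leLHS]l2norm_abs; apply: le_trans z0.
  by rewrite -[leRHS]l2norm_abs le_eqVlt; apply/orP; left; apply/eqP; apply: eq_l2norm => w; rewrite ZbE // distrC.
exists (fun w => Yb i w - v w), (fun w => Zb i w - zt w); split.
- by apply: L2B_wrt => //; have [] := LYZb _ ii.
- move=> i0 k; have [_ /(_ i0 k) LZi] := LYZb _ ii.
  rewrite (_ : (fun w => _) = fun w => Zb i w i0 k - zt w i0 k); last first.
    by apply/funext => w; rewrite !mxE.
  by apply: L2B_wrt => //; exact: Lzt.
- exists Ytb; rewrite (_ : (fun w => _ - _) = v); last by apply/funext => w; rewrite subKr.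
  by rewrite (_ : (fun w => _ - _) = zt) //; apply/funext => w; rewrite subKr.
- have crho' : is_condexp P (natural_filtration W (i%:R * h)) rho (fun w => v w - Y i w - c i).
    have := condexpB (@gm (i%:R * h)) erefl crho (@condexp_cst (past_events W (i%:R * h)) (c i)).
    rewrite (_ : (fun w => _ - _) = rho) //; apply/funext => w.
    rewrite addrC [X in _ + (X + _)](_ : _ = c i) ?addKr // cE.
    by apply: eq_big_nat => j jm; rewrite yE ?ij.
  rewrite -l2norm_abs (@eq_l2norm _ _ _ P _ (fun w => `|v w - Y i w - c i|)); last first.
    move=> w; rewrite distrC -addrA -opprD.
    by have [-> _] := Ybc _ ii.
  rewrite l2norm_abs (le_trans (l2norm_condexp (@gm (i%:R * h)) crho' Lrho)) // (le_trans l2rho) //.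
  rewrite nz0 // addr0 le_eqVlt; apply/orP; left; apply/eqP; congr (_ * _).
  by apply: eq_big_nat => j jm; rewrite nz0 ?ij // addr0 l2y ?ij.
- apply: big1 => k _; rewrite (@eq_l2norm _ _ _ P _ (fun w => Zb i w 0 k - zt w 0 k)).
    by rewrite zk expr0n.
  by move=> w; rewrite !mxE.
Qed.

Hypothesis lam_cond : forall N : nat, (0 < N)%N ->
  lambda_cond m (T / N%:R) (lam (T / N%:R)).

(* A solution [a] of the recurrence of length [n0] is realised, for every large [N], as the
   difference between the scheme with zero starting values and its perturbation. *)
Lemma shifted_scheme (a : nat -> R) n0 N : recurrence m alpha a -> (m <= n0 <= N)%N ->
  let h := T / N%:R in
  let c0 := D * (m%:R * \sum_(0 <= k < n0.+1) `|a k|) in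
  exists Y Z Yb Zb eY eZ, [/\
    scheme P T W X f m alphat gammat alpha gamma lam N Y Z,
    perturbed_scheme P T W X f m alphat gammat alpha gamma lam N eY eZ Yb Zb,
    forall i, (N - n0 <= i <= N)%N -> (forall w, Y i w - Yb i w = - a (N - i)%N) /\ Zb i = Z i,
    forall i, (i <= N - m)%N -> L2 P (natural_filtration W (i%:R * h)) (eY i) /\
      L2_mx P (natural_filtration W (i%:R * h)) (eZ i) &
    forall i, (i <= N - m)%N -> l2norm (eY i) <= (if (N - n0 <= i)%N then c0 * h else 0) /\
      row_sqr_l2norm (eZ i) = 0].
Proof.
move=> ra /andP[mn0 n0N] h c0.
set n := (N - m)%N; set lo := (N - n0)%N.
have [F1 F2 F3] : [/\ n.+1 + m <= N.+1, lo + m <= N.+1 & lo <= n]%N by rewrite /n /lo; split; lia.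
have F4 i : (i <= n)%N -> (i + m <= N)%N by rewrite /n; lia.
have F5 i j : (lo <= i)%N -> (0 <= N - (i + j) < n0.+1)%N by rewrite /lo; lia.
have F6 i j : (i <= n)%N -> (N - i - m + m - j = N - (i + j))%N by rewrite /n; lia.
have F7 i : (i <= n)%N -> (N - i = N - i - m + m)%N by rewrite /n; lia.
have N0 : (0 < N)%N by lia.
have h0 : 0 < h by rewrite divr_gt0 // ltr0n.
have NhT : N%:R * h <= T by rewrite /h mulrC divfK // pnatr_eq0 -lt0n.
have ihT i : (i <= n)%N -> (i + m)%:R * h <= T.
  by move=> ni; apply: le_trans NhT; rewrite (ler_wpM2r (ltW h0)) // ler_nat F4.
have [|Y [Z [_ LYZ SYZ]]] := scheme_extend alphat gammat alpha gamma lam W_bm X_L2 Lf_ge0 f_lip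
    h0 F1 NhT (Y0 := fun _ => cst 0) (Z0 := fun _ => cst 0).
  move=> i _; split; first exact: L2_cst.
  move=> i0 k; rewrite (_ : (fun w => _) = cst 0); first exact: L2_cst.
  by apply/funext => w; rewrite mxE.
(* The shift is prescribed for indices from N - n0 on; below, the perturbed solution continues as an
   exact one, so its perturbations can be taken to be 0. *)
have [|Yb [Zb [Yb0 LYZb SYZb]]] := scheme_extend alphat gammat alpha gamma lam W_bm X_L2 Lf_ge0
    f_lip h0 F2 NhT (Y0 := fun i w => Y i w + a (N - i)%N) (Z0 := Z).
  move=> i /andP[_ iN]; have [Ly Lz] := LYZ _ iN; split=> //.
  by apply: L2D_wrt => //; exact: L2_cst.
pose F (i : nat) := natural_filtration W (i%:R * h).
have : forall i, exists e : (Omega -> R) * (Omega -> 'rV[R]_d), (i <= n)%N ->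
    [/\ L2 P (F i) e.1, L2_mx P (F i) e.2,
    exists Ytb, step h i Yb Zb Ytb (fun w => Yb i w - e.1 w) (fun w => Zb i w - e.2 w),
    l2norm e.1 <= (if (lo <= i)%N then c0 * h else 0) & row_sqr_l2norm e.2 = 0].
  move=> i; have [ni|] := leqP i n; last by exists (cst 0, cst 0).
  have [loi|ilo] := leqP lo i; last first.
    have [Ytb Sb] := SYZb _ ilo; exists (cst 0, cst 0) => _ /=; split.
    - exact: L2_cst.
    - move=> i0 k; rewrite (_ : (fun w => _) = cst 0); first exact: L2_cst.
      by apply/funext => w; rewrite mxE.
    - exists Ytb; rewrite (_ : (fun w => _ - _) = Yb i); last by apply/funext => w; rewrite subr0.
      by rewrite (_ : (fun w => _ - _) = Zb i) //; apply/funext => w; rewrite subr0.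
    - by rewrite l2norm_eq0.
    - by apply: big1 => k _; rewrite l2norm_eq0 ?expr0n // => w; rewrite mxE.
  have [Yt S] := SYZ i ni.
  have [|||eY [eZ [LeY LeZ Sb l2e nz2e]]] := shifted_step (c := fun j => a (N - j)%N)
      h0 (ihT _ ni) (lam_cond N0) _ S (Yb := Yb) (Zb := Zb).
  - by move=> j /andP[_ jm]; apply: LYZ; apply: leq_trans jm (F4 _ ni).
  - by move=> j /andP[ij _]; have [-> ->] := Yb0 _ (leq_trans loi ij).
  - rewrite (F7 _ ni) ra; apply: eq_bigr => j _; rewrite -F6 //.
  exists (eY, eZ) => _; split=> //=; apply: le_trans l2e _.
  rewrite /c0 mulrAC ler_wpM2r ?(ltW h0) // ler_wpM2l //; first exact: drift_const_ge0.
  rewrite [m%:R * _]mulr_natl; apply: (@le_trans _ _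
    (\sum_(1 <= j < m.+1) \sum_(0 <= k < n0.+1) `|a k|)).
    apply: ler_sum_nat => j _; rewrite (bigD1_seq (N - (i + j))%N) ?iota_uniq //=.
      by rewrite lerDl sumr_ge0.
    by rewrite mem_index_iota F5.
  by rewrite sumr_const_nat subn1.
move=> /choice[e eP]; exists Y, Z, Yb, Zb, (fun i => (e i).1), (fun i => (e i).2); split.
- split=> // i ni; have [Yt S] := SYZ i ni; exists Yt.
  suff: step h i Y Z Yt (fun w => Y i w - 0) (fun w => Z i w - 0) by [].
  rewrite (_ : (fun w => _ - _) = Y i); last by apply/funext => w; rewrite subr0.
  by rewrite (_ : (fun w => _ - _) = Z i) //; apply/funext => w; rewrite subr0.
- by split=> // i ni; have [_ _] := eP i ni.
- move=> i /andP[loi _]; have [-> ->] := Yb0 _ loi; split=> // w.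
  by rewrite opprD addrA subrr add0r.
- by move=> i ni; have [] := eP i ni.
- by move=> i ni; have [] := eP i ni.
Qed.

(** For fixed n0 at most n0 + 1 perturbations are nonzero, each of norm at most c0 h and hence
    costing c0^2 h. As the stability constant does not see N, refining the grid makes the total at
    most 1 and leaves a bound on a(n0) free of n0. *)
Lemma stable_bounded_recurrence :
  L2_stable P T W X f m alphat gammat alpha gamma lam ->
  forall a, recurrence m alpha a -> exists M : R, forall n, `|a n| <= M.
Proof.
move=> [C stab] a ra; pose B := \sum_(0 <= k < m) a k ^+ 2.
have B0 : 0 <= B by apply: sumr_ge0 => k _; exact: sqr_ge0.
have aB k : (k < m)%N -> a k ^+ 2 <= B.
  move=> km; rewrite /B (bigD1_seq k) ?mem_index_iota ?iota_uniq //= lerDl.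
  by apply: sumr_ge0 => j _; exact: sqr_ge0.
suff sqr_le n0 : (m <= n0)%N -> a n0 ^+ 2 <= `|C| * (B + 1).
  (* From |a| <= a^2 + 1; the absolute value of [C] is taken because its sign is not prescribed. *)
  exists (B + `|C| * (B + 1) + 1) => n0.
  have CB : 0 <= `|C| * (B + 1) by rewrite mulr_ge0 // addr_ge0.
  have : a n0 ^+ 2 <= B + `|C| * (B + 1).
    case: (ltnP n0 m) => [/aB an|/sqr_le an]; first by rewrite (le_trans an) // lerDl.
    by rewrite (le_trans an) // lerDr.
  have := sqr_ge0 (`|a n0| - 1); rewrite sqrrB real_normK ?num_real // expr1n mulr1.
  by have := normr_ge0 (a n0); lra.
move=> mn0; set c0 := D * (m%:R * \sum_(0 <= k < n0.+1) `|a k|).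
have c1 : 0 <= n0.+1%:R * c0 ^+ 2 * T by rewrite mulr_ge0 ?(ltW T_gt0) // mulr_ge0 ?sqr_ge0 ?ler0n.
(* Large enough for (n0 + 1) c0^2 T / N <= 1. *)
pose N := (n0 + Num.bound (n0.+1%:R * c0 ^+ 2 * T))%N.
have n0N : (n0 <= N)%N by exact: leq_addr.
have mN : (m <= N)%N by exact: leq_trans mn0 n0N.
have N0 : (0 < N)%N by exact: leq_trans mN.
have N0R : 0 < N%:R :> R by rewrite ltr0n.
have cN : n0.+1%:R * c0 ^+ 2 * T <= N%:R.
  by rewrite (le_trans (ltW (archi_boundP c1))) // ler_nat leq_addl.
have mn0N : (m <= n0 <= N)%N by rewrite mn0.
have [Y [Z [Yb [Zb [eY [eZ [sch psch Yab Le ne]]]]]]] := shifted_scheme ra mn0N.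
have nN : (N - m <= N)%N by exact: leq_subr.
have lon : (N - n0 <= N - m)%N by rewrite leq_sub2l.
have := stab N Y Yb Z Zb eY eZ mN Le sch psch.
have start k : (N - m < k <= N)%N -> {ae P, forall w, Zb k w = Z k w}.
  move=> /andP[nk kN]; have [|_ ->] := Yab k; last exact: aeW.
  by rewrite kN andbT (leq_trans lon) // ltnW.
move=> /(_ start).
case: sch psch => LYZ _ [LYZb _].
have Ly i : (i <= N)%N -> (fun w => Y i w - Yb i w) \in L2P.
  by move=> iN; apply: L2B; [case: (LYZ _ iN) => -[]|case: (LYZb _ iN) => -[]].
have Lz i k : (i <= N)%N -> (fun w => (Z i w - Zb i w) 0 k) \in L2P.
  move=> iN; rewrite (_ : (fun w => _) = fun w => Z i w 0 k - Zb i w 0 k).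
    by apply: L2B; [case: (LYZ _ iN) => _ /(_ 0 k)[]|case: (LYZb _ iN) => _ /(_ 0 k)[]].
  by apply/funext => w; rewrite !mxE.
have LeY i : (i <= N - m)%N -> eY i \in L2P by move=> /Le[[]].
have LeZ i k : (i <= N - m)%N -> (fun w => eZ i w 0 k) \in L2P.
  by move=> /Le[_ /(_ 0 k)[]].
rewrite (stability_inequalityE (T / N%:R) C nN Ly Lz LeY LeZ).
have h0 : 0 < T / N%:R by rewrite divr_gt0.
have hcN : n0.+1%:R * (c0 ^+ 2 * (T / N%:R)) <= 1 by rewrite 2!mulrA ler_pdivrMr // mul1r.
set h := T / N%:R in h0 hcN ne *.
have l2a i : (N - n0 <= i <= N)%N -> l2norm (fun w => Y i w - Yb i w) ^+ 2 = a (N - i)%N ^+ 2.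
  move=> /Yab[yE _]; rewrite (@eq_l2norm _ _ _ P _ (fun=> - a (N - i)%N)) //.
  by rewrite l2norm_cst normrN real_normK ?num_real.
set E := \sum_(0 <= i < (N - m).+1) (h * row_sqr_l2norm (eZ i) + _).
have E1 : E <= 1.
  apply: le_trans hcN; apply: (@le_trans _ _ (\sum_(0 <= i < (N - m).+1)
      if (N - n0 <= i)%N then c0 ^+ 2 * h else 0)).
    apply: ler_sum_nat => i /andP[_ ni]; have [l2e ->] := ne i ni.
    rewrite mulr0 add0r; have := l2norm_ge0 P (eY i); case: ifP l2e => _ l2e e0.
      rewrite ler_pdivrMl // [leRHS](_ : _ = (c0 * h) ^+ 2); last by ring.
      by rewrite lerXn2r // nnegrE (le_trans e0).
    by rewrite (_ : l2norm (eY i) = 0) ?expr0n ?mulr0 //; apply/le_anti/andP.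
  rewrite (big_cat_nat (n := (N - n0)%N)) //=; last by rewrite ltnW.
  rewrite big_nat big1 ?add0r => [|i /andP[_]]; last by rewrite ltnNge => /negbTE ->.
  rewrite (eq_big_nat _ _ (F2 := fun=> c0 ^+ 2 * h)) => [|i /andP[-> _]] //.
  rewrite sumr_const_nat -[leLHS]mulr_natl ler_wpM2r ?(mulr_ge0 (sqr_ge0 _) (ltW h0)) //.
  by rewrite ler_nat leq_subLR addnS ltnS subnK // leq_subr.
have E0 : 0 <= E.
  apply: sumr_ge0 => i _; rewrite addr_ge0 ?(mulr_ge0 (ltW h0)) ?row_sqr_l2norm_ge0 //.
  by rewrite mulr_ge0 ?sqr_ge0 // invr_ge0 ltW.
set M := \big[Num.max/0]_((N - m).+1 <= k < N.+1) _.
have M0 : 0 <= M by exact: bigmax_ge_id.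
have MB : M <= B.
  rewrite /M big_nat; apply: bigmax_le => // k /andP[nk kN].
  rewrite l2a; first by rewrite aB // ltn_subLR // addnC -ltn_subLR.
  by rewrite (leq_trans lon) // ltnW.
move=> stabN; rewrite -(subKn n0N) -l2a ?leqnn ?leq_subr //.
apply: (@le_trans _ _ (`|C| * (M + E))); last by rewrite ler_wpM2l // lerD.
apply: (@le_trans _ _ (C * (M + E))); last by rewrite ler_wpM2r ?ler_norm // addr_ge0.
apply: le_trans stabN; apply: (@le_trans _ _ (\big[Num.max/0]_(0 <= i < (N - m).+1)
   l2norm (fun w => Y i w - Yb i w) ^+ 2)).
  by apply: (@Order.TotalTheory.le_bigmax_seq _ _ _ _ 0 (N - n0)%N xpredT (fun i => l2norm (fun w => Y i w - Yb i w) ^+ 2)) => //;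
     rewrite mem_index_iota ltnS.
by rewrite lerDl; apply: sumr_ge0 => i _; rewrite mulr_ge0 ?(ltW h0) // row_sqr_l2norm_ge0.
Qed.

End necessity.

Theorem theorem3p6 (R : realType) (dO : measure_display)
  (Omega : measurableType dO) (P : probability Omega R)
  (d : nat) (d_gt0 : (0 < d)%N) (T : R) (T_gt0 : 0 < T)
  (W : R -> Omega -> 'cV[R]_d) (W_bm : brownian_motion P W)
  (x0 : 'cV[R]_d)
  (b : R -> 'cV[R]_d -> 'cV[R]_d) (sigma : R -> 'cV[R]_d -> 'M[R]_d)
  (b_lip : lipschitz_x T b) (sigma_lip : lipschitz_x T sigma)
  (X : R -> Omega -> 'cV[R]_d) (X_sde : sde_solution P T W x0 b sigma X)
  (f : R -> 'cV[R]_d -> R -> 'rV[R]_d -> R)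
  (Phi : 'cV[R]_d -> R)
  (m : nat) (m_gt0 : (0 < m)%N)
  (alphat gammat alpha gamma : nat -> R) (gamma0_neq0 : gamma 0%N != 0)
  (lam : R -> nat -> R)
  (lam_cond : forall N : nat, (0 < N)%N ->
     lambda_cond m (T / N%:R) (lam (T / N%:R)))
  (f_lip : exists2 Lf : R, 0 <= Lf &
     forall t1 t2 x1 x2 y1 y2 z1 z2,
       0 <= t1 <= T -> 0 <= t2 <= T ->
       `|f t1 x1 y1 z1 - f t2 x2 y2 z2| <=
         Lf * (Num.sqrt `|t1 - t2| + enorm (x1 - x2) + `|y1 - y2|
               + enorm (z1 - z2)))
  (Phi_meas : measurable_wrt (@borel R d) Phi)
  (Phi_bdd : exists M : R, forall x, `|Phi x| <= M) :
  L2_stable P T W X f m alphat gammat alpha gamma lam <->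
  dahlquist_root_condition (char_poly_scheme m alpha).
Proof.
have [Lf Lf0 lip] := f_lip.
(* The driver is only ever compared with itself at equal times, where the square-root term
   vanishes. *)
have lip_t t : 0 <= t <= T -> forall x1 x2 y1 y2 z1 z2, `|f t x1 y1 z1 - f t x2 y2 z2| <=
    Lf * (enorm (x1 - x2) + `|y1 - y2| + enorm (z1 - z2)).
  move=> tT x1 x2 y1 y2 z1 z2; have := lip t t x1 x2 y1 y2 z1 z2 tT tT.
  by rewrite subrr normr0 sqrtr0 add0r.
have [X_L2 _ _ _ _] := X_sde.
split=> [stab|dahl].
- apply: bounded_recurrence_dahlquist => a.
  exact: (stable_bounded_recurrence T_gt0 W_bm X_L2 m_gt0 Lf0 lip_t lam_cond stab).
- apply: (bounded_recurrence_stable X alphat gammat gamma T_gt0 W_bm m_gt0 Lf0 lip_t lam_cond) => a.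
  exact: recurrence_bounded.
Qed.
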